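(* Fix a finite set $\Sigma$ with $|\Sigma|\geq 2$. For every finite family $\mathcal{F}$ of ordered graphs $F:\binom{[n_F]}{2}\to\Sigma$ and every $\epsilon>0$ there exists $\delta=\delta(\mathcal{F},\epsilon)>0$ such that every ordered graph $G:\binom{[n]}{2}\to\Sigma$ that is $\epsilon$-far from $\mathcal{F}$-freeness contains, for some $F\in\mathcal{F}$ with $q=n_F$ vertices, at least $\delta n^q$ induced copies of $F$.
   Context: For $U\subseteq[n]$ with elements $u_1<\dots<u_k$, the ordered subgraph of $G$ on $U$ is $H:\binom{[k]}{2}\to\Sigma$, $H(ij)=G(u_iu_j)$ for $i<j$. An induced copy of $F$ in $G$ is a set $U$ of $n_F$ vertices whose ordered subgraph equals $F$. $G$ is $\mathcal{F}$-free if none of its ordered subgraphs is in $\mathcal{F}$, and $\epsilon$-far from $\mathcal{F}$-freeness if one must change $G(ij)$ for at least $\epsilon\binom{n}{2}$ pairs $ij$ to make it $\mathcal{F}$-free. *)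

(* Defs.v *)
From HB Require Import structures.
From mathcomp Require Import all_boot all_order all_algebra.
From mathcomp Require Import reals.
Set Implicit Arguments.
Unset Strict Implicit.
Unset Printing Implicit Defensive.
Import Order.TTheory GRing.Theory Num.Theory.
Local Open Scope ring_scope.

Definition vpair (n : nat) := {e : {set 'I_n} | #|e| == 2}.

Definition ograph (S : finType) (n : nat) := {ffun vpair n -> S}.

(* An ordered graph together with its number of vertices, which is its [tag]. *)
Definition anyograph (S : finType) := {k : nat & {ffun vpair k -> S}}.

Definition to_anyograph (S : finType) (n : nat) (G : ograph S n) : anyograph S :=
  @Tagged nat n (fun k => {ffun vpair k -> S}) G.

Lemma vpair_image_proof (n : nat) (U : {set 'I_n}) (e : vpair #|U|) :
  #|[set enum_val i | i in val e]| == 2.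
Proof. by rewrite card_imset ?(valP e)//; exact: enum_val_inj. Qed.

Definition vpair_image (n : nat) (U : {set 'I_n}) (e : vpair #|U|) : vpair n :=
  exist _ [set enum_val i | i in val e] (vpair_image_proof e).

(* [enum_val] lists the elements of U in increasing order. *)
Lemma enum_val_lt (n : nat) (U : {set 'I_n}) (i j : 'I_#|U|) :
  (i < j)%N -> (enum_val i < enum_val j)%N.
Proof.
move=> ij; have n_gt0 : 'I_n := enum_val i.
have srt : sorted ltn (map val (enum U)).
  rewrite {1}/enum_mem -enumT /=.
  apply: (subseq_sorted ltn_trans (map_subseq val (filter_subseq _ _))).
  by rewrite val_enum_ord iota_ltn_sorted.
rewrite !(enum_val_nth n_gt0) -!(nth_map n_gt0 0%N val) -?cardE//.
by apply: (sorted_ltn_nth ltn_trans) => //; rewrite inE size_map -cardE.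
Qed.

Definition osub (S : finType) (n : nat) (G : ograph S n) (U : {set 'I_n}) :
    ograph S #|U| :=
  [ffun e => G (vpair_image e)].

Definition copies (S : finType) (n : nat) (F : anyograph S) (G : ograph S n) :
    {set {set 'I_n}} :=
  [set U | to_anyograph (osub G U) == F].

Definition ofree (S : finType) (n : nat) (Fam : seq (anyograph S))
    (G : ograph S n) : Prop :=
  forall U : {set 'I_n}, to_anyograph (osub G U) \notin Fam.

Definition odist (S : finType) (n : nat) (G G' : ograph S n) : nat :=
  #|[set e | G e != G' e]|.

(* The first conjunct matters only when n <= 1 (see [ofarE]): there
   'C(n, 2) = 0, and the distance bound alone would make even a Fam-free
   graph far from Fam-freeness. *)
Definition ofar (R : realType) (S : finType) (n : nat) (eps : R)
    (Fam : seq (anyograph S)) (G : ograph S n) : Prop :=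
  ~ ofree Fam G /\
  forall G' : ograph S n, ofree Fam G' ->
    eps * 'C(n, 2)%:R <= (odist G G')%:R.

Lemma ofarE (R : realType) (S : finType) (n : nat) (eps : R)
    (Fam : seq (anyograph S)) (G : ograph S n) : 0 < eps -> (1 < n)%N ->
  ofar eps Fam G <->
  forall G' : ograph S n, ofree Fam G' ->
    eps * 'C(n, 2)%:R <= (odist G G')%:R.
Proof.
move=> eps0 n1; split=> [[]//|far]; split=> // /far.
have -> : odist G G = 0%N by apply/eqP; rewrite cards_eq0; apply/eqP/setP => e; rewrite !inE eqxx.
by rewrite leNgt mulr_gt0// ltr0n bin_gt0.
Qed.

(* Main.v *)
(* Proof idea. Refine the vertex set alternately by vertex partitions ("letters")
   and by grid intervals, each time until the energy (the mean square of the
   conditional colour densities, or of the letter frequencies in the intervals)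
   can no longer be increased much by any refinement of bounded size; this gives
   A1 on scale m1, then A2 on scale m2, then PS, then PT, each stable with respect
   to the later ones with an error tiny compared to the sizes of the earlier ones.
   In every interval j of scale m1 pick a random subinterval of scale m2, and for
   each letter a of A1 a random cell of A2 inside it; its density to the other
   picked cells is typical.  Split the picked subinterval into t blocks, where
   each picked cell is still evenly represented, and pick a random cell z(j,a,s)
   of PS in each block s.  The colours between blocks of the same interval are
   made independent of the blocks by Ramsey's theorem.  Recolour G: inside an
   interval use the Ramsey colours, between intervals remove the colours that are
   rare between the picked cells.  The result is close to G, and a copy of F in it
   selects cells of PS, in increasing position, between which the needed colours
   are all dense; as PT is cut-regular, G has many copies of F there. *)
Require Import Defs.
From mathcomp Require Import all_boot all_order all_algebra.
From mathcomp Require Import reals boolp.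
From mathcomp Require Import ring lra zify.
Set Implicit Arguments.
Unset Strict Implicit.
Unset Printing Implicit Defensive.
Import Order.TTheory GRing.Theory Num.Theory.
Local Open Scope ring_scope.

(** * Conditional expectations and energy *)

(** The obstacle is the order: the cells of a regularity partition are spread over all vertices, so
    a product of cells need not consist of increasing tuples. Cells are therefore picked inside
    intervals. But several vertices of a copy may fall into one interval, even with the same letter.
    The blocks provide for this: the vertex of rank i in a copy uses block [h i] of its interval,
    whatever its letter, and Ramsey's theorem makes the colour needed between blocks [h i] and
    [h i'] depend on the two letters only. This is what permits a recolouring that sees two end
    vertices but not their ranks in a copy. Two kinds of error need different care. The distance to
    the recoloured graph involves only averages over all pairs of vertices, so the error of [A1] may
    be a constant depending on [eps] and the number of colours. The picked cells, however, must all
    be good at once; this costs their number, so the errors that control them are chosen after that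
    number is known. *)

Section CondExp.
Variables (R : realType) (T : finType) (K : eqType).
Implicit Types (f g : T -> R) (p : T -> K).

Definition cellsize p (x : T) : R := (#|[pred y | p y == p x]|)%:R.

Definition cexp p f (x : T) : R := (\sum_(y | p y == p x) f y) / cellsize p x.

(** This also expresses refinement: when [g] is a partition, every cell of [p] lies in a cell of
    [g]. *)
Definition measurable_wrt (A : Type) p (g : T -> A) := forall x y, p x = p y -> g x = g y.

Lemma cellsize_gt0 p x : 0 < cellsize p x.
Proof. by rewrite ltr0n; apply/card_gt0P; exists x; rewrite inE. Qed.

Lemma eq_cellsize p x y : p x = p y -> cellsize p x = cellsize p y.
Proof. by move=> e; rewrite /cellsize e. Qed.

Lemma cexp_measurable p f : measurable_wrt p (cexp p f).
Proof. by move=> x y e; rewrite /cexp /cellsize e. Qed.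

Lemma sum_cell_const p x (a : R) : \sum_(y | p y == p x) a = a * cellsize p x.
Proof. by rewrite sumr_const /cellsize mulr_natr. Qed.

Lemma cexp_sum p f x : \sum_(y | p y == p x) f y = cexp p f x * cellsize p x.
Proof. by rewrite /cexp divfK // gt_eqF ?cellsize_gt0. Qed.

(** [cexp p] is the orthogonal projection onto the functions constant on cells: expand the average,
    exchange the two sums and use that [g] is constant on each cell. *)
Lemma sum_cexpM p f g : measurable_wrt p g ->
  \sum_x cexp p f x * g x = \sum_x f x * g x.
Proof.
move=> mg; under eq_bigr do rewrite /cexp -mulrA [_^-1 * _]mulrC mulr_suml.
under eq_bigr => x _.
  rewrite (eq_bigr (fun y => f y * (g y / cellsize p y))); last first.
    by move=> y /eqP e; rewrite (mg _ _ e) (eq_cellsize e).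
  over.
rewrite (exchange_big_dep predT) //=; apply: eq_bigr => y _.
under eq_bigl do rewrite eq_sym.
rewrite sum_cell_const -!mulrA mulVf ?mulr1 //.
by rewrite gt_eqF ?cellsize_gt0.
Qed.

Lemma sum_cexp p f : \sum_x cexp p f x = \sum_x f x.
Proof.
have := @sum_cexpM p f (fun=> 1) (fun _ _ _ => erefl).
by under eq_bigr do rewrite mulr1; under [in RHS]eq_bigr do rewrite mulr1.
Qed.

Lemma sum_cexp_set p f (A : pred T) : measurable_wrt p A ->
  \sum_(x | A x) cexp p f x = \sum_(x | A x) f x.
Proof.
move=> mA; rewrite big_mkcond [RHS]big_mkcond /=.
transitivity (\sum_x cexp p f x * (A x)%:R).
  by apply: eq_bigr => x _; case: (A x); rewrite ?mulr1 ?mulr0.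
rewrite sum_cexpM; last by move=> x y /mA ->.
by apply: eq_bigr => x _; case: (A x); rewrite ?mulr1 ?mulr0.
Qed.

Lemma cexp_ge0 p f x : (forall y, 0 <= f y) -> 0 <= cexp p f x.
Proof. by move=> f0; rewrite divr_ge0 ?ler0n// sumr_ge0. Qed.

Lemma cexp_le1 p f x : (forall y, f y <= 1) -> cexp p f x <= 1.
Proof.
move=> f1; rewrite ler_pdivrMr ?cellsize_gt0// -sum_cell_const.
exact: ler_sum.
Qed.

(** The squared norm of the projection. It is not divided by the number of points, so the later
    bounds carry factors [n] or [n ^ 2]. *)
Definition energy p f : R := \sum_x cexp p f x ^+ 2.

Lemma energy_ge0 p f : 0 <= energy p f.
Proof. by apply: sumr_ge0 => x _; rewrite sqr_ge0. Qed.

Lemma sum_sqrB f g :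
  \sum_x (f x - g x) ^+ 2 = \sum_x f x ^+ 2 - 2 * (\sum_x f x * g x) + \sum_x g x ^+ 2.
Proof.
rewrite mulr_sumr -sumrB -big_split /=; apply: eq_bigr => x _; ring.
Qed.

Lemma energy_le_sqr p f : energy p f <= \sum_x f x ^+ 2.
Proof.
have e : \sum_x f x * cexp p f x = energy p f.
  rewrite -(sum_cexpM f (@cexp_measurable p f)).
  by apply: eq_bigr => x _; rewrite expr2.
have : 0 <= \sum_x (f x - cexp p f x) ^+ 2.
  by apply: sumr_ge0 => x _; rewrite sqr_ge0.
rewrite sum_sqrB e -/(energy p f); lra.
Qed.

End CondExp.

Section Refinement.
Variables (R : realType) (T : finType) (K K' : eqType).
Variables (f : T -> R) (p : T -> K) (q : T -> K').
Hypothesis qp : measurable_wrt q p.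

(** Pythagoras: [cexp p f] is also constant on the cells of [q], so the increment
    [cexp q f - cexp p f] is orthogonal to it. *)
Lemma energy_diff :
  \sum_x (cexp q f x - cexp p f x) ^+ 2 = energy q f - energy p f.
Proof.
have e : \sum_x cexp q f x * cexp p f x = energy p f.
  rewrite sum_cexpM; last by move=> x y /qp e; rewrite (cexp_measurable f e).
  rewrite -(sum_cexpM f (@cexp_measurable _ _ _ p f)).
  by apply: eq_bigr => x _; rewrite expr2.
rewrite sum_sqrB e -!/(energy _ _); ring.
Qed.

Lemma energy_mono : energy p f <= energy q f.
Proof.
rewrite -subr_ge0 -energy_diff.
by apply: sumr_ge0 => x _; rewrite sqr_ge0.
Qed.

End Refinement.

Section Stability.
Variables (R : realType) (X : Type) (St : X -> nat -> Type).
Variables (ok : forall x k, St x k -> Prop) (e : forall x k, St x k -> R).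
Variables (b : X -> R) (eta : R).

(** [Q] is restricted by its size and by [ok] only; it need not refine [P]. So a partition can be
    compared directly with one chosen several levels later. *)
Definition stable (r : nat) x k (P : St x k) :=
  forall k' (Q : St x k'), (k' <= r)%N -> ok Q -> e Q <= e P + eta * b x.

(* [Phi x r] weakens as [r] grows. The bound [r] on the partitions that a stable
   one has to be compared with may depend on its own size [k], so [r] is found by
   induction on the number of energy increments that are still possible. *)
Lemma stable_exists (Phi : X -> nat -> Prop) :
  0 < eta -> (forall x, 0 <= b x) ->
  (forall x k (P : St x k), 0 <= e P <= b x) ->
  (forall x r r', (r <= r')%N -> Phi x r -> Phi x r') ->
  (forall k, exists r, forall x (P : St x k), ok P -> stable r P -> Phi x r) ->
  forall k, exists r, forall x (P : St x k), ok P -> Phi x r.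
Proof.
move=> eta0 b0 eb mono H.
have main (j : nat) : forall k, exists r, forall x (P : St x k), ok P ->
    b x * (1 - j%:R * eta) <= e P -> Phi x r.
  elim: j => [|j IH] k; have [r0 Hr0] := H k.
    exists r0 => x P okP; rewrite mul0r subr0 mulr1 => bP.
    apply: (Hr0 x P) => // k' Q _ _; have /andP[_ eQ] := eb x _ Q.
    by rewrite (le_trans eQ)// (le_trans bP)// lerDl mulr_ge0// ltW.
  have [rr Hrr] := choice IH.
  (* A witness of instability has some size [k'] at most [r0], not known in advance; the maximum
     serves all of them. *)
  exists (maxn r0 (\max_(i < r0.+1) rr i)) => x P okP bP.
  have [st|/existsNP[k' /existsNP[Q]]] := pselect (stable r0 P).
    by apply: (mono x r0) (Hr0 x P okP st); rewrite leq_maxl.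
  move=> /not_implyP[k'r /not_implyP[okQ /negP]]; rewrite -ltNge => lQ.
  have kr : (k' < r0.+1)%N by rewrite ltnS.
  apply: (mono x (rr k')).
    apply: leq_trans (leq_maxr _ _).
    exact: (leq_bigmax (Ordinal kr) (F := fun i : 'I_r0.+1 => rr i)).
  apply: (Hrr k' x Q okQ); apply: ltW; apply: le_lt_trans lQ.
  have -> : b x * (1 - j%:R * eta) = b x * (1 - j.+1%:R * eta) + eta * b x.
    by rewrite -natr1; ring.
  by rewrite lerD2r.
(* With [j] at least the inverse of [eta], the lower bound on the energy required by [main] is at
   most 0. *)
move=> k; have [j hj] : exists j : nat, eta^-1 <= j%:R.
  by exists (Num.bound eta^-1); apply/ltW/archi_boundP; rewrite invr_ge0 ltW.
have [r Hr] := main j k; exists r => x P okP; apply: (Hr x P okP).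
have /andP[eP _] := eb x _ P; apply: le_trans eP.
rewrite mulr_ge0_le0// subr_le0.
by rewrite -(@ler_pdivrMr _ eta)// div1r.
Qed.

End Stability.

(** * Selection, Ramsey, and grid intervals *)

Section Selection.
Variables (R : realType) (L V : finType) (w : L -> V -> R).
Hypotheses (w0 : forall l v, 0 <= w l v) (w1 : forall l, \sum_v w l v = 1).

Let Om (y : {ffun L -> V}) : R := \prod_l w l (y l).

Lemma product_marginal1 (l : L) (phi : V -> R) :
  \sum_(y : {ffun L -> V}) Om y * phi (y l) = \sum_v w l v * phi v.
Proof.
pose F i u := w i u * (if i == l then phi u else 1).
transitivity (\sum_(y : {ffun L -> V}) \prod_i F i (y i)).
  apply: eq_bigr => y _; rewrite /F big_split /=; congr (_ * _).
  by rewrite -big_mkcond /= big_pred1_eq.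
rewrite -(bigA_distr_bigA F) (bigD1 l) //= [X in _ * X]big1 ?mulr1 => [|i /negPf il].
  by rewrite /F eqxx.
by rewrite /F -[RHS](w1 i); apply: eq_bigr => u _; rewrite il mulr1.
Qed.

(** Distinct coordinates are independent under [Om]. For a product of two one-variable functions
    this is the exchange of product and sum; a general [g] is a combination of indicators of
    pairs. *)
Lemma product_marginal2 (l l' : L) (g : V -> V -> R) : l' != l ->
  \sum_(y : {ffun L -> V}) Om y * g (y l) (y l') =
  \sum_v \sum_v' w l v * w l' v' * g v v'.
Proof.
move=> ll'.
have prodE phi psi : \sum_(y : {ffun L -> V}) Om y * (phi (y l) * psi (y l')) =
    (\sum_v w l v * phi v) * (\sum_v w l' v * psi v).
  pose F i u := w i u * ((if i == l then phi u else 1) * (if i == l' then psi u else 1)).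
  transitivity (\sum_(y : {ffun L -> V}) \prod_i F i (y i)).
    apply: eq_bigr => y _; rewrite /F !big_split /=; congr (_ * (_ * _)).
      by rewrite -big_mkcond /= big_pred1_eq.
    by rewrite -big_mkcond /= big_pred1_eq.
  rewrite -(bigA_distr_bigA F) (bigD1 l) //= (bigD1 l') //= [X in _ * (_ * X)]big1 ?mulr1.
    rewrite /F !eqxx (negPf ll') eq_sym (negPf ll'); congr (_ * _); apply: eq_bigr => u _.
      by rewrite mulr1.
    by rewrite mul1r.
  move=> i /andP[/negPf il /negPf il'].
  by rewrite /F -[RHS](w1 i); apply: eq_bigr => u _; rewrite il il' !mulr1.
transitivity (\sum_a \sum_b g a b *
    \sum_(y : {ffun L -> V}) Om y * ((y l == a)%:R * (y l' == b)%:R)).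
  under [RHS]eq_bigr do under eq_bigr do rewrite mulr_sumr.
  under [RHS]eq_bigr do rewrite exchange_big /=.
  rewrite exchange_big /=; apply: eq_bigr => y _.
  rewrite (bigD1 (y l)) //= (bigD1 (y l')) //= !eqxx big1; last first.
    by move=> b /negPf nb; rewrite eq_sym nb !mulr0.
  rewrite big1 ?addr0 => [|a /negPf na]; first by rewrite !mulr1 mulrC.
  by apply: big1 => b _; rewrite [y l == a]eq_sym na mul0r !mulr0.
apply: eq_bigr => a _; apply: eq_bigr => b _; rewrite (prodE (fun v => (v == a)%:R) (fun v => (v == b)%:R)) mulrC; congr (_ * _ * _).
  by rewrite (bigD1 a) //= eqxx mulr1 big1 ?addr0// => v /negPf->; rewrite mulr0.
by rewrite (bigD1 b) //= eqxx mulr1 big1 ?addr0// => v /negPf->; rewrite mulr0.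
Qed.

(** The first-moment method: some outcome is no worse than the average. It is taken in the support
    of the product law, so that constraints on [y l] can be encoded in the weights. *)
Lemma selection (g : L -> L -> V -> V -> R) (h : L -> V -> R) :
  exists2 y : {ffun L -> V}, forall l, 0 < w l (y l) &
    \sum_l \sum_(l' | l' != l) g l l' (y l) (y l') + \sum_l h l (y l) <=
    \sum_l \sum_(l' | l' != l) \sum_v \sum_v' w l v * w l' v' * g l l' v v' +
    \sum_l \sum_v w l v * h l v.
Proof.
pose E := \sum_l \sum_(l' | l' != l) \sum_v \sum_v' w l v * w l' v' * g l l' v v' +
  \sum_l \sum_v w l v * h l v.
pose obj (y : {ffun L -> V}) :=
  \sum_l \sum_(l' | l' != l) g l l' (y l) (y l') + \sum_l h l (y l).
have Om0 y : 0 <= Om y by apply: prodr_ge0.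
have Om1 : \sum_y Om y = 1.
  by rewrite -(bigA_distr_bigA w) big1.
have EO : \sum_y Om y * obj y = E.
  under eq_bigr do rewrite mulrDr !mulr_sumr.
  rewrite big_split /=; congr (_ + _); rewrite exchange_big /=.
    apply: eq_bigr => l _; under eq_bigr do rewrite mulr_sumr.
    by rewrite exchange_big /=; apply: eq_bigr => l' /product_marginal2.
  by apply: eq_bigr => l _; apply: product_marginal1.
have [//|no] := pselect (exists2 y : {ffun L -> V}, forall l, 0 < w l (y l) & obj y <= E).
have Om_gt0 y : Om y != 0 -> forall l, 0 < w l (y l).
  by move=> yn0 l; rewrite lt_def w0 andbT; move/prodf_neq0: yn0 => ->.
have objE y : Om y != 0 -> 0 < obj y - E.
  by move=> yn0; rewrite subr_gt0 ltNge; apply/negP => le; apply: no; exists y => //; apply: Om_gt0.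
(* If all outcomes in the support exceeded the average, this vanishing sum would have nonnegative
   terms, so every probability would be 0. *)
have /psumr_eq0P z : \sum_y Om y * (obj y - E) = 0.
  by under eq_bigr do rewrite mulrBr; rewrite sumrB -mulr_suml Om1 EO mul1r subrr.
have Omz y : Om y = 0.
  apply/eqP/negPn/negP => yn0; move: (objE _ yn0).
  have := z _ y isT; move=> /(_ _)/eqP; rewrite mulf_eq0 (negPf yn0) /=.
  rewrite -subr_eq0 subr0 => H; rewrite (eqP (H _)) ?ltxx // => u _.
  have [->|/objE/ltW ou] := eqVneq (Om u) 0; first by rewrite mul0r.
  by rewrite mulr_ge0.
by move: Om1; rewrite big1 // => /eqP; rewrite eq_sym oner_eq0.
Qed.

End Selection.

(** First find a long sequence in which the colour of a pair depends on its first element only, then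
    apply the pigeonhole principle to these colours. *)
Lemma ramsey_pairs (C : finType) (c0 : C) (Q : nat) : exists t, forall col : nat -> nat -> C,
  exists (h : nat -> nat) (c : C),
    [/\ forall i, (i < Q)%N -> (h i < t)%N,
        forall i j, (i < j < Q)%N -> (h i < h j)%N &
        forall i j, (i < j < Q)%N -> col (h i) (h j) = c].
Proof.
have pigeon (A : eqType) (f : A -> C) (s : seq A) m : (#|C| * m <= size s)%N ->
    exists c, (m <= size [seq x <- s | f x == c])%N.
  move=> le; apply: contrapT => /forallNP no.
  have : (size s < #|C| * m)%N; last by rewrite ltnNge le.
  have -> : size s = (\sum_c size [seq x <- s | f x == c])%N.
    elim: s {le no} => [|x s IH] /=; first by rewrite big1.
    rewrite (bigD1 (f x)) //= eqxx IH (bigD1 (f x)) //= addSn; congr (_.+1 + _)%N.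
    by apply: eq_bigr => c /negPf; rewrite eq_sym => ->.
  rewrite -sum_nat_const; apply: (@leq_trans (\sum_(c : C) (size [seq x <- s | f x == c]).+1)).
    rewrite (bigD1 c0) //= [X in (_ <= X)%N](bigD1 c0) //= addSn ltnS leq_add2l.
    by apply: leq_sum => c _.
  by apply: leq_sum => c _; rewrite ltnNge; apply/negP/no.
(* Each entry of [r] pairs a number with the colour that it has with all later ones. *)
have step m : exists N, forall (col : nat -> nat -> C) (s : seq nat), (N <= size s)%N ->
    exists r : seq (nat * C), [/\ size r = m, subseq (map fst r) s &
      pairwise (fun p q => col p.1 q.1 == p.2) r].
  elim: m => [|m [N IH]]; first by exists 0%N => col s _; exists [::]; rewrite sub0seq.
  exists (#|C| * N).+1 => col [//|x s] /=; rewrite ltnS => le.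
  have [c lec] := pigeon _ (col x) s N le.
  have [r [sr sub pr]] := IH col _ lec.
  exists ((x, c) :: r) => /=; rewrite eqxx pr andbT.
  split; [by rewrite sr|exact: subseq_trans sub (filter_subseq _ _)|].
  apply/allP => -[y d] yr /=.
  have : y \in [seq y <- s | col x y == c].
    by apply: (mem_subseq sub); apply/mapP; exists (y, d).
  by rewrite mem_filter => /andP[].
(* Among [#|C| * Q] entries some colour occurs [Q] times. *)
have [N HN] := step (#|C| * Q)%N; exists N => col.
have [r [sr sub pr]] := HN col (iota 0 N) (eq_leq (esym (size_iota 0 N))).
have [c lec] := pigeon _ snd r Q (eq_leq (esym sr)).
set r' := [seq x <- r | _] in lec.
have prr' : pairwise (fun p q => col p.1 q.1 == p.2) r'.
  exact: (subseq_pairwise (filter_subseq _ _) pr).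
have sub' : subseq (map fst r') (iota 0 N).
  exact: subseq_trans (map_subseq _ (filter_subseq _ _)) sub.
have srt : sorted ltn (map fst r') by apply: (subseq_sorted ltn_trans sub'); apply: iota_ltn_sorted.
have szr : size (map fst r') = size r' by rewrite size_map.
exists (nth 0%N (map fst r')), c; split.
- move=> i iQ; have : nth 0%N (map fst r') i \in iota 0 N.
    by apply: (mem_subseq sub'); rewrite mem_nth// szr (leq_trans iQ).
  by rewrite mem_iota.
- move=> i j /andP[ij jQ]; apply: (sorted_ltn_nth ltn_trans) => //;
    by rewrite inE szr; apply: leq_trans lec => //; apply: ltn_trans jQ.
- move=> i j /andP[ij jQ].
  have jr : (j < size r')%N by apply: leq_trans lec.
  have ir : (i < size r')%N by apply: ltn_trans jr.
  rewrite !(nth_map (0%N, c0)) //.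
  move/(pairwiseP (0%N, c0)): prr' => /(_ i j ir jr ij)/eqP ->.
  have := mem_nth (0%N, c0) ir; rewrite mem_filter => /andP[/eqP] //.
Qed.

Section Grid.
Variable n : nat.

(** The index of the interval of [x] among [m] nearly equal ones. With this rounding the grids of
    scales [m] and [m * d] nest exactly, as [pos_divn] shows. *)
Definition pos (m : nat) (x : 'I_n) : nat := ((x * m) %/ n)%N.

Lemma pos_lt m (x : 'I_n) : (0 < m)%N -> (pos m x < m)%N.
Proof.
move=> m0; have n0 : (0 < n)%N by apply: leq_ltn_trans (ltn_ord x).
by rewrite ltn_divLR// mulnC ltn_pmul2l.
Qed.

Lemma pos_divn m d (x : 'I_n) : (0 < d)%N -> (pos (m * d) x %/ d)%N = pos m x.
Proof. by move=> d0; rewrite /pos -divnMA mulnA divnMr. Qed.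

Lemma pos_mono m (x y : 'I_n) : (x <= y)%N -> (pos m x <= pos m y)%N.
Proof. by move=> xy; rewrite leq_div2r// leq_mul2r xy orbT. Qed.

Lemma pos_lt_lt m (x y : 'I_n) : (pos m x < pos m y)%N -> (x < y)%N.
Proof. by rewrite !ltnNge; apply: contra; apply: pos_mono. Qed.

Lemma card_ord_range (a b : nat) :
  #|[pred y : 'I_n | (a <= y < b)%N]| = (minn n b - minn n a)%N.
Proof.
rewrite -sum1_card big_mkcond /=.
have -> : (\sum_(i < n) (if i \in [pred y : 'I_n | (a <= y < b)%N] then 1 else 0) =
   \sum_(i < n) (if (a <= i < b)%N then 1 else 0))%N by apply: eq_bigr => i _; rewrite inE.
elim: n => [|k IH]; first by rewrite big_ord0 !min0n.
by rewrite big_ord_recr /= IH; case: ifP; lia.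
Qed.

Lemma card_pos m j : (0 < m)%N -> (j < m)%N ->
  (n <= m * #|[pred y : 'I_n | pos m y == j]| + m /\
   m * #|[pred y : 'I_n | pos m y == j]| <= n + m)%N.
Proof.
move=> m0 jm.
have [n0|n_gt0] := posnP n.
  have -> : #|[pred y : 'I_n | pos m y == j]| = 0%N.
    by apply: eq_card0 => y; have := ltn_ord y; rewrite {2}n0.
  by rewrite n0; lia.
(* The ceiling of [k * n / m], the first point of interval [k]. *)
pose c k := ((k * n + (m - 1)) %/ m)%N.
have cE k (y : nat) : (c k <= y)%N = (k * n <= y * m)%N.
  rewrite /c -ltnS ltn_divLR //; apply/idP/idP; nia.
have -> : #|[pred y : 'I_n | pos m y == j]| = #|[pred y : 'I_n | (c j <= y < c j.+1)%N]|.
  apply: eq_card => y; rewrite !inE /pos [(_ < c _)%N]ltnNge !cE -ltnNge.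
  by rewrite eqn_leq andbC leq_divRL// -[X in _ && X = _]ltnS ltn_divLR.
rewrite card_ord_range.
have cj k : (k <= m)%N -> (k * n <= m * c k < k * n + m /\ c k <= n)%N.
  move=> km; have d := divn_eq (k * n + (m - 1)) m.
  have l := ltn_pmod (k * n + (m - 1)) m0; rewrite -/(c k) in d.
  split; first by nia.
  by rewrite cE mulnC leq_mul2l km orbT.
have [A1 A2] := cj j (ltnW jm); have [B1 B2] := cj j.+1 jm.
rewrite (minn_idPr A2) (minn_idPr B2); nia.
Qed.

End Grid.

(** * Counting *)

Section Counting.
Variables (R : realType) (V : finType) (q : nat).
Implicit Types (x : {ffun 'I_q -> V}) (i j k : 'I_q) (u v : V).

Definition upd x i u : {ffun 'I_q -> V} := [ffun k => if k == i then u else x k].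

Lemma updE x i u k : upd x i u k = if k == i then u else x k.
Proof. by rewrite ffunE. Qed.

(** Exchanging the coordinate [x i] with [u] is an involution on the pairs [(x, u)]. *)
Lemma sum_upd (H : {ffun 'I_q -> V} -> R) i :
  \sum_x \sum_u H (upd x i u) = #|V|%:R * \sum_x H x.
Proof.
rewrite mulr_sumr pair_bigA /=.
pose sw (p : {ffun 'I_q -> V} * V) := (upd p.1 i p.2, p.1 i).
have swK : involutive sw.
  move=> [x u]; rewrite /sw /= updE eqxx; congr (_, _).
  by apply/ffunP => k; rewrite !updE; case: eqP => [->|].
rewrite (reindex_inj (inv_inj swK)) /=.
have updK x u : upd (upd x i u) i (x i) = x.
  by apply/ffunP => k; rewrite !updE; case: eqP => [->|].
under eq_bigr do rewrite updK.
rewrite -(pair_bigA _ (fun x u => H x)) /=; apply: eq_bigr => x _.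
by rewrite sumr_const mulr_natl.
Qed.

(* Used to isolate the dependence of a product on two of its coordinates. *)
Lemma sum_upd2 (H : {ffun 'I_q -> V} -> R) i j :
  \sum_x \sum_u \sum_v H (upd (upd x i u) j v) = #|V|%:R ^+ 2 * \sum_x H x.
Proof.
rewrite (sum_upd (fun x => \sum_v H (upd x j v))) sum_upd; ring.
Qed.

Definition unit_fun (phi : V -> R) := forall u, 0 <= phi u <= 1.

(** With all other coordinates fixed, [H] is a product of a function of coordinate [i] and one of
    coordinate [j]; cut bounds apply to weights of exactly this form. *)
Definition splits i j (H : {ffun 'I_q -> V} -> R) := forall x,
  exists phi psi, [/\ unit_fun phi, unit_fun psi &
    forall u v, H (upd (upd x i u) j v) = phi u * psi v].

Lemma splitsM i j H H' : splits i j H -> splits i j H' ->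
  splits i j (fun x => H x * H' x).
Proof.
move=> sH sH' x; have [f [g [uf ug e]]] := sH x; have [f' [g' [uf' ug' e']]] := sH' x.
have M01 (a b : R) : 0 <= a <= 1 -> 0 <= b <= 1 -> 0 <= a * b <= 1.
  by move=> /andP[a0 a1] /andP[b0 b1]; rewrite mulr_ge0//= mulr_ile1.
exists (fun u => f u * f' u), (fun u => g u * g' u); split.
- by move=> u; apply: M01.
- by move=> u; apply: M01.
- by move=> u v; rewrite e e' mulrACA.
Qed.

Lemma unit_fun1 : unit_fun (fun=> 1).
Proof. by move=> u; rewrite ler01 lexx. Qed.

Lemma splits_prod (I : eqType) (r : seq I) (F : I -> {ffun 'I_q -> V} -> R) i j :
  (forall e, e \in r -> splits i j (F e)) -> splits i j (fun x => \prod_(e <- r) F e x).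
Proof.
elim: r => [|e r IH] H x.
  exists (fun=> 1), (fun=> 1); split; try exact: unit_fun1.
  by move=> u v; rewrite big_nil mulr1.
have Hr e' : e' \in r -> splits i j (F e') by move=> er; apply: H; rewrite inE er orbT.
have [f [g [uf ug E]]] := splitsM (H e (mem_head _ _)) (IH Hr) x.
by exists f, g; split => // u v; rewrite big_cons E.
Qed.

Lemma splits1 i j k (w : V -> R) : i != j -> unit_fun w -> splits i j (fun x => w (x k)).
Proof.
move=> ij uw x.
have [ki|ki] := eqVneq k i.
  by exists w, (fun=> 1); split=> // [|u v]; [exact: unit_fun1|rewrite !updE ki (negPf ij) eqxx mulr1].
have [kj|kj] := eqVneq k j.
  by exists (fun=> 1), w; split=> // [|u v]; [exact: unit_fun1|rewrite !updE kj eqxx mul1r].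
exists (fun=> w (x k)), (fun=> 1); split=> // [|u v]; first exact: unit_fun1.
by rewrite !updE (negPf ki) (negPf kj) mulr1.
Qed.

(** A pair other than [(i, j)] misses [i] or [j], so its factor depends on at most one of these two
    coordinates. *)
Lemma splits2 (i j a b : 'I_q) (g : V -> V -> R) :
  (i < j)%N -> (a < b)%N -> (a, b) != (i, j) ->
  (forall u v, 0 <= g u v <= 1) -> splits i j (fun x => g (x a) (x b)).
Proof.
move=> ij ab ne g01 x.
have nij : (i == j) = false by apply/negbTE; rewrite -val_eqE neq_ltn ij.
have nab : (b == a) = false by apply/negbTE; rewrite -val_eqE neq_ltn ab orbT.
have [ai|ai] := eqVneq a i.
  have bj : (b == j) = false by apply/negbTE; apply: contra ne => /eqP ->; rewrite ai.
  exists (fun u => g u (x b)), (fun=> 1); split=> // [|u v]; first exact: unit_fun1.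
  by rewrite !updE bj ai nij eqxx -ai nab mulr1.
have [aj|aj] := eqVneq a j.
  have bi : (b == i) = false.
    by apply/negbTE; rewrite -val_eqE neq_ltn (ltn_trans ij _) ?orbT// -aj.
  exists (fun=> 1), (fun v => g v (x b)); split=> // [|u v]; first exact: unit_fun1.
  by rewrite !updE aj eqxx -aj nab bi mul1r.
have [bi|bi] := eqVneq b i.
  exists (fun u => g (x a) u), (fun=> 1); split=> // [|u v]; first exact: unit_fun1.
  by rewrite !updE (negPf aj) (negPf ai) bi nij eqxx mulr1.
have [bj|bj] := eqVneq b j.
  exists (fun=> 1), (fun v => g (x a) v); split=> // [|u v]; first exact: unit_fun1.
  by rewrite !updE (negPf aj) (negPf ai) bj eqxx mul1r.
exists (fun=> g (x a) (x b)), (fun=> 1); split=> // [|u v]; first exact: unit_fun1.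
by rewrite !updE (negPf aj) (negPf ai) (negPf bi) (negPf bj) mulr1.
Qed.

Lemma sum_split_le (i j : 'I_q) (D : V -> V -> R) (M : R) H : (0 < #|V|)%N -> i != j ->
  (forall phi psi, unit_fun phi -> unit_fun psi ->
     \sum_u \sum_v phi u * psi v * D u v <= M * #|V|%:R ^+ 2) ->
  splits i j H -> \sum_x H x * D (x i) (x j) <= M * #|V|%:R ^+ q.
Proof.
move=> V0 ij HD sH; have V2 : 0 < #|V|%:R ^+ 2 :> R by rewrite exprn_gt0// ltr0n.
rewrite -(ler_pM2l V2) -(sum_upd2 _ i j) mulrA [_ ^+ 2 * M]mulrC.
have -> : M * #|V|%:R ^+ 2 * #|V|%:R ^+ q = \sum_(x : {ffun 'I_q -> V}) (M * #|V|%:R ^+ 2).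
  by rewrite sumr_const -[RHS]mulr_natr card_ffun card_ord natrX.
apply: ler_sum => x _; have [f [g [uf ug E]]] := sH x.
apply: le_trans (HD f g uf ug); rewrite le_eqVlt; apply/orP; left; apply/eqP.
apply: eq_bigr => u _; apply: eq_bigr => v _.
by rewrite E !updE eqxx (negPf ij) eqxx.
Qed.

Variables (w : 'I_q -> V -> R) (f T : 'I_q * 'I_q -> V -> V -> R) (lam al rho : R).
Hypothesis V_gt0 : (0 < #|V|)%N.
Hypothesis w01 : forall k, unit_fun (w k).
Hypothesis f01 : forall e u v, 0 <= f e u v <= 1.
Hypothesis T01 : forall e u v, 0 <= T e u v <= 1.

Let W x := \prod_(k <- index_enum 'I_q) w k (x k).
Let F e x := f e (x e.1) (x e.2).
Let TT e x := T e (x e.1) (x e.2).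

(** The factors [T] are replaced by [f] one pair at a time. The rest of the product splits at that
    pair, so each replacement costs one cut error. *)
Lemma counting_swap (s : seq ('I_q * 'I_q)) :
  (forall e, e \in s -> (e.1 < e.2)%N) -> uniq s ->
  (forall e phi psi, e \in s -> unit_fun phi -> unit_fun psi ->
     \sum_u \sum_v phi u * psi v * (T e u v - f e u v) <= lam * #|V|%:R ^+ 2) ->
  \sum_x W x * \prod_(e <- s) TT e x - (size s)%:R * (lam * #|V|%:R ^+ q) <=
  \sum_x W x * \prod_(e <- s) F e x.
Proof.
(* The pairs in [s1] already carry [f], those in [s2] still carry [T]. *)
suff main (s1 s2 : seq ('I_q * 'I_q)) : (forall e, e \in s1 ++ s2 -> (e.1 < e.2)%N) -> uniq (s1 ++ s2) ->
    (forall e phi psi, e \in s1 ++ s2 -> unit_fun phi -> unit_fun psi ->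
     \sum_u \sum_v phi u * psi v * (T e u v - f e u v) <= lam * #|V|%:R ^+ 2) ->
    \sum_x W x * (\prod_(e <- s1) F e x * \prod_(e <- s2) TT e x) -
      (size s2)%:R * (lam * #|V|%:R ^+ q) <=
    \sum_x W x * (\prod_(e <- s1) F e x * \prod_(e <- s2) F e x).
  move=> lts us cut; have := main [::] s lts us cut.
  under eq_bigr do rewrite big_nil mul1r.
  by under [in X in _ <= X]eq_bigr do rewrite big_nil mul1r.
elim: s2 s1 => [|e s2 IH] s1 lts us cut.
  by rewrite mul0r subr0; apply: ler_sum => x _; rewrite !big_nil.
have {IH} := IH (rcons s1 e); rewrite cat_rcons => /(_ lts us cut) IH.
have es : e \in s1 ++ e :: s2 by rewrite mem_cat mem_head orbT.
have e12 := lts e es.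
have ne12 : e.1 != e.2 by rewrite -val_eqE neq_ltn e12.
pose H x := W x * (\prod_(e <- s1) F e x * \prod_(e <- s2) TT e x).
have sH : splits e.1 e.2 H.
  apply: splitsM; first by apply: splits_prod => k _; apply: splits1.
  have ees e' : (e' \in s1) || (e' \in s2) -> e' != e /\ (e'.1 < e'.2)%N.
    move=> e's; split; last by apply: lts; rewrite mem_cat inE; case/orP: e's => ->; rewrite ?orbT.
    apply/eqP => ee; move: us; rewrite cat_uniq /= => /and3P[_ /norP[n1 _] /andP[n2 _]].
    by move: e's; rewrite ee (negPf n1) (negPf n2).
  apply: splitsM; apply: splits_prod => e' e's.
    have [|ne lt] := ees e'; first by rewrite e's.
    by apply: splits2 => //; rewrite -!surjective_pairing.
  have [|ne lt] := ees e'; first by rewrite e's orbT.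
  by apply: splits2 => //; rewrite -!surjective_pairing.
have cute phi psi : unit_fun phi -> unit_fun psi ->
    \sum_u \sum_v phi u * psi v * (T e u v - f e u v) <= lam * #|V|%:R ^+ 2.
  by apply: cut.
have := sum_split_le V_gt0 ne12 cute sH.
have -> : \sum_x H x * (T e (x e.1) (x e.2) - f e (x e.1) (x e.2)) =
   \sum_x W x * (\prod_(e <- s1) F e x * \prod_(e <- e :: s2) TT e x) -
   \sum_x W x * (\prod_(e <- rcons s1 e) F e x * \prod_(e <- s2) TT e x).
  rewrite -sumrB; apply: eq_bigr => x _.
  by rewrite /H big_cons -cats1 big_cat big_seq1 /= -/(F e x) -/(TT e x); ring.
have -> : \sum_x W x * (\prod_(e <- s1) F e x * \prod_(e <- e :: s2) F e x) =
   \sum_x W x * (\prod_(e <- rcons s1 e) F e x * \prod_(e <- s2) F e x).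
  by apply: eq_bigr => x _; rewrite big_cons -cats1 big_cat big_seq1 /=; ring.
rewrite /= -natr1; move: IH; lra.
Qed.

Lemma sum_W : \sum_x W x = \prod_k \sum_v w k v.
Proof. by rewrite bigA_distr_bigA. Qed.

Lemma sum_W_pair (i j : 'I_q) (B : V -> V -> R) : i != j ->
  \sum_u \sum_v w i u * w j v * B u v <= rho * (\sum_u \sum_v w i u * w j v) ->
  \sum_x W x * B (x i) (x j) <= rho * \sum_x W x.
Proof.
move=> ij HB; have V2 : 0 < #|V|%:R ^+ 2 :> R by rewrite exprn_gt0// ltr0n.
pose rest x := \prod_(k | (k != i) && (k != j)) w k (x k).
have WE x u v : W (upd (upd x i u) j v) = rest x * (w i u * w j v).
  rewrite /W (bigD1 i) //= (bigD1 j) //=; last by rewrite eq_sym.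
  rewrite !updE (negPf ij) !eqxx [RHS]mulrC -mulrA; congr (_ * (_ * _)).
  by apply: eq_bigr => k /andP[/negPf ki /negPf kj]; rewrite !updE ki kj.
rewrite -(ler_pM2l V2) mulrCA -!(sum_upd2 _ i j) mulr_sumr; apply: ler_sum => x _.
have -> : \sum_u \sum_v W (upd (upd x i u) j v) *
     B (upd (upd x i u) j v i) (upd (upd x i u) j v j) =
   rest x * \sum_u \sum_v w i u * w j v * B u v.
  rewrite mulr_sumr; apply: eq_bigr => u _; rewrite mulr_sumr; apply: eq_bigr => v _.
  by rewrite WE !updE eqxx (negPf ij) eqxx -mulrA.
have -> : \sum_u \sum_v W (upd (upd x i u) j v) = rest x * \sum_u \sum_v w i u * w j v.
  rewrite mulr_sumr; apply: eq_bigr => u _; rewrite mulr_sumr; apply: eq_bigr => v _.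
  by rewrite WE.
rewrite mulrCA ler_wpM2l//; apply: prodr_ge0 => k _.
by have /andP[] := w01 k (x k).
Qed.

(** After the swap, a tuple whose densities [T] are all at least [al] contributes at least
    [al ^+ size s] times its weight. By the union bound the other tuples have at most the share
    [size s * rho] of the weight. *)
Lemma counting (s : seq ('I_q * 'I_q)) : 0 <= al <= 1 ->
  (forall e, e \in s -> (e.1 < e.2)%N) -> uniq s ->
  (forall e phi psi, e \in s -> unit_fun phi -> unit_fun psi ->
     \sum_u \sum_v phi u * psi v * (T e u v - f e u v) <= lam * #|V|%:R ^+ 2) ->
  (forall e, e \in s -> \sum_u \sum_v w e.1 u * w e.2 v * (T e u v < al)%R%:R <=
     rho * (\sum_u \sum_v w e.1 u * w e.2 v)) ->
  al ^+ size s * (1 - (size s)%:R * rho) * (\prod_k \sum_v w k v) -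
    (size s)%:R * (lam * #|V|%:R ^+ q) <=
  \sum_(x : {ffun 'I_q -> V}) (\prod_k w k (x k)) * \prod_(e <- s) f e (x e.1) (x e.2).
Proof.
move=> /andP[al0 al1] lts us cut dense; apply: le_trans (counting_swap lts us cut).
rewrite lerD2r -sum_W.
have W0 x : 0 <= W x by apply: prodr_ge0 => k _; have /andP[] := w01 k (x k).
(* If some density is below [al], the left side is at most 0. *)
have low x (r : seq ('I_q * 'I_q)) : al ^+ size r * (1 - \sum_(e <- r) (TT e x < al)%R%:R) <= \prod_(e <- r) TT e x.
  have [no|] := boolP (has (fun e => TT e x < al) r); last first.
    move/hasPn => all_; rewrite big1_seq => [|e /andP[_ /all_/negPf->]] //.
    rewrite subr0 mulr1; elim: r all_ => [|e r IH] all_; first by rewrite big_nil expr0.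
    rewrite /= big_cons exprS ler_pM ?exprn_ge0//.
      by rewrite leNgt; apply: all_; rewrite mem_head.
    by apply: IH => e' e'r; apply: all_; rewrite inE e'r orbT.
  apply: (@le_trans _ _ 0); last first.
    by apply: prodr_ge0 => e _; have /andP[] := T01 e (x e.1) (x e.2).
  rewrite mulr_ge0_le0 ?exprn_ge0// subr_le0.
  have [e er be] := hasP no; rewrite (big_rem e) //= be /= lerDl.
  by apply: sumr_ge0 => e' _; rewrite ler0n.
apply: (@le_trans _ _ (\sum_x W x * (al ^+ size s * (1 - \sum_(e <- s) (TT e x < al)%R%:R)))); last first.
  by apply: ler_sum => x _; rewrite ler_wpM2l.
have -> : \sum_x W x * (al ^+ size s * (1 - \sum_(e <- s) (TT e x < al)%R%:R)) =
    al ^+ size s * (\sum_x W x - \sum_(e <- s) \sum_x W x * (TT e x < al)%R%:R).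
  rewrite exchange_big /= -sumrB mulr_sumr; apply: eq_bigr => x _.
  by rewrite -mulr_sumr; ring.
rewrite -mulrA ler_wpM2l ?exprn_ge0// mulrBl mul1r lerD2l lerN2.
apply: (@le_trans _ _ (\sum_(e <- s) rho * \sum_x W x)); last first.
  by rewrite big_const_seq count_predT iter_addr_0 -mulrA mulr_natl.
rewrite big_seq [X in _ <= X]big_seq; apply: ler_sum => e es.
apply: (@sum_W_pair e.1 e.2 (fun u v => (T e u v < al)%R%:R)); last exact: dense.
by rewrite -val_eqE neq_ltn lts.
Qed.

End Counting.

(** * Ordered copies *)

Section Colours.
Variables (S : finType) (n : nat).
Implicit Types (G : ograph S n) (c : S) (x y u v : 'I_n).

(** A relation rather than a colour-valued function, so that [x = y] needs no default colour. *)
Definition gcol G c x y : bool := [exists e : vpair n, (val e == [set x; y]) && (G e == c)].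

Lemma gcolE G c (e : vpair n) x y : val e = [set x; y] -> gcol G c x y = (G e == c).
Proof.
move=> ve; apply/existsP/idP => [[e' /andP[/eqP ve' /eqP <-]]|/eqP <-].
  by rewrite (_ : e' = e)//; apply: val_inj; rewrite ve ve'.
by exists e; rewrite ve !eqxx.
Qed.

Lemma vpair_exists x y : x != y -> exists e : vpair n, val e = [set x; y].
Proof.
move=> xy; have h : #|[set x; y]| == 2%N by rewrite cards2 xy.
by exists (exist (fun e : {set 'I_n} => #|e| == 2%N) _ h).
Qed.

Lemma gcol_irr G c x : gcol G c x x = false.
Proof.
apply/negbTE/negP => /existsP[e /andP[/eqP ve _]].
by have : #|val e| == 2%N := valP e; rewrite ve cards2 eqxx.
Qed.

Lemma ends_subproof (e : vpair n) : exists p : 'I_n * 'I_n,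
  (p.1 < p.2)%N && (val e == [set p.1; p.2]).
Proof.
have : #|val e| == 2%N := valP e.
move=> /cards2P[x [y [xy E]]].
have [lt|] := ltnP x y; first by exists (x, y); rewrite lt E eqxx.
rewrite leq_eqVlt val_eqE eq_sym (negPf xy) /= => lt.
by exists (y, x); rewrite lt E setUC eqxx.
Qed.

Definition ends (e : vpair n) : 'I_n * 'I_n := xchoose (ends_subproof e).

Lemma endsP e : ((ends e).1 < (ends e).2)%N /\ val e = [set (ends e).1; (ends e).2].
Proof. by have /andP[? /eqP] := xchooseP (ends_subproof e). Qed.

Lemma endsE e u v : (u < v)%N -> val e = [set u; v] -> ends e = (u, v).
Proof.
move=> uv ve; have [lt ve'] := endsP e.
case: (ends e) lt ve' => a b /= lt; rewrite ve => E.
have : a \in [set u; v] by rewrite E set21.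
have : b \in [set u; v] by rewrite E set22.
rewrite !in_set2 => /orP[]/eqP bE /orP[]/eqP aE; move: lt; rewrite aE bE ?ltnn //.
by move=> /ltn_trans /(_ uv); rewrite ltnn.
Qed.

End Colours.

Section Copies.
Variables (S : finType) (n q : nat).

(** Listed in the order of ['I_q], both families are the sorted enumeration of the same set. *)
Lemma increasing_unique (x y : 'I_q -> 'I_n) :
  (forall i j : 'I_q, (i < j)%N -> (x i < x j)%N) ->
  (forall i j : 'I_q, (i < j)%N -> (y i < y j)%N) ->
  [set x i | i : 'I_q] = [set y i | i : 'I_q] -> x =1 y.
Proof.
move=> incx incy E.
have srt (z : 'I_q -> 'I_n) : (forall i j : 'I_q, (i < j)%N -> (z i < z j)%N) ->
    sorted ltn [seq val (z i) | i <- enum 'I_q].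
  move=> incz; rewrite (@sorted_map _ _ (fun i => val (z i))).
  have : sorted ltn [seq val i | i <- enum 'I_q] by rewrite val_enum_ord iota_ltn_sorted.
  rewrite sorted_map; apply: sub_sorted => i j /=; exact: incz.
have /eq_in_map eqm : [seq val (x i) | i <- enum 'I_q] = [seq val (y i) | i <- enum 'I_q].
  apply: (irr_sorted_eq ltn_trans ltnn (srt _ incx) (srt _ incy)) => a.
  have mapE (z : 'I_q -> 'I_n) : (a \in [seq val (z i) | i <- enum 'I_q]) =
      [exists v : 'I_n, (v \in [set z i | i : 'I_q]) && (val v == a)].
    apply/mapP/existsP => [[i _ ->]|[v /andP[/imsetP[i _ ->] /eqP <-]]].
      by exists (z i); rewrite eqxx imset_f.
    by exists i; rewrite // mem_enum.
  by rewrite !mapE E.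
by move=> i; apply: val_inj; apply: eqm; rewrite mem_enum.
Qed.

Lemma copies_of_increasing (F : ograph S q) (G : ograph S n) (x : 'I_q -> 'I_n) :
  (forall i j : 'I_q, (i < j)%N -> (x i < x j)%N) ->
  (forall (i j : 'I_q) c, (i < j)%N -> gcol F c i j -> gcol G c (x i) (x j)) ->
  [set x i | i : 'I_q] \in copies (to_anyograph F) G.
Proof.
move=> incx colx; have injx : injective x.
  move=> i j xij; apply/val_inj/eqP; rewrite eqn_leq leqNgt andbC leqNgt.
  by apply/andP; split; apply/negP => /incx; rewrite xij ltnn.
set U := [set x i | i : 'I_q].
have cU : q = #|U| by rewrite card_imset// card_ord.
have xE : x =1 (fun i => enum_val (cast_ord cU i)).
  apply: increasing_unique => // [i j ij|]; first exact: enum_val_lt.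
  apply/setP => v; apply/idP/imsetP => [vU|[i _ ->]]; last exact: enum_valP.
  exists (cast_ord (esym cU) (enum_rank_in vU v)) => //.
  by rewrite cast_ordKV enum_rankK_in.
have {}colx (i j : 'I_q) c : (i < j)%N -> gcol F c i j ->
    gcol G c (enum_val (cast_ord cU i)) (enum_val (cast_ord cU j)).
  by rewrite -!xE; apply: colx.
(* Once [q] is replaced by [#|U|], the casts are identities and [F] and [osub G U] have the same
   type. *)
move: U cU xE colx => U cU _; rewrite inE; subst q => colx.
apply/eqP; congr (to_anyograph _); apply/ffunP => e; rewrite ffunE.
have [lt ve] := endsP e.
have := colx (ends e).1 (ends e).2 (F e) lt.
rewrite (gcolE _ _ ve) eqxx => /(_ isT).
rewrite (@gcolE _ _ _ _ (vpair_image e)) => [/eqP //|].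
by rewrite /= ve imsetU1 imset_set1 !cast_ord_id.
Qed.

End Copies.

(** * Colour densities *)

Section ColourDensity.
Variables (R : realType) (S : finType) (n : nat) (G : ograph S n).

Definition fcol (w : S * 'I_n * 'I_n) : R := (gcol G w.1.1 w.1.2 w.2)%:R.

(** The colour is a coordinate of its own, so a single function [fcol] and a single energy treat all
    colours together. The average of [fcol] over a cell is the density of colour [c] between the
    cells of [x] and [y]. *)
Definition lift2 (K : eqType) (P : 'I_n -> K) (w : S * 'I_n * 'I_n) : S * K * K :=
  (w.1.1, P w.1.2, P w.2).

Definition dens (K : eqType) (P : 'I_n -> K) := cexp (lift2 P) fcol.

Definition energy2 (K : eqType) (P : 'I_n -> K) : R := energy (lift2 P) fcol.

Lemma sum3 (H : S * 'I_n * 'I_n -> R) :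
  \sum_w H w = \sum_c \sum_x \sum_y H (c, x, y).
Proof. by rewrite pair_bigA pair_bigA /=; apply: eq_bigr => -[[c x] y]. Qed.

Lemma fcol01 w : 0 <= fcol w <= 1.
Proof. by rewrite ler0n lern1 leq_b1. Qed.

Lemma dens01 (K : eqType) (P : 'I_n -> K) w : 0 <= dens P w <= 1.
Proof.
by rewrite cexp_ge0 ?cexp_le1 // => u; have /andP[] := fcol01 u.
Qed.

Lemma sum_fcol (x y : 'I_n) : \sum_c fcol (c, x, y) = (x != y)%:R.
Proof.
have [->|xy] := eqVneq x y; first by rewrite big1 // => c _; rewrite /fcol /= gcol_irr.
have [e ve] := vpair_exists xy.
rewrite (bigD1 (G e)) //= /fcol /= (gcolE _ _ ve) eqxx big1 ?addr0 // => c /negPf.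
by rewrite eq_sym (gcolE _ _ ve) => ->.
Qed.

Lemma energy2_ge0 (K : eqType) (P : 'I_n -> K) : 0 <= energy2 P.
Proof. exact: energy_ge0. Qed.

Lemma energy2_le (K : eqType) (P : 'I_n -> K) : energy2 P <= n%:R ^+ 2.
Proof.
apply: le_trans (energy_le_sqr _ _) _.
have -> : \sum_w fcol w ^+ 2 = \sum_w fcol w.
  by apply: eq_bigr => w _; rewrite /fcol; case: gcol; rewrite ?expr1n ?expr0n.
rewrite sum3 exchange_big /=.
apply: (@le_trans _ _ (\sum_(x < n) \sum_(y < n) 1)).
  apply: ler_sum => x _; rewrite exchange_big /=; apply: ler_sum => y _.
  by rewrite sum_fcol lern1 leq_b1.
by rewrite !sumr_const !card_ord expr2 mulr_natr.
Qed.

Lemma lift2_refine (K K' : eqType) (P : 'I_n -> K) (P' : 'I_n -> K') :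
  measurable_wrt P' P -> measurable_wrt (lift2 P') (lift2 P).
Proof.
by move=> m [[c x] y] [[c' x'] y'] [-> /m ex /m ey]; rewrite /lift2 /= ex ey.
Qed.

Lemma dens_diff (K K' : eqType) (P : 'I_n -> K) (P' : 'I_n -> K') :
  measurable_wrt P' P ->
  \sum_w (dens P' w - dens P w) ^+ 2 = energy2 P' - energy2 P.
Proof. by move=> m; apply: energy_diff; apply: lift2_refine. Qed.

Lemma energy2_mono (K K' : eqType) (P : 'I_n -> K) (P' : 'I_n -> K') :
  measurable_wrt P' P -> energy2 P <= energy2 P'.
Proof. by move=> m; apply: energy_mono; apply: lift2_refine. Qed.

Section Cut.
Variables (k : nat) (P : 'I_n -> 'I_k) (lam : R).
Hypothesis lam_gt0 : 0 < lam.
Hypothesis Pstable : forall k' (P' : 'I_n -> 'I_k'), (k' <= k * 4)%N ->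
  measurable_wrt P' P -> energy2 P' <= energy2 P + lam ^+ 2 * n%:R ^+ 2.

(* Otherwise splitting the cells of [P] along [A] and [B] would increase the
   energy too much. *)
Lemma cut_sets c (A B : pred 'I_n) :
  \sum_(x | A x) \sum_(y | B y) (dens P (c, x, y) - fcol (c, x, y)) <= lam * n%:R ^+ 2.
Proof.
(* Two memberships split each cell into at most four: this is the factor 4 in [Pstable]. *)
pose P' (x : 'I_n) := enum_rank (P x, A x, B x).
have P'E x y : P' x = P' y -> [/\ P x = P y, A x = A y & B x = B y].
  by move=> /enum_rank_inj[].
have mP : measurable_wrt P' P by move=> x y /P'E[].
have st : energy2 P' <= energy2 P + lam ^+ 2 * n%:R ^+ 2.
  by apply: Pstable => //; rewrite !card_prod card_ord !card_bool -mulnA.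
pose g (w : S * 'I_n * 'I_n) : R := [&& w.1.1 == c, A w.1.2 & B w.2]%:R.
have mg : measurable_wrt (lift2 P') g.
  by move=> [[a x] y] [[a' x'] y'] [-> /P'E[_ Ax _] /P'E[_ _ By]]; rewrite /g /= Ax By.
have gE H : \sum_w H w * g w = \sum_(x | A x) \sum_(y | B y) H (c, x, y).
  rewrite sum3 (bigD1 c) //= [X in _ + X]big1 ?addr0 => [|a /negPf ac]; last first.
    by apply: big1 => x _; apply: big1 => y _; rewrite /g /= ac mulr0.
  rewrite [RHS]big_mkcond; apply: eq_bigr => x _ /=.
  case: ifP => Ax; last by apply: big1 => y _; rewrite /g /= Ax andbF mulr0.
  rewrite [RHS]big_mkcond; apply: eq_bigr => y _ /=.
  by rewrite /g /= eqxx Ax; case: (B y); rewrite ?mulr1 ?mulr0.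
(* Tested against [g], which is constant on the cells of [P'], [fcol] and [dens P'] give the same
   sum. *)
have -> : \sum_(x | A x) \sum_(y | B y) (dens P (c, x, y) - fcol (c, x, y)) =
    \sum_w (dens P w - dens P' w) * g w.
  rewrite -(gE (fun w => dens P w - fcol w)).
  under eq_bigr do rewrite mulrBl; under [RHS]eq_bigr do rewrite mulrBl.
  by rewrite !sumrB (sum_cexpM fcol mg).
have lam2 : 0 <= 2 * lam by rewrite mulr_ge0// ltW.
(* Where [g] is 1, this is the inequality between arithmetic and geometric means, with weight
   [lam]. *)
apply: (@le_trans _ _ (\sum_w ((dens P' w - dens P w) ^+ 2 / (2 * lam) + lam / 2 * g w))).
  apply: ler_sum => w _; rewrite /g; case: [&& _, _ & _]; last first.
    by rewrite !mulr0 addr0 divr_ge0 ?sqr_ge0.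
  rewrite !mulr1 -subr_ge0 (_ : _ - _ = (dens P' w - dens P w + lam) ^+ 2 / (2 * lam)).
    by rewrite divr_ge0 ?sqr_ge0.
  by field; rewrite gt_eqF.
rewrite big_split /= -mulr_suml -mulr_sumr dens_diff //.
have g1 : \sum_w g w <= n%:R ^+ 2.
  have -> : \sum_w g w = \sum_w 1 * g w by apply: eq_bigr => w _; rewrite mul1r.
  rewrite (gE (fun=> 1)).
  apply: (@le_trans _ _ (\sum_(x < n) \sum_(y < n) 1)); last first.
    by rewrite !sumr_const !card_ord expr2 mulr_natr.
  rewrite big_mkcond; apply: ler_sum => x _; case: (A x); last by apply: sumr_ge0.
  by rewrite big_mkcond; apply: ler_sum => y _; case: (B y).
have -> : lam * n%:R ^+ 2 = (lam ^+ 2 * n%:R ^+ 2) / (2 * lam) + lam / 2 * n%:R ^+ 2.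
  by field; rewrite gt_eqF.
apply: lerD; last by apply: ler_wpM2l => //; rewrite divr_ge0// ltW.
by rewrite ler_pM2r ?lerBlDl// invr_gt0 mulr_gt0.
Qed.

(** A linear form on functions with values between 0 and 1 is largest at the indicator of the points
    with positive coefficient. Used for [phi] and then for [psi], this leads back to [cut_sets]. *)
Lemma cut_functions c (phi psi : 'I_n -> R) : unit_fun phi -> unit_fun psi ->
  \sum_x \sum_y phi x * psi y * (dens P (c, x, y) - fcol (c, x, y)) <= lam * n%:R ^+ 2.
Proof.
have ext (f h : 'I_n -> R) : unit_fun f -> \sum_x f x * h x <= \sum_(x | 0 < h x) h x.
  move=> f01; rewrite [leRHS]big_mkcond; apply: ler_sum => x _.
  have /andP[f0 f1] := f01 x; case: ltP => h0; first by rewrite ler_piMl// ltW.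
  by rewrite mulr_ge0_le0.
move=> u1 u2.
pose D x y := dens P (c, x, y) - fcol (c, x, y).
pose L x := \sum_y psi y * D x y.
have -> : \sum_x \sum_y phi x * psi y * (dens P (c, x, y) - fcol (c, x, y)) = \sum_x phi x * L x.
  by apply: eq_bigr => x _; rewrite mulr_sumr; apply: eq_bigr => y _; rewrite -mulrA.
apply: le_trans (ext _ _ u1) _; rewrite exchange_big /=.
under eq_bigr do rewrite -mulr_sumr.
apply: le_trans (ext _ _ u2) _; rewrite exchange_big /=.
exact: cut_sets.
Qed.

End Cut.
End ColourDensity.

(** * From one copy in the recoloured graph to many copies in [G] *)

Section Transfer.
Variables (R : realType) (S : finType) (n k Q : nat) (G : ograph S n).
Variables (P : 'I_n -> 'I_k) (L : Type) (lab : 'I_n -> L) (jj : L -> nat).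
Variables (W : L -> nat -> pred 'I_n) (newc : 'I_n -> 'I_n -> S) (lam al rho bet : R).
Hypothesis n_gt0 : (0 < n)%N.
Hypothesis jj_mono : forall u v : 'I_n, (u < v)%N -> (jj (lab u) <= jj (lab v))%N.
Hypothesis W_sorted : forall (u v x y : 'I_n) i i', (i < i' < Q)%N ->
  (jj (lab u) <= jj (lab v))%N -> W (lab u) i x -> W (lab v) i' y -> (x < y)%N.
Hypothesis W_large : forall (u : 'I_n) i, (i < Q)%N ->
  bet * n%:R <= #|W (lab u) i|%:R.
Hypothesis W_dense : forall (u v : 'I_n) i i', (u < v)%N -> (i < i' < Q)%N ->
  \sum_(x | W (lab u) i x) \sum_(y | W (lab v) i' y) (dens R G P (newc u v, x, y) < al)%R%:R
   <= rho * (#|W (lab u) i|%:R * #|W (lab v) i'|%:R).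
Hypothesis cut : forall c phi psi, unit_fun phi -> unit_fun psi ->
  \sum_x \sum_y phi x * psi y * (dens R G P (c, x, y) - fcol R G (c, x, y)) <=
  lam * n%:R ^+ 2.
Hypotheses (al01 : 0 < al <= 1) (bet01 : 0 < bet <= 1) (rho0 : 0 <= rho) (lam0 : 0 <= lam).
Hypothesis rho_small : (Q ^ 2)%:R * rho <= 1 / 2.
Hypothesis lam_small : (Q ^ 2)%:R * lam <= al ^+ (Q ^ 2) * bet ^+ Q / 4.

Definition recolour : ograph S n := [ffun e => newc (ends e).1 (ends e).2].

(** The vertex of rank [i] in [U] is replaced by any point of the set [W] for its label and [i]. By
    [W_sorted] the resulting tuples are increasing, so they are determined by their images;
    [counting] finds many with the right colours. *)
Lemma transfer (U : {set 'I_n}) : (#|U| <= Q)%N ->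
  al ^+ (Q ^ 2) * bet ^+ Q / 4 * n%:R ^+ #|U| <=
  #|copies (to_anyograph (osub recolour U)) G|%:R.
Proof.
move=> UQ; set F := osub recolour U; pose q := #|U|.
pose u (i : 'I_q) : 'I_n := enum_val i.
have u_lt (i j : 'I_q) : (i < j)%N -> (u i < u j)%N by exact: enum_val_lt.
have FE (i j : 'I_q) c : (i < j)%N -> gcol F c i j = (newc (u i) (u j) == c).
  move=> ij; have [|e ve] := @vpair_exists q i j; first by rewrite -val_eqE neq_ltn ij.
  rewrite (gcolE _ _ ve) /F !ffunE (@endsE _ _ (u i) (u j)) ?u_lt //=.
  by rewrite ve imsetU1 imset_set1.
pose w (i : 'I_q) (v : 'I_n) : R := (W (lab (u i)) i v)%:R.
pose f (e : 'I_q * 'I_q) x y := fcol R G (newc (u e.1) (u e.2), x, y).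
pose T (e : 'I_q * 'I_q) x y := dens R G P (newc (u e.1) (u e.2), x, y).
pose s : seq ('I_q * 'I_q) := [seq e : 'I_q * 'I_q <- enum {: 'I_q * 'I_q} | (e.1 < e.2)%N].
have iQ (i : 'I_q) : (i < Q)%N by apply: leq_trans UQ.
have lts (e : 'I_q * 'I_q) : e \in s -> (e.1 < e.2)%N by rewrite mem_filter => /andP[].
have us : uniq s by rewrite filter_uniq ?enum_uniq.
have szs : (size s <= Q ^ 2)%N.
  rewrite size_filter (leq_trans (count_size _ _))// -cardE card_prod card_ord.
  by rewrite -mulnn leq_mul.
have w01 i : unit_fun (w i) by move=> v; rewrite ler0n lern1 leq_b1.
have wsum i : \sum_v w i v = #|W (lab (u i)) i|%:R.
  by rewrite -sumr_const [RHS]big_mkcond; apply: eq_bigr => v _; rewrite /w unfold_in; case: (W _ _ v).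
have al0 : 0 <= al by case/andP: al01 => /ltW.
have al1 : al <= 1 by case/andP: al01.
have [bet0 bet1] := andP bet01.
have cutp (e : 'I_q * 'I_q) phi psi : e \in s -> unit_fun phi -> unit_fun psi ->
    \sum_x \sum_y phi x * psi y * (T e x y - f e x y) <= lam * #|'I_n|%:R ^+ 2.
  by move=> _; rewrite card_ord; apply: cut.
have densep (e : 'I_q * 'I_q) : e \in s -> \sum_x \sum_y w e.1 x * w e.2 y * (T e x y < al)%R%:R <=
    rho * (\sum_x \sum_y w e.1 x * w e.2 y).
  move=> es.
  have W2 (H : 'I_n -> 'I_n -> R) : \sum_x \sum_y w e.1 x * w e.2 y * H x y =
      \sum_(x | W (lab (u e.1)) e.1 x) \sum_(y | W (lab (u e.2)) e.2 y) H x y.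
    rewrite [RHS]big_mkcond; apply: eq_bigr => x _ /=; rewrite /w; case: (W _ _ x); last first.
      by apply: big1 => y _; rewrite !mul0r.
    rewrite [RHS]big_mkcond; apply: eq_bigr => y _ /=; case: (W _ _ y); rewrite ?mul1r//.
    by rewrite mul0r.
  rewrite W2 (_ : \sum_x \sum_y _ = #|W (lab (u e.1)) e.1|%:R * #|W (lab (u e.2)) e.2|%:R).
    by apply: W_dense; rewrite ?u_lt ?lts ?iQ.
  by rewrite -!wsum mulr_suml; apply: eq_bigr => x _; rewrite mulr_sumr.
have V0 : (0 < #|'I_n|)%N by rewrite card_ord.
have al01' : 0 <= al <= 1 by rewrite al0 al1.
have f01 e x y : 0 <= f e x y <= 1 by apply: fcol01.
have T01 e x y : 0 <= T e x y <= 1 by apply: dens01.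
have := counting V0 w01 f01 T01 al01' lts us cutp densep.
rewrite card_ord; set big := (X in _ <= X) => count.
have bigE : big <= #|copies (to_anyograph F) G|%:R.
  pose good (x : {ffun 'I_q -> 'I_n}) := [forall i, W (lab (u i)) i (x i)] &&
     all (fun e => gcol G (newc (u e.1) (u e.2)) (x e.1) (x e.2)) s.
  have -> : big = #|[set x | good x]|%:R.
    rewrite -sumr_const [RHS]big_mkcond /big; apply: eq_bigr => x _.
    rewrite inE /good; case: (boolP [forall i, _]) => [/forallP wx|] /=; last first.
      by rewrite negb_forall => /existsP[i /negPf wi]; rewrite (bigD1 i) //= /w wi !mul0r.
    rewrite big1 ?mul1r => [|i _]; last by rewrite /w wx.
    elim: (s) => [|e r IH]; first by rewrite big_nil.
    rewrite big_cons IH /f /fcol /=; case: gcol; rewrite ?mul1r ?mul0r //.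
  rewrite ler_nat.
  have inc x : good x -> forall i j : 'I_q, (i < j)%N -> (x i < x j)%N.
    move=> /andP[/forallP wx _] i j ij; apply: W_sorted (wx i) (wx j); first by rewrite ij iQ.
    by apply: jj_mono; apply: u_lt.
  have inj : {in [set x | good x] &, injective (fun x : {ffun 'I_q -> 'I_n} => [set x i | i : 'I_q])}.
    move=> x y; rewrite !inE => gx gy E; apply/ffunP.
    exact: increasing_unique (inc x gx) (inc y gy) E.
  rewrite -(card_in_imset inj); apply: subset_leq_card; apply/subsetP => U'.
  move=> /imsetP[x]; rewrite inE => gx ->; apply: copies_of_increasing; first exact: inc.
  move=> i j c ij; rewrite FE // => /eqP <-.
  move: gx => /andP[_ /allP /(_ (i, j))]; apply.
  by rewrite mem_filter ij mem_enum.
apply: le_trans bigE; apply: le_trans count.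
(* Half of the main term survives the low densities, by [rho_small]; a quarter of it pays for the
   cut errors, by [lam_small]. The exponents may grow because [al] and [bet] are at most 1. *)
have -> : al ^+ (Q ^ 2) * bet ^+ Q / 4 * n%:R ^+ #|U| =
      (al ^+ (Q ^ 2) * bet ^+ Q / 2) * n%:R ^+ #|U| -
      al ^+ (Q ^ 2) * bet ^+ Q / 4 * n%:R ^+ #|U| by field.
  have nq0 : 0 <= n%:R ^+ #|U| :> R by rewrite exprn_ge0.
  apply: lerB; last first.
    rewrite mulrA ler_wpM2r//; apply: le_trans lam_small.
    by rewrite ler_wpM2r// ler_nat.
  have -> : al ^+ (Q ^ 2) * bet ^+ Q / 2 * n%:R ^+ #|U| =
     (al ^+ (Q ^ 2) * (1 / 2)) * (bet ^+ Q * n%:R ^+ #|U|) by field.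
  have hs : 1 / 2 <= 1 - (size s)%:R * rho.
    rewrite lerBrDl -lerBrDr; apply: (@le_trans _ _ (1 / 2)); last by lra.
    by apply: le_trans rho_small; rewrite ler_wpM2r// ler_nat.
  apply: ler_pM.
  + by rewrite !mulr_ge0 ?exprn_ge0 ?invr_ge0 ?ler0n.
  + by rewrite mulr_ge0 ?exprn_ge0 // ltW.
  + have half0 : 0 <= 1 / 2 :> R by rewrite divr_ge0.
    by apply: ler_pM => //; rewrite ?exprn_ge0 ?ler_wiXn2l.
  + apply: (@le_trans _ _ (\prod_(i < q) (bet * n%:R))).
      rewrite prodr_const card_ord exprMn ler_wpM2r// ler_wiXn2l// ltW//.
    by apply: ler_prod => i _; rewrite wsum mulr_ge0 ?(ltW bet0)//= W_large.
Qed.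

End Transfer.

(** * Letter frequencies *)

Section Frequency.
Variables (R : realType) (n k : nat) (A : 'I_n -> 'I_k).

Definition letter (w : 'I_k * 'I_n) : R := (A w.2 == w.1)%:R.

Definition liftpos (m : nat) (w : 'I_k * 'I_n) : 'I_k * nat := (w.1, pos m w.2).

Definition freq m := cexp (liftpos m) letter.

Definition energy1 m : R := energy (liftpos m) letter.

Definition gridsize m (x : 'I_n) : R := cellsize R (pos m) x.

Lemma gridsize_gt0 m x : 0 < gridsize m x.
Proof. exact: cellsize_gt0. Qed.

Lemma freq01 m w : 0 <= freq m w <= 1.
Proof. by rewrite cexp_ge0 ?cexp_le1 // => u; rewrite /letter ?ler0n ?lern1 ?leq_b1. Qed.

Lemma freq_eq m a x y : pos m x = pos m y -> freq m (a, x) = freq m (a, y).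
Proof. by move=> e; apply: cexp_measurable; rewrite /liftpos /= e. Qed.

Lemma sum_freq_cell m a x :
  \sum_(y | (A y == a) && (pos m y == pos m x)) 1 = freq m (a, x) * gridsize m x :> R.
Proof.
rewrite /freq; have -> : gridsize m x = cellsize R (liftpos m) (a, x).
  congr (_%:R); rewrite -(card_in_image (f := fun y => (a, y))) => [|y z _ _ []//].
  apply: eq_card => -[b y]; rewrite !inE /liftpos xpair_eqE /=.
  apply/imageP/andP => [[z]|[/eqP -> py]]; first by rewrite inE => /eqP pz [-> ->]; rewrite pz !eqxx.
  by exists y.
rewrite -cexp_sum -(pair_big (fun b => b == a) (fun y => pos m y == pos m x)
  (fun b y => letter (b, y))) /= big_pred1_eq /letter /=.
by rewrite [LHS]big_mkcondl; apply: eq_bigr => y _ /=; case: eqP.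
Qed.

Lemma energy1_ge0 m : 0 <= energy1 m.
Proof. exact: energy_ge0. Qed.

Lemma sum_letter x : \sum_a letter (a, x) = 1.
Proof.
rewrite (bigD1 (A x)) //= /letter /= eqxx big1 ?addr0 // => a /negPf.
by rewrite eq_sym => ->.
Qed.

Lemma energy1_le m : energy1 m <= n%:R.
Proof.
apply: le_trans (energy_le_sqr _ _) _.
have -> : \sum_w letter w ^+ 2 = \sum_w letter w.
  by apply: eq_bigr => w _; rewrite /letter; case: eqP; rewrite ?expr1n ?expr0n.
rewrite -(pair_bigA _ (fun a x => letter (a, x))) /= exchange_big /=.
by under eq_bigr do rewrite sum_letter; rewrite sumr_const card_ord.
Qed.

Lemma sum_freq m x : \sum_a freq m (a, x) = 1.
Proof.
apply: (mulIf (lt0r_neq0 (gridsize_gt0 m x))); rewrite mul1r mulr_suml.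
under eq_bigr do rewrite -sum_freq_cell.
rewrite (exchange_big_dep (fun y => pos m y == pos m x)) /=; last first.
  by move=> a y _ /andP[].
rewrite /gridsize /cellsize -sumr_const; apply: eq_big => [y|y /eqP py]; first by rewrite inE.
by rewrite (eq_bigl (fun a => a == A y)) ?big_pred1_eq // => a; rewrite py eqxx andbT eq_sym.
Qed.

Lemma freq_diff m m' : (0 < m)%N -> (0 < m')%N -> (m %| m')%N ->
  \sum_a \sum_x (freq m' (a, x) - freq m (a, x)) ^+ 2 = energy1 m' - energy1 m.
Proof.
move=> m0 m'0 /dvdnP[d dE].
rewrite (pair_bigA _ (fun a x => (freq m' (a, x) - freq m (a, x)) ^+ 2)) /=.
rewrite -energy_diff => [|[a x] [b y] [-> e]]; first by apply: eq_bigr => -[].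
have d0 : (0 < d)%N by move: m'0; rewrite dE muln_gt0 => /andP[].
by rewrite /liftpos /= -(pos_divn m x d0) -(pos_divn m y d0) mulnC -dE e.
Qed.

End Frequency.

Section TwoStageSelection.
Variables (R : realType) (J A V : finType).
Variables (w : J -> V -> R) (law : A -> V -> V -> R).
Hypotheses (w0 : forall j x, 0 <= w j x) (w1 : forall j, \sum_x w j x = 1).
Hypotheses (law0 : forall a x y, 0 <= law a x y) (law1 : forall a x, \sum_y law a x y = 1).
Variables (g : J * A -> J * A -> V -> V -> V -> V -> R) (h : J * A -> V -> V -> R).

(** Stage one picks all [xs] for the expectations conditional on them, stage two picks the [ys].
    Picks [ys] with the same [j] are dependent through [xs j]; only pairs with distinct [j] are
    priced. *)
Lemma two_stage_selection : exists (xs : J -> V) (ys : J * A -> V),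
  [/\ forall j, 0 < w j (xs j), forall l, 0 < law l.2 (xs l.1) (ys l) &
    \sum_j \sum_(j' | j' != j) \sum_a \sum_a'
      g (j, a) (j', a') (xs j) (xs j') (ys (j, a)) (ys (j', a')) +
    \sum_j \sum_a h (j, a) (xs j) (ys (j, a)) <=
    \sum_j \sum_(j' | j' != j) \sum_a \sum_a' \sum_x \sum_x' \sum_y \sum_y'
      w j x * w j' x' * (law a x y * law a' x' y' * g (j, a) (j', a') x x' y y') +
    \sum_j \sum_a \sum_x \sum_y w j x * (law a x y * h (j, a) x y)].
Proof.
pose g1 j j' x x' := \sum_a \sum_a' \sum_y \sum_y'
  law a x y * law a' x' y' * g (j, a) (j', a') x x' y y'.
pose h1 j x := \sum_a \sum_y law a x y * h (j, a) x y.
have [xs wxs le1] := selection w0 w1 g1 h1.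
(* The price 0 within one [j] turns the sum over distinct labels into a sum over distinct [j]. *)
pose g2 (l l' : J * A) y y' :=
  if l.1 == l'.1 then 0 else g l l' (xs l.1) (xs l'.1) y y'.
pose h2 (l : J * A) y := h l (xs l.1) y.
have [ys lys le2] := @selection R _ V (fun l : J * A => law l.2 (xs l.1))
  (fun l => law0 _ _) (fun l => law1 _ _) g2 h2.
exists xs, ys; split=> //.
have split2 (F : J * A -> J * A -> R) :
    (forall l l', l.1 == l'.1 -> F l l' = 0) ->
    \sum_l \sum_(l' | l' != l) F l l' =
    \sum_j \sum_(j' | j' != j) \sum_a \sum_a' F (j, a) (j', a').
  move=> F0; transitivity (\sum_j \sum_a \sum_(l' | l' != (j, a)) F (j, a) l').
    by rewrite pair_bigA; apply: eq_bigr => -[].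
  apply: eq_bigr => j _; rewrite [RHS]exchange_big /=; apply: eq_bigr => a _.
  rewrite (pair_big (fun j' => j' != j) xpredT (fun j' a' => F (j, a) (j', a'))) /=.
  rewrite big_mkcond [RHS]big_mkcond; apply: eq_bigr => -[j' a'] _ /=.
  rewrite andbT xpair_eqE; have [->|//] := eqVneq j' j.
  by case: ifP => // _; rewrite F0.
rewrite split2 in le2; last by move=> l l'; rewrite /g2 => ->.
rewrite split2 in le2; last first.
  by move=> l l' e; apply: big1 => v _; apply: big1 => v' _; rewrite /g2 e mulr0.
apply: le_trans (le_trans _ le2) _.
  rewrite le_eqVlt; apply/orP; left; apply/eqP; congr (_ + _).
    apply: eq_bigr => j _; apply: eq_bigr => j' jj; apply: eq_bigr => a _; apply: eq_bigr => a' _.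
    by rewrite /g2 /= eq_sym (negPf jj).
  by rewrite (pair_bigA _ (fun j a => h (j, a) (xs j) (ys (j, a)))); apply: eq_bigr => -[].
apply: le_trans (le_trans _ le1) _; rewrite le_eqVlt; apply/orP; left; apply/eqP; congr (_ + _).
- apply: eq_bigr => j _; apply: eq_bigr => j' jj; apply: eq_bigr => a _; apply: eq_bigr => a' _.
  apply: eq_bigr => y _; apply: eq_bigr => y' _.
  by rewrite /g2 /= eq_sym (negPf jj).
- by rewrite [RHS]pair_bigA; apply: eq_bigr => -[].
- apply: eq_bigr => j _; apply: eq_bigr => j' jj.
  under eq_bigr do under eq_bigr do rewrite mulr_sumr.
  under eq_bigr do rewrite exchange_big /=.
  rewrite exchange_big /=; apply: eq_bigr => a _.
  under eq_bigr do under eq_bigr do rewrite mulr_sumr.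
  under eq_bigr do rewrite exchange_big /=.
  rewrite exchange_big /=; apply: eq_bigr => a' _.
  apply: eq_bigr => x _; apply: eq_bigr => x' _; rewrite mulr_sumr.
  by apply: eq_bigr => y _; rewrite mulr_sumr.
- apply: eq_bigr => j _; under eq_bigr do rewrite mulr_sumr.
  rewrite exchange_big /=; apply: eq_bigr => a _; apply: eq_bigr => x _.
  by rewrite mulr_sumr.
Qed.

End TwoStageSelection.

(** * Representatives of the cells *)

Lemma sum_bilinear (R : comPzRingType) (X Y : finType) (p q : X -> Y -> R) (Z : Y -> Y -> R) :
  \sum_x \sum_x' \sum_y \sum_y' p x y * q x' y' * Z y y' =
  \sum_y \sum_y' (\sum_x p x y) * (\sum_x q x y') * Z y y'.
Proof.
transitivity (\sum_y \sum_y' \sum_x \sum_x' p x y * q x' y' * Z y y'); last first.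
  apply: eq_bigr => y _; apply: eq_bigr => y' _; rewrite big_distrlr /= mulr_suml.
  by apply: eq_bigr => x _; rewrite mulr_suml.
under eq_bigr do rewrite exchange_big /=.
rewrite exchange_big /=; apply: eq_bigr => y _.
under eq_bigr do rewrite exchange_big /=.
by rewrite exchange_big.
Qed.

Section Representatives.
Variables (R : realType) (n k : nat) (A : 'I_n -> 'I_k) (m1 m2 : nat) (kap : R).
Hypotheses (m1_gt0 : (0 < m1)%N) (m2_gt0 : (0 < m2)%N) (m12 : (m1 %| m2)%N).
Hypotheses (n_large : (2 * m1 <= n)%N) (kap_gt0 : 0 < kap).

Implicit Types (x y : 'I_n) (a : 'I_k) (j : 'I_m1).

Let nu1 a x : R := freq R A m1 (a, x).
Let nu2 a x : R := freq R A m2 (a, x).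

(* Here [x] represents the interval of scale [m2] picked inside its interval of
   scale [m1]: the letter [a] is used if it is frequent in the small interval,
   and tame if it is also not much rarer there than in the large one. *)
Definition used a x := kap <= nu2 a x.
Definition tame a x := used a x && (nu1 a x / 2 <= nu2 a x).
Definition cardV (j : 'I_m1) a : R := \sum_(y | (A y == a) && (pos m1 y == j)) 1.

Let jsize (j : 'I_m1) : R := (#|[pred y : 'I_n | pos m1 y == j]|)%:R.
Let w (j : 'I_m1) x : R := (pos m1 x == j)%:R / jsize j.
(** Uniform on the vertices of letter [a] in the small interval of [x]. The point mass for other
    letters only keeps the total mass at 1; indicators suppress it later. *)
Let law a x y : R := if used a x
  then ((A y == a) && (pos m2 y == pos m2 x))%:R / (nu2 a x * gridsize R m2 x)
  else (y == x)%:R.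

Let jsize_ge j : n%:R / (2 * m1)%:R <= jsize j.
Proof.
have [le _] := card_pos n m1_gt0 (ltn_ord j).
rewrite ler_pdivrMr ?ltr0n ?muln_gt0 // /jsize -natrM ler_nat; nia.
Qed.

Let n_gt0 : (0 < n)%N.
Proof. by apply: leq_trans n_large; rewrite muln_gt0. Qed.

Let jsize_gt0 j : 0 < jsize j.
Proof. by apply: lt_le_trans (jsize_ge j); rewrite divr_gt0 ?ltr0n ?muln_gt0. Qed.

Let gridsizeE j x : pos m1 x = j :> nat -> gridsize R m1 x = jsize j.
Proof. by move=> e; rewrite /gridsize /cellsize /jsize e. Qed.

Let w0 j x : 0 <= w j x.
Proof. by rewrite divr_ge0// ler0n. Qed.

Let w1 j : \sum_x w j x = 1.
Proof.
rewrite -mulr_suml (_ : \sum_x _ = jsize j) ?mulfV ?gt_eqF//.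
rewrite /jsize -sumr_const [RHS]big_mkcond; apply: eq_bigr => x _.
by rewrite unfold_in /=; case: eqP.
Qed.

Let pos21 x y : pos m2 x = pos m2 y -> pos m1 x = pos m1 y.
Proof.
case/dvdnP: m12 m2_gt0 => d ->; rewrite mulnC muln_gt0 => /andP[_ d0] e.
by rewrite -(pos_divn m1 x d0) -(pos_divn m1 y d0) e.
Qed.

Let nu1_ge0 a x : 0 <= nu1 a x. Proof. by have /andP[] := freq01 R A m1 (a, x). Qed.
Let nu2_ge0 a x : 0 <= nu2 a x. Proof. by have /andP[] := freq01 R A m2 (a, x). Qed.

Let law0 a x y : 0 <= law a x y.
Proof.
by rewrite /law; case: ifP => _; rewrite ?ler0n // divr_ge0 ?ler0n // mulr_ge0.
Qed.

Let law1 a x : \sum_y law a x y = 1.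
Proof.
rewrite /law; have [us|us] := boolP (used a x); last first.
  by rewrite (bigD1 x) //= eqxx big1 ?addr0 // => y /negPf ->.
rewrite -mulr_suml (_ : \sum_y _ = nu2 a x * gridsize R m2 x) ?mulfV //.
  by rewrite mulf_neq0 ?gt_eqF ?gridsize_gt0 // (lt_le_trans kap_gt0 us).
rewrite -sum_freq_cell [RHS]big_mkcond; apply: eq_bigr => y _.
by case: (_ && _).
Qed.

Let K x y : R := (pos m2 x == pos m2 y)%:R / gridsize R m2 y.

Let sum_K y : \sum_x K x y = 1.
Proof.
rewrite -mulr_suml (_ : \sum_x _ = gridsize R m2 y) ?mulfV ?gt_eqF ?gridsize_gt0//.
rewrite /gridsize /cellsize -sumr_const [RHS]big_mkcond; apply: eq_bigr => x _.
by rewrite unfold_in /=; case: eqP.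
Qed.

Let K0 x y : 0 <= K x y.
Proof. by rewrite divr_ge0. Qed.

Let lawE a x y : used a x -> law a x y = (A y == a)%:R * K x y / nu2 a x.
Proof.
move=> us; rewrite /law us /K eq_sym; have [e|ne] := eqVneq (pos m2 x) (pos m2 y).
  rewrite andbT mul1r (_ : gridsize R m2 x = gridsize R m2 y).
    by rewrite invfM mulrA [_ / nu2 _ _ / _]mulrAC.
  by apply: eq_cellsize; rewrite e.
by rewrite andbF !(mul0r, mulr0).
Qed.

Let om1 j a y := cardV j a * \sum_x w j x * (law a x y * (tame a x)%:R).
Let om2 j a y := \sum_x w j x * (law a x y * (used a x)%:R).

Let cardVE j a x : pos m1 x = j :> nat -> cardV j a = nu1 a x * jsize j.
Proof. by move=> e; rewrite /cardV -e -(gridsizeE e) /nu1 -sum_freq_cell. Qed.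

(** [cardV j a] is [nu1] times the size of the interval, which cancels the weight of [x]. What
    remains is [nu1 / nu2], at most 2 by tameness: picks weighted by the vertices they stand for
    cover each vertex at most twice on average. *)
Let om1_le j a y : om1 j a y <= 2 * ((A y == a) && (pos m1 y == j))%:R.
Proof.
have -> : 2 * ((A y == a) && (pos m1 y == j))%:R =
    \sum_x 2 * ((A y == a) && (pos m1 y == j))%:R * K x y by rewrite -mulr_sumr sum_K mulr1.
rewrite /om1 mulr_sumr; apply: ler_sum => x _.
have [/andP[us ta]|_] := boolP (tame a x); last first.
  by rewrite !mulr0 mulr_ge0 // mulr_ge0 ?ler0n.
rewrite mulr1 lawE // /w; have [ya|ya] := eqVneq (A y) a; last first.
  by rewrite !(mul0r, mulr0).
have [yx|yx] := eqVneq (pos m2 x) (pos m2 y); last first.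
  by rewrite /K (negPf yx) !(mul0r, mulr0).
rewrite -(pos21 yx); have [xj|_] := eqVneq (pos m1 x) j; last by rewrite !(mul0r, mulr0).
rewrite (cardVE _ xj) !mul1r mulr1.
have -> : nu1 a x * jsize j * ((jsize j)^-1 * (K x y / nu2 a x)) = nu1 a x / nu2 a x * K x y.
  by field; rewrite !gt_eqF ?jsize_gt0 // (lt_le_trans kap_gt0 us).
rewrite ler_wpM2r // ler_pdivrMr ?(lt_le_trans kap_gt0 us) //; move: ta; lra.
Qed.

Let C : R := 2 * m1%:R / (kap * n%:R).

Let om2_le j a y : om2 j a y <= C * (pos m1 y == j)%:R.
Proof.
have C0 : 0 <= C by rewrite divr_ge0 ?mulr_ge0 ?ltW ?ltr0n.
have -> : C * (pos m1 y == j)%:R = \sum_x C * (pos m1 y == j)%:R * K x y.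
  by rewrite -mulr_sumr sum_K mulr1.
apply: ler_sum => x _.
have [us|_] := boolP (used a x); last by rewrite !mulr0 mulr_ge0 // mulr_ge0 ?ler0n.
rewrite mulr1 lawE // /w; have [yx|yx] := eqVneq (pos m2 x) (pos m2 y); last first.
  by rewrite /K (negPf yx) !(mul0r, mulr0).
rewrite -(pos21 yx); have [xj|_] := eqVneq (pos m1 x) j; last by rewrite !(mul0r, mulr0).
have n2 : 0 < nu2 a x by apply: lt_le_trans us.
rewrite mulr1 mul1r; apply: (@le_trans _ _ ((jsize j)^-1 * (K x y / nu2 a x))).
  apply: ler_wpM2l; first by rewrite invr_ge0 ltW.
  apply: ler_wpM2r; first by rewrite invr_ge0.
  by case: eqP; rewrite ?mul1r // mul0r.
have -> : (jsize j)^-1 * (K x y / nu2 a x) = (jsize j)^-1 / nu2 a x * K x y.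
  by rewrite mulrA mulrAC.
rewrite ler_wpM2r // -invfM /C -(invf_div (kap * n%:R)) lef_pV2 ?posrE; last 2 first.
- by rewrite mulr_gt0.
- by rewrite divr_gt0 ?mulr_gt0 ?ltr0n.
have -> : kap * n%:R / (2 * m1%:R) = n%:R / (2 * m1)%:R * kap.
  by rewrite natrM; ring.
by rewrite ler_pM ?divr_ge0 ?ler0n // ltW.
Qed.

Let sum_om1 y : \sum_j \sum_a om1 j a y <= 2.
Proof.
apply: (@le_trans _ _ (\sum_(j < m1) \sum_(a < k) (2 : R) * ((A y == a) && (pos m1 y == j))%:R)).
  by apply: ler_sum => j _; apply: ler_sum => a _; apply: om1_le.
rewrite (bigD1 (Ordinal (pos_lt y m1_gt0))) //= (bigD1 (A y)) //= !eqxx.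
rewrite !big1 ?addr0 ?mulr1 // => [j|a].
  rewrite eq_sym -val_eqE /= => /negPf jn; apply: big1 => a _; by rewrite eq_sym jn andbF mulr0.
by rewrite eq_sym => /negPf ->; rewrite mulr0.
Qed.

Let sum_om2 y : \sum_j \sum_a om2 j a y <= C * k%:R.
Proof.
apply: (@le_trans _ _ (\sum_(j < m1) \sum_(a < k) C * (pos m1 y == j)%:R)).
  by apply: ler_sum => j _; apply: ler_sum => a _; apply: om2_le.
rewrite (bigD1 (Ordinal (pos_lt y m1_gt0))) //= [X in _ + X]big1 ?addr0 => [|j].
  by rewrite eqxx mulr1 sumr_const card_ord mulr_natr.
rewrite -val_eqE /= eq_sym => /negPf jn.
by apply: big1 => a _; rewrite jn mulr0.
Qed.

Let cardV0 j a : 0 <= cardV j a.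
Proof. exact: sumr_ge0. Qed.

Let wl0 j a x y (c : bool) : 0 <= w j x * (law a x y * c%:R).
Proof. by apply: mulr_ge0; [exact: w0|apply: mulr_ge0; [exact: law0|exact: ler0n]]. Qed.

Let om1_ge0 j a y : 0 <= om1 j a y.
Proof. by rewrite /om1; apply: mulr_ge0 => //; apply: sumr_ge0 => x _; apply: wl0. Qed.

Let om2_ge0 j a y : 0 <= om2 j a y.
Proof. by rewrite /om2; apply: sumr_ge0 => x _; apply: wl0. Qed.

(** Picks in different intervals are independent, so the weights multiply; extending the sum to all
    pairs of labels makes it factor. *)
Let expect_bound (om : 'I_m1 -> 'I_k -> 'I_n -> R) (Z : 'I_n -> 'I_n -> R) (M : R) :
  (forall j a y, 0 <= om j a y) -> (forall y, \sum_j \sum_a om j a y <= M) ->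
  (forall y y', 0 <= Z y y') ->
  \sum_j \sum_(j' | j' != j) \sum_a \sum_a' \sum_y \sum_y' om j a y * om j' a' y' * Z y y'
  <= M ^+ 2 * \sum_y \sum_y' Z y y'.
Proof.
move=> om0 omM Z0.
have S0 y : 0 <= \sum_j \sum_a om j a y.
  by apply: sumr_ge0 => j _; apply: sumr_ge0 => a _.
apply: (@le_trans _ _ (\sum_j \sum_j' \sum_y \sum_y'
    (\sum_a om j a y) * (\sum_a om j' a y') * Z y y')).
  apply: ler_sum => j _; rewrite big_mkcond; apply: ler_sum => j' _.
  case: ifP => _; first by rewrite sum_bilinear.
  apply: sumr_ge0 => y _; apply: sumr_ge0 => y' _.
  by rewrite !mulr_ge0 // sumr_ge0.
rewrite (sum_bilinear (fun j y => \sum_a om j a y) (fun j y => \sum_a om j a y)).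
rewrite mulr_sumr; apply: ler_sum => y _; rewrite mulr_sumr; apply: ler_sum => y' _.
by rewrite ler_wpM2r // expr2 ler_pM.
Qed.

(** If [nu1] exceeds [2 * kap] and [a] is not tame, then [nu2] is below [nu1 / 2], so the squared
    difference is at least [nu1 ^ 2 / 4], hence at least [kap * nu1 / 2]. *)
Let exceptional_bound a x : nu1 a x * (~~ tame a x)%:R <= 2 * kap + 2 / kap * (nu2 a x - nu1 a x) ^+ 2.
Proof.
have b0 : 0 <= 2 / kap * (nu2 a x - nu1 a x) ^+ 2.
  by rewrite mulr_ge0 ?sqr_ge0 // divr_ge0 // ltW.
have [le|lt] := lerP (nu1 a x) (2 * kap).
  apply: (@le_trans _ _ (nu1 a x)); last by rewrite ler_wpDr.
  by rewrite ler_piMr // lern1 leq_b1.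
have kap2 : 0 <= 2 * kap by rewrite mulr_ge0 // ltW.
have [_|nt] := boolP (tame a x); first by rewrite mulr0 addr_ge0.
rewrite mulr1.
have l2 : nu2 a x < nu1 a x / 2.
  move: nt; rewrite /tame negb_and -!ltNge => /orP[]//; rewrite -/(nu2 a x); lra.
apply: (@le_trans _ _ (2 / kap * (nu1 a x / 2) ^+ 2)).
  rewrite -ler_pdivrMl ?divr_gt0 // invf_div.
  have -> : (nu1 a x / 2) ^+ 2 = (nu1 a x / 4) * nu1 a x by field.
  rewrite ler_wpM2r //; lra.
have n10 := nu1_ge0 a x.
apply: (@le_trans _ _ (2 / kap * (nu2 a x - nu1 a x) ^+ 2)); last by rewrite ler_wpDl.
apply: ler_wpM2l; first by rewrite divr_ge0 // ltW.
rewrite -subr_ge0 (_ : _ - _ = (nu1 a x / 2 - nu2 a x) * (3 / 2 * nu1 a x - nu2 a x)); last by field.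
by apply: mulr_ge0; lra.
Qed.

(** The price [Z1] is multiplied by 4 only, whatever [m1] and [k] are; this is why the error of the
    first letter partition can be fixed before its size. The prices [Z2] and [h] must hold for every
    pick and pay for [m1], [kap] and [k]; [b] is the price of a vertex whose letter is not tame. *)
Lemma representatives (b : R) (Z1 Z2 : 'I_n -> 'I_n -> R) (h : 'I_n -> R) :
  0 <= b -> (forall y y', 0 <= Z1 y y') -> (forall y y', 0 <= Z2 y y') -> (forall y, 0 <= h y) ->
  exists (xs : 'I_m1 -> 'I_n) (ys : 'I_m1 * 'I_k -> 'I_n),
  [/\ forall j, pos m1 (xs j) = j,
      forall j a, used a (xs j) -> A (ys (j, a)) = a /\ pos m2 (ys (j, a)) = pos m2 (xs j) &
  \sum_j \sum_(j' | j' != j) \sum_a \sum_a'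
    ((tame a (xs j))%:R * (tame a' (xs j'))%:R * (cardV j a * cardV j' a') *
       Z1 (ys (j, a)) (ys (j', a')) +
     (used a (xs j))%:R * (used a' (xs j'))%:R * Z2 (ys (j, a)) (ys (j', a'))) +
  \sum_j \sum_a (cardV j a * (~~ tame a (xs j))%:R * b + (used a (xs j))%:R * h (ys (j, a))) <=
  4 * (\sum_y \sum_y' Z1 y y') +
  (2 * m1%:R / (kap * n%:R) * k%:R) ^+ 2 * (\sum_y \sum_y' Z2 y y') +
  b * (2 * kap * k%:R * n%:R + 2 / kap * (energy1 R A m2 - energy1 R A m1)) +
  2 * m1%:R / (kap * n%:R) * k%:R * (\sum_y h y)].
Proof.
move=> b0 Z10 Z20 h0.
pose g (l l' : 'I_m1 * 'I_k) x x' y y' : R :=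
  (tame l.2 x)%:R * (tame l'.2 x')%:R * (cardV l.1 l.2 * cardV l'.1 l'.2) * Z1 y y' +
  (used l.2 x)%:R * (used l'.2 x')%:R * Z2 y y'.
pose h' (l : 'I_m1 * 'I_k) x y : R :=
  cardV l.1 l.2 * (~~ tame l.2 x)%:R * b + (used l.2 x)%:R * h y.
have [xs [ys [wxs lys le]]] := two_stage_selection w0 w1 law0 law1 g h'.
exists xs, ys; split.
- move=> j; have := wxs j; rewrite /w.
  by have [//|] := eqVneq (pos m1 (xs j)) j; rewrite mul0r ltxx.
- move=> j a us; have := lys (j, a); rewrite /= lawE // /K.
  have [->|_] := eqVneq (A _) a; last by rewrite !mul0r ltxx.
  have [->|_] := eqVneq (pos m2 (xs j)); first by [].
  by rewrite !(mul0r, mulr0) ltxx.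
apply: le_trans le _; rewrite -[leRHS]addrA lerD //.
- rewrite (_ : 4 = 2 ^+ 2); last by rewrite expr2; ring.
  apply: le_trans (lerD (expect_bound om1_ge0 sum_om1 Z10) (expect_bound om2_ge0 sum_om2 Z20)).
  rewrite -big_split /=; apply: ler_sum => j _; rewrite -big_split; apply: ler_sum => j' _.
  rewrite -big_split; apply: ler_sum => a _; rewrite -big_split; apply: ler_sum => a' _ /=.
  rewrite le_eqVlt; apply/orP; left; apply/eqP.
  pose p1 j a x y := cardV j a * (w j x * (law a x y * (tame a x)%:R)).
  pose p2 j a x y := w j x * (law a x y * (used a x)%:R).
  transitivity (\sum_x \sum_x' \sum_y \sum_y' p1 j a x y * p1 j' a' x' y' * Z1 y y' +
    \sum_x \sum_x' \sum_y \sum_y' p2 j a x y * p2 j' a' x' y' * Z2 y y').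
    rewrite -big_split; apply: eq_bigr => x _; rewrite -big_split; apply: eq_bigr => x' _.
    rewrite -big_split; apply: eq_bigr => y _; rewrite -big_split; apply: eq_bigr => y' _ /=.
    by rewrite /g /p1 /p2 /=; ring.
  rewrite !sum_bilinear; congr (_ + _); apply: eq_bigr => y _; apply: eq_bigr => y' _.
  by rewrite /om1 !mulr_sumr.
- have -> : \sum_j \sum_a \sum_x \sum_y w j x * (law a x y * h' (j, a) x y) =
      b * (\sum_j \sum_a \sum_x w j x * (cardV j a * (~~ tame a x)%:R)) +
      \sum_y (\sum_j \sum_a om2 j a y) * h y.
    rewrite mulr_sumr; under [X in _ + X]eq_bigr do rewrite mulr_suml.
    rewrite [X in _ + X]exchange_big -big_split /=; apply: eq_bigr => j _.
    rewrite mulr_sumr; under [X in _ + X]eq_bigr do rewrite mulr_suml.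
    rewrite [X in _ + X]exchange_big -big_split /=; apply: eq_bigr => a _.
    rewrite mulr_sumr; under [X in _ + X]eq_bigr do rewrite mulr_suml.
    rewrite [X in _ + X]exchange_big -big_split /=; apply: eq_bigr => x _.
    have -> : b * (w j x * (cardV j a * (~~ tame a x)%:R)) =
      \sum_y b * (w j x * (cardV j a * (~~ tame a x)%:R)) * law a x y.
      by rewrite -mulr_sumr law1 mulr1.
    by rewrite -big_split; apply: eq_bigr => y _ /=; rewrite /h' /=; ring.
  apply: lerD; last first.
    rewrite mulr_sumr; apply: ler_sum => y _; rewrite ler_wpM2r //; exact: sum_om2.
  rewrite ler_wpM2l //.
  apply: (@le_trans _ _ (\sum_a \sum_x nu1 a x * (~~ tame a x)%:R)).
    rewrite exchange_big; apply: ler_sum => a _; rewrite exchange_big; apply: ler_sum => x _ /=.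
    rewrite (bigD1 (Ordinal (pos_lt x m1_gt0))) //= [X in _ + X]big1 ?addr0 => [|j].
      rewrite (@cardVE _ a x) // /w eqxx mul1r le_eqVlt; apply/orP; left; apply/eqP.
      by field; rewrite gt_eqF // jsize_gt0.
    by rewrite -val_eqE /= eq_sym => /negPf jn; rewrite /w jn !mul0r.
  apply: (@le_trans _ _ (\sum_(a < k) \sum_(x < n) (2 * kap + 2 / kap * (nu2 a x - nu1 a x) ^+ 2))).
    by apply: ler_sum => a _; apply: ler_sum => x _; apply: exceptional_bound.
  rewrite -freq_diff // mulr_sumr.
  have -> : 2 * kap * k%:R * n%:R = \sum_(a < k) 2 * kap * n%:R.
    by rewrite sumr_const card_ord -mulr_natr; ring.
  rewrite -big_split; apply: ler_sum => a _ /=.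
  by rewrite big_split /= sumr_const card_ord -mulr_sumr mulr_natr.
Qed.

End Representatives.

(** * Evenness and clusters *)

Lemma gridsize_bounds (R : realType) (n m : nat) (x : 'I_n) : (0 < m)%N -> (2 * m <= n)%N ->
  n%:R / (2 * m%:R) <= gridsize R m x <= 2 * n%:R / m%:R.
Proof.
move=> m0 mn; rewrite /gridsize /cellsize; set c := #|_|.
have [le1 le2] : (n <= m * c + m /\ m * c <= n + m)%N := card_pos n m0 (pos_lt x m0).
rewrite ler_pdivrMr ?mulr_gt0 ?ltr0n // ler_pdivlMr ?ltr0n //.
rewrite -!natrM !ler_nat; apply/andP; split; nia.
Qed.

Section Evenness.
Variables (R : realType) (n k : nat) (A : 'I_n -> 'I_k) (m t : nat) (theta : R).
Hypotheses (m_gt0 : (0 < m)%N) (t_gt0 : (0 < t)%N) (n_large : (2 * (m * t) <= n)%N).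
Hypothesis theta_gt0 : 0 < theta.
Implicit Types (x y z : 'I_n) (b : 'I_k).

Let nu2 b x : R := freq R A m (b, x).
Let nu3 b x : R := freq R A (m * t) (b, x).
Let bad b x := (theta <= nu2 b x) && (nu3 b x < nu2 b x / 2).

(* Each block of the interval of [y] in which the letter of [y] is too rare adds
   at least 1, because it has at least [n / (2 * (m * t))] points. *)
Definition unevenness (y : 'I_n) : R := (nu2 (A y) y < theta)%R%:R +
  2 * (m * t)%:R / n%:R * \sum_(x | pos m x == pos m y) (bad (A y) x)%:R.

Let mt_gt0 : (0 < m * t)%N. Proof. by rewrite muln_gt0 m_gt0. Qed.
Let n_gt0 : (0 < n)%N. Proof. by apply: leq_trans n_large; rewrite muln_gt0. Qed.
Let c0 : 0 <= 2 * (m * t)%:R / n%:R :> R. Proof. by rewrite divr_ge0 // mulr_ge0. Qed.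
Let nu2_ge0 b x : 0 <= nu2 b x. Proof. by have /andP[] := freq01 R A m (b, x). Qed.

Lemma unevenness_ge0 y : 0 <= unevenness y.
Proof. by rewrite addr_ge0 // mulr_ge0 // sumr_ge0. Qed.

(** A quantity depending on the letter and interval of [y] only may be averaged with letter
    frequencies in place of actual letters. *)
Let sum_letters (phi : 'I_k * 'I_n -> R) :
  (forall b x y, pos m x = pos m y -> phi (b, x) = phi (b, y)) ->
  \sum_y phi (A y, y) = \sum_b \sum_x nu2 b x * phi (b, x).
Proof.
move=> mphi; rewrite (pair_bigA _ (fun b x => nu2 b x * phi (b, x))) /=.
transitivity (\sum_w letter R A w * phi w).
  transitivity (\sum_b \sum_x letter R A (b, x) * phi (b, x)); last first.
    by rewrite pair_bigA; apply: eq_bigr => -[].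
  rewrite exchange_big; apply: eq_bigr => y _ /=.
  rewrite (bigD1 (A y)) //= /letter /= eqxx mul1r big1 ?addr0 // => b /negPf.
  by rewrite eq_sym => ->; rewrite mul0r.
transitivity (\sum_w freq R A m w * phi w); last by apply: eq_bigr => -[].
symmetry; apply: sum_cexpM => -[b x] [b' x'] [-> e].
exact: mphi.
Qed.

(** In a bad block a frequency that is at least [theta] drops by more than half, so the squared drop
    is at least [theta * nu2 / 4]. *)
Lemma sum_unevenness : \sum_y unevenness y <=
  theta * k%:R * n%:R + 16 * t%:R / theta * (energy1 R A (m * t) - energy1 R A m).
Proof.
rewrite big_split /= lerD //.
  rewrite (sum_letters (phi := fun w => (nu2 w.1 w.2 < theta)%R%:R)); last first.
    by move=> b x y e /=; rewrite /nu2 (freq_eq R A b e).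
  apply: (@le_trans _ _ (\sum_(b < k) \sum_(x < n) theta)).
    apply: ler_sum => b _; apply: ler_sum => x _ /=.
    case: ltP => [lt|_]; last by rewrite mulr0 ltW.
    by rewrite mulr1 ltW.
  by rewrite !sumr_const !card_ord -[_ *+ k]mulr_natr -[_ *+ n]mulr_natr mulrAC.
rewrite -mulr_sumr (sum_letters (phi := fun w => \sum_(x | pos m x == pos m w.2) (bad w.1 x)%:R)); last first.
  by move=> b x y e /=; rewrite e.
have -> : \sum_b \sum_x nu2 b x * (\sum_(x' | pos m x' == pos m x) (bad b x')%:R) =
    \sum_b \sum_x' (bad b x')%:R * nu2 b x' * gridsize R m x'.
  apply: eq_bigr => b _; under eq_bigr do rewrite mulr_sumr.
  rewrite (exchange_big_dep predT) //=; apply: eq_bigr => x' _.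
  rewrite -sum_cell_const; apply: eq_big => [x|x /eqP e]; first exact: eq_sym.
  by rewrite mulrC /nu2 (freq_eq R A b e).
rewrite -freq_diff ?dvdn_mulr // !mulr_sumr; apply: ler_sum => b _.
rewrite !mulr_sumr; apply: ler_sum => x _; rewrite -/(nu2 b x) -/(nu3 b x).
have [/andP[th lt]|_] := boolP (bad b x); last first.
  by rewrite !mul0r mulr0 mulr_ge0 ?sqr_ge0 // divr_ge0 ?mulr_ge0 // ltW.
rewrite mul1r; have /andP[_ gs] := gridsize_bounds R x m_gt0 (leq_trans (leq_mul (leqnn 2) (leq_pmulr m t_gt0)) n_large).
apply: (@le_trans _ _ (2 * (m * t)%:R / n%:R * (nu2 b x * (2 * n%:R / m%:R)))).
  by rewrite ler_wpM2l // ler_wpM2l.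
have -> : 2 * (m * t)%:R / n%:R * (nu2 b x * (2 * n%:R / m%:R)) = 4 * t%:R * nu2 b x.
  by rewrite natrM; field; rewrite !gt_eqF ?ltr0n.
have -> : 16 * t%:R / theta * (nu3 b x - nu2 b x) ^+ 2 =
  4 * t%:R * (4 / theta * (nu3 b x - nu2 b x) ^+ 2) by field; rewrite gt_eqF.
rewrite ler_wpM2l ?mulr_ge0 // -ler_pdivrMl ?divr_gt0 // invf_div.
have n3 : 0 <= nu3 b x by have /andP[] := freq01 R A (m * t) (b, x).
apply: (@le_trans _ _ ((nu2 b x / 2) ^+ 2)).
  rewrite expr2 (_ : _ * _ = nu2 b x / 4 * nu2 b x); last by field.
  by rewrite ler_wpM2r // ler_wpM2r ?invr_ge0.
rewrite -subr_ge0 (_ : _ - _ = (nu2 b x / 2 - nu3 b x) * (3 / 2 * nu2 b x - nu3 b x)); last by field.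
apply: mulr_ge0; move: lt; have := nu2_ge0 b x; lra.
Qed.

Definition block y s := [pred z : 'I_n | (A z == A y) && (pos (m * t) z == pos m y * t + s)%N].

(** Unevenness below 1 excludes both a rare letter and every bad block. By the second bound, the
    average of a nonnegative function over a block is at most [8 * t] times its average over the
    whole cell. *)
Lemma block_large y s : (s < t)%N -> unevenness y < 1 ->
  theta * n%:R / (4 * (m * t)%:R) <= #|block y s|%:R /\
  \sum_(z | (A z == A y) && (pos m z == pos m y)) 1 <= 8 * t%:R * #|block y s|%:R :> R.
Proof.
move=> st uy.
have th : theta <= nu2 (A y) y.
  rewrite leNgt; apply/negP => lt; move: uy; rewrite /unevenness lt ltNge lerDl.
  by rewrite mulr_ge0 // sumr_ge0.
have cmt : (pos m y * t + s < m * t)%N.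
  by have := pos_lt y m_gt0; move: st; nia.
have [x px] : exists x : 'I_n, pos (m * t) x = (pos m y * t + s)%N.
  have [le _] := card_pos n mt_gt0 cmt.
  have : (0 < #|[pred x : 'I_n | pos (m * t) x == pos m y * t + s]|)%N by nia.
  by case/card_gt0P => x; rewrite inE => /eqP; exists x.
have pxy : pos m x = pos m y.
  by rewrite -(pos_divn m x t_gt0) px divnMDl // divn_small // addn0.
have ex : nu2 (A y) x = nu2 (A y) y by apply: freq_eq.
have n3 : nu2 (A y) y / 2 <= nu3 (A y) x.
  rewrite leNgt; apply/negP => lt; move: uy; rewrite /unevenness ltNge => /negP; apply.
  rewrite ler_wpDl //.
  pose c := #|[pred x : 'I_n | (pos (m * t) x == pos m y * t + s)%N]|.
  have le : (n <= m * t * c + m * t)%N by have [] := card_pos n mt_gt0 cmt.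
  apply: (@le_trans _ _ (2 * (m * t)%:R / n%:R * c%:R)).
    rewrite mulrAC ler_pdivlMr ?ltr0n // mul1r -!natrM ler_nat; nia.
  rewrite ler_wpM2l // /c -sumr_const big_mkcond [X in _ <= X]big_mkcond.
  apply: ler_sum => z _; rewrite unfold_in /=; case: eqP => [pz|_]; last by case: ifP.
  have pzx : pos (m * t) z = pos (m * t) x by rewrite pz px.
  have pzy : pos m z = pos m y by rewrite -(pos_divn m z t_gt0) pzx pos_divn.
  rewrite pzy eqxx /bad /nu2 /nu3 (freq_eq R A _ pzy) (freq_eq R A _ pzx).
  by rewrite -/(nu2 _ _) -/(nu3 _ _) th lt.
have cE : #|block y s|%:R = nu3 (A y) x * gridsize R (m * t) x.
  rewrite /nu3 -sum_freq_cell -sumr_const px.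
  by apply: eq_bigl => z; rewrite unfold_in.
rewrite cE sum_freq_cell -/(nu2 _ _).
have /andP[g3 _] := gridsize_bounds R x mt_gt0 n_large.
have /andP[_ g2] := gridsize_bounds R y m_gt0 (leq_trans (leq_mul (leqnn 2) (leq_pmulr m t_gt0)) n_large).
have n2 : 0 < nu2 (A y) y by apply: lt_le_trans th.
have big : nu2 (A y) y / 2 * (n%:R / (2 * (m * t)%:R)) <= nu3 (A y) x * gridsize R (m * t) x.
  have d1 : 0 <= nu2 (A y) y / 2 by rewrite divr_ge0 // ltW.
  have d2 : 0 <= n%:R / (2 * (m * t)%:R) :> R by rewrite divr_ge0 // mulr_ge0.
  exact: ler_pM.
split.
- apply: le_trans big; rewrite -subr_ge0.
  rewrite (_ : _ - _ = (nu2 (A y) y - theta) * (n%:R / (4 * (m * t)%:R))).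
    by rewrite mulr_ge0 ?subr_ge0 // divr_ge0 // mulr_ge0.
  by field; rewrite !gt_eqF ?ltr0n.
- apply: le_trans (ler_wpM2l (ltW n2) g2) _.
  apply: (@le_trans _ _ (8 * t%:R * (nu2 (A y) y / 2 * (n%:R / (2 * (m * t)%:R))))).
    rewrite le_eqVlt; apply/orP; left; apply/eqP; rewrite natrM.
    by field; rewrite !gt_eqF ?ltr0n.
  by rewrite ler_wpM2l // mulr_ge0.
Qed.

End Evenness.

Section Clusters.
Variables (R : realType) (V I : finType) (usd : pred I) (U : I -> pred V) (mu : R).
Variables (ind : rel I) (Z Z' : V -> V -> R) (h : V -> R) (E : R) (v0 : V).
Hypotheses (mu_gt0 : 0 < mu) (E_ge0 : 0 <= E).
Hypothesis U_large : forall i, usd i -> mu <= #|U i|%:R.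
Hypotheses (Z0 : forall x y, 0 <= Z x y) (Z'0 : forall x y, 0 <= Z' x y) (h0 : forall x, 0 <= h x).
Hypothesis Z'_small : forall i i', usd i -> usd i' -> ind i i' ->
  \sum_(x | U i x) \sum_(y | U i' y) Z' x y <= E * (#|U i|%:R * #|U i'|%:R).

Lemma clusters : exists z : I -> V,
  (forall i, usd i -> U i (z i)) /\
  \sum_i \sum_(i' | i' != i) (usd i)%:R * (usd i')%:R *
     (Z (z i) (z i') + (ind i i')%:R * Z' (z i) (z i')) +
  \sum_i (usd i)%:R * h (z i) <=
  #|I|%:R ^+ 2 * (mu ^- 2 * (\sum_x \sum_y Z x y) + E) + #|I|%:R * (mu^-1 * \sum_x h x).
Proof.
pose w i x : R := if usd i then (U i x)%:R / #|U i|%:R else (x == v0)%:R.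
have U0 i : usd i -> 0 < #|U i|%:R :> R by move=> /U_large; apply: lt_le_trans.
have w0 i x : 0 <= w i x by rewrite /w; case: ifP => _; rewrite ?ler0n // divr_ge0.
have w1 i : \sum_x w i x = 1.
  rewrite /w; have [us|us] := boolP (usd i); last first.
    by rewrite (bigD1 v0) //= eqxx big1 ?addr0 // => x /negPf ->.
  rewrite -mulr_suml (_ : \sum_x _ = #|U i|%:R) ?mulfV ?gt_eqF ?U0 //.
  by rewrite -sumr_const [RHS]big_mkcond; apply: eq_bigr => x _; rewrite unfold_in; case: (U i x).
pose g i i' x y : R := (usd i)%:R * (usd i')%:R * (Z x y + (ind i i')%:R * Z' x y).
pose h' i x : R := (usd i)%:R * h x.
have [z wz le] := selection w0 w1 g h'.
exists z; split.
  move=> i us; have := wz i; rewrite /w us.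
  by case: (U i (z i)); rewrite ?mul0r ?ltxx.
apply: le_trans le _; have mui : 0 <= mu^-1 by rewrite invr_ge0 ltW.
have wU i x : usd i -> w i x <= mu^-1.
  move=> us; rewrite /w us; apply: (@le_trans _ _ (#|U i|%:R)^-1).
    by case: (U i x); rewrite ?mul1r // mul0r invr_ge0.
  by rewrite lef_pV2 ?posrE ?U0 // U_large.
apply: lerD; last first.
  apply: (@le_trans _ _ (\sum_(i : I) mu^-1 * \sum_x h x)); last by rewrite sumr_const mulr_natl.
  apply: ler_sum => i _; rewrite mulr_sumr; apply: ler_sum => x _; rewrite /h'.
  have [us|_] := boolP (usd i); last by rewrite mul0r mulr0 mulr_ge0.
  by rewrite mul1r ler_wpM2r // wU.
have S0 : 0 <= mu ^- 2 * (\sum_x \sum_y Z x y).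
  apply: mulr_ge0; first by rewrite invr_ge0 exprn_ge0 // ltW.
  by apply: sumr_ge0 => x _; apply: sumr_ge0.
apply: (@le_trans _ _ (\sum_(i : I) \sum_(i' : I) (mu ^- 2 * (\sum_x \sum_y Z x y) + E))); last first.
  set X := _ + E.
  by rewrite !sumr_const -(mulr_natl (X *+ _)) -(mulr_natl X) mulrA -expr2.
apply: ler_sum => i _; rewrite big_mkcond; apply: ler_sum => i' _.
case: ifP => _; last by rewrite addr_ge0.
have [us|us] := boolP (usd i); last first.
  rewrite big1 ?addr_ge0 // => x _; apply: big1 => y _.
  by rewrite /g (negPf us) !(mul0r, mulr0).
have [us'|us'] := boolP (usd i'); last first.
  rewrite big1 ?addr_ge0 // => x _; apply: big1 => y _.
  by rewrite /g (negPf us') !(mul0r, mulr0).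
have -> : \sum_x \sum_y w i x * w i' y * g i i' x y =
    \sum_x \sum_y w i x * w i' y * Z x y + (ind i i')%:R * (\sum_x \sum_y w i x * w i' y * Z' x y).
  rewrite mulr_sumr -big_split; apply: eq_bigr => x _.
  rewrite mulr_sumr -big_split; apply: eq_bigr => y _ /=.
  by rewrite /g us us' !mul1r; ring.
apply: lerD.
  rewrite mulr_sumr; apply: ler_sum => x _; rewrite mulr_sumr; apply: ler_sum => y _.
  by rewrite ler_wpM2r // -exprVn expr2 ler_pM // wU.
have [ii'|_] := boolP (ind i i'); last by rewrite mul0r.
rewrite mul1r; have -> : \sum_x \sum_y w i x * w i' y * Z' x y =
    (\sum_(x | U i x) \sum_(y | U i' y) Z' x y) / (#|U i|%:R * #|U i'|%:R).
  rewrite mulr_suml [RHS]big_mkcond; apply: eq_bigr => x _ /=.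
  rewrite /w us us'; case: (U i x); last by apply: big1 => y _; rewrite !mul0r.
  rewrite mulr_suml [RHS]big_mkcond; apply: eq_bigr => y _ /=.
  case: (U i' y); last by rewrite !(mul0r, mulr0).
  by rewrite !mul1r -invfM mulrC.
by rewrite ler_pdivrMr ?mulr_gt0 ?U0 // Z'_small.
Qed.

End Clusters.

(** * Distance to the recoloured graph *)

Section Distance.
Variables (R : realType) (S : finType) (n k : nat) (G : ograph S n) (A : 'I_n -> 'I_k).
Variables (m1 m2 : nat) (kap al tau : R) (K2 : eqType) (P2 : 'I_n -> K2).
Variables (xs : 'I_m1 -> 'I_n) (ys : 'I_m1 * 'I_k -> 'I_n) (newc : 'I_n -> 'I_n -> S).
Hypotheses (m1_gt0 : (0 < m1)%N) (m2_gt0 : (0 < m2)%N) (m12 : (m1 %| m2)%N).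
Hypotheses (n_large : (2 * m1 <= n)%N) (tau_gt0 : 0 < tau) (al_ge0 : 0 <= al).
Hypothesis xsE : forall j, pos m1 (xs j) = j.
Hypothesis ysE : forall j a, used A m2 kap a (xs j) ->
  A (ys (j, a)) = a /\ pos m2 (ys (j, a)) = pos m2 (xs j).
Implicit Types (x y u v : 'I_n) (a : 'I_k) (j : 'I_m1) (c : S).

Definition jof u : 'I_m1 := Ordinal (pos_lt u m1_gt0).

Let tm u := tame A m1 m2 kap (A u) (xs (jof u)).
Let yof u := ys (jof u, A u).

Hypothesis newcE : forall u v c, (u < v)%N -> pos m1 u != pos m1 v -> tm u -> tm v ->
  gcol G c u v -> al <= dens R G P2 (c, yof u, yof v) -> newc u v = c.

Let P1 x := (A x, pos m1 x).
Let gap (w : S * 'I_n * 'I_n) : R := dens R G P2 w - dens R G P1 w.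

Let yofP u : tm u -> P1 (yof u) = P1 u.
Proof.
move=> /andP[us _]; have [Ay py] := ysE us; rewrite /P1 /yof Ay.
have [d m2E] := dvdnP m12.
have d0 : (0 < d)%N by move: m2_gt0; rewrite m2E muln_gt0 => /andP[].
move: py => /(congr1 (fun z => z %/ d)%N) /=.
by rewrite m2E [(d * m1)%N]mulnC !pos_divn // xsE => ->.
Qed.

Let bad_same u v : R := (pos m1 v == pos m1 u)%:R.
Let bad_rare u v : R := \sum_c fcol R G (c, u, v) *
  [&& pos m1 u != pos m1 v, tm u, tm v & (dens R G P2 (c, yof u, yof v) < al)%R]%:R.

Let sum_by_label (F : 'I_m1 -> 'I_k -> R) :
  \sum_u F (jof u) (A u) = \sum_j \sum_a cardV R A j a * F j a.
Proof.
rewrite (partition_big jof predT) //=; apply: eq_bigr => j _.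
rewrite (partition_big A predT) //=; apply: eq_bigr => a _.
rewrite /cardV mulr_suml; apply: eq_big => [u|u /andP[/eqP <- /eqP <-]]; last by rewrite mul1r.
by rewrite andbC -val_eqE.
Qed.

(** A pair changes colour only if its ends share an interval, or an end has a letter that is not
    tame, or its colour is rare between the picked cells. The first three terms and the last one
    bound these cases; [al + tau] and the squared gaps belong to the third. *)
Lemma odist_recolour :
  (odist G (recolour newc))%:R <= 2 * n%:R ^+ 2 / m1%:R +
   2 * n%:R * (\sum_j \sum_a cardV R A j a * (~~ tame A m1 m2 kap a (xs j))%:R) +
   #|S|%:R * (al + tau) * n%:R ^+ 2 +
   tau^-1 * \sum_j \sum_(j' | j' != j) \sum_a \sum_a'
    (tame A m1 m2 kap a (xs j))%:R * (tame A m1 m2 kap a' (xs j'))%:R *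
    (cardV R A j a * cardV R A j' a') * \sum_c gap (c, ys (j, a), ys (j', a')) ^+ 2.
Proof.
have tau_ge0 := ltW tau_gt0.
pose B u v : R := bad_same u v + ((~~ tm u)%:R + (~~ tm v)%:R) + bad_rare u v.
have rare0 u v : 0 <= bad_rare u v.
  by apply: sumr_ge0 => c _; rewrite mulr_ge0 ?ler0n.
have B0 u v : 0 <= B u v by rewrite !addr_ge0 ?ler0n.
have odist_le : (odist G (recolour newc))%:R <= \sum_u \sum_v B u v.
  rewrite (pair_bigA _ B) /= /odist -sumr_const.
  rewrite (eq_bigl (fun e => G e != recolour newc e)) => [|e]; last by rewrite inE.
  apply: (@le_trans _ _ (\sum_(e | G e != recolour newc e) B (ends e).1 (ends e).2)).
    apply: ler_sum => e; rewrite ffunE; have [lt ve] := endsP e.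
    case: (ends e) lt ve => u v /= lt ve ne; rewrite /B /bad_same.
    have [same|diff] := eqVneq (pos m1 v) (pos m1 u).
      by rewrite -[leLHS]addr0 -addrA lerD // !addr_ge0 ?ler0n.
    rewrite add0r; have [tu|_] := boolP (tm u); last first.
      by rewrite -[leLHS]addr0 -addrA lerD // addr_ge0 ?ler0n.
    have [tv|_] := boolP (tm v); last by rewrite add0r lerDl.
    rewrite !add0r /bad_rare (bigD1 (G e)) //= /fcol (gcolE _ _ ve) eqxx mul1r tu tv eq_sym diff /=.
    have [lt_al|ge_al] := ltrP (dens R G P2 (G e, yof u, yof v)) al.
      by rewrite lerDl; apply: sumr_ge0 => c _; rewrite mulr_ge0 ?ler0n.
    case/negP: ne; rewrite (newcE lt _ tu tv _ ge_al) ?eqxx // 1?eq_sym //.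
    by rewrite (gcolE _ _ ve).
  have inj : injective (@ends n).
    move=> e e' E; apply: val_inj.
    by have [_ ->] := endsP e; have [_ ->] := endsP e'; rewrite E.
  rewrite -(@big_imset _ _ _ _ _ (@ends n) [pred e | G e != recolour newc e]
    (fun p => B p.1 p.2)); last by move=> e e' _ _; apply: inj.
  by rewrite big_mkcond; apply: ler_sum => p _; case: ifP.
apply: le_trans odist_le _.
under eq_bigr do rewrite 2!big_split /=.
rewrite 2!big_split /= -[leRHS]addrA; apply: lerD; first apply: lerD.
- have -> : 2 * n%:R ^+ 2 / m1%:R = \sum_(u < n) 2 * n%:R / m1%:R :> R.
    by rewrite sumr_const card_ord -[RHS]mulr_natr expr2 mulrA mulrAC.
  apply: ler_sum => u _; have /andP[_] := gridsize_bounds R u m1_gt0 n_large.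
  apply: le_trans; rewrite /gridsize /cellsize -sumr_const [leRHS]big_mkcond.
  by apply: ler_sum => v _; rewrite unfold_in /bad_same /=; case: eqP.
- have e1 : \sum_u (~~ tm u)%:R = \sum_j \sum_a cardV R A j a * (~~ tame A m1 m2 kap a (xs j))%:R.
    by rewrite -sum_by_label.
  have e2 : \sum_u \sum_v ((~~ tm u)%:R + (~~ tm v)%:R) = 2 * n%:R * (\sum_u (~~ tm u)%:R) :> R.
    under eq_bigr do rewrite big_split /= sumr_const card_ord.
    rewrite big_split /= sumr_const card_ord sumrMnl; set X := \sum_u _.
    by rewrite -(mulr_natr X n); ring.
  by rewrite e2 e1.
- pose phi (w : S * 'I_n * 'I_n) := [&& pos m1 w.1.2 != pos m1 w.2, tm w.1.2, tm w.2 &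
    (dens R G P2 (w.1.1, yof w.1.2, yof w.2) < al)%R].
  have -> : \sum_u \sum_v bad_rare u v = \sum_w fcol R G w * (phi w)%:R.
    by rewrite sum3 [RHS]exchange_big; apply: eq_bigr => u _; rewrite [RHS]exchange_big.
  (* Being rare depends only on the [P1] cells of the two ends, so the number of rare pairs can be
     computed with [P1] densities. *)
  have mphi : measurable_wrt (lift2 P1) (fun w => (phi w)%:R : R).
    move=> [[c u] v] [[c' u'] v'] [-> Au pu Av pv].
    have ju : jof u = jof u' by apply: val_inj.
    have jv : jof v = jof v' by apply: val_inj.
    by rewrite /phi /tm /yof /= Au Av ju jv pu pv.
  rewrite -(sum_cexpM _ mphi) -/(dens R G P1).
  apply: (@le_trans _ _ (\sum_(w : S * 'I_n * 'I_n) ((al + tau) + tau^-1 *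
     ([&& pos m1 w.1.2 != pos m1 w.2, tm w.1.2 & tm w.2]%:R * gap (w.1.1, yof w.1.2, yof w.2) ^+ 2)))).
    apply: ler_sum => -[[c u] v] _; rewrite /phi /=.
    have ag0 (b : bool) : 0 <= al + tau + tau^-1 * (b%:R * gap (c, yof u, yof v) ^+ 2).
      by rewrite !addr_ge0 // mulr_ge0 ?invr_ge0 // mulr_ge0 ?sqr_ge0.
    case: (pos m1 u != pos m1 v) => /=; last by rewrite mulr0 (ag0 false).
    have [tu|_] /= := boolP (tm u); last by rewrite mulr0 (ag0 false).
    have [tv|_] /= := boolP (tm v); last by rewrite mulr0 (ag0 false).
    case: ltrP => [lt|_]; last by rewrite mulr0 (ag0 true).
    rewrite mulr1 mul1r.
    have -> : dens R G P1 (c, u, v) = dens R G P1 (c, yof u, yof v).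
      apply: cexp_measurable; rewrite /lift2 /=; by rewrite !yofP.
    set d2 := dens R G P2 _ in lt; rewrite /gap -/d2; set d1 := dens R G P1 _.
    (* As [d2] is below [al], it suffices that [d1 - d2] is at most [tau + (d1 - d2) ^ 2 / tau]; the
       three squares show this. *)
    have sq : 0 <= (tau - (d1 - d2)) ^+ 2 / (2 * tau) + (d2 - d1) ^+ 2 / (2 * tau) + tau / 2.
      by rewrite !addr_ge0 // divr_ge0 ?sqr_ge0 ?mulr_ge0.
    rewrite -subr_ge0; apply: le_trans sq _; rewrite -subr_ge0.
    rewrite (_ : _ - _ = al - d2); last by field; rewrite gt_eqF.
    by rewrite subr_ge0 ltW.
  rewrite big_split /=; apply: lerD.
    rewrite sumr_const !card_prod card_ord -(mulr_natr (al + tau)) !natrM.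
    by rewrite le_eqVlt; apply/orP; left; apply/eqP; ring.
  rewrite -mulr_sumr ler_wpM2l ?invr_ge0 ?(ltW tau_gt0) //.
  rewrite sum3 exchange_big /=; under eq_bigr do rewrite exchange_big /=.
  pose H j a j' a' : R := (j' != j)%:R * ((tame A m1 m2 kap a (xs j))%:R *
     (tame A m1 m2 kap a' (xs j'))%:R * \sum_c gap (c, ys (j, a), ys (j', a')) ^+ 2).
  have -> : \sum_u \sum_v \sum_c [&& pos m1 u != pos m1 v, tm u & tm v]%:R * gap (c, yof u, yof v) ^+ 2 =
     \sum_u \sum_v H (jof u) (A u) (jof v) (A v).
    apply: eq_bigr => u _; apply: eq_bigr => v _; rewrite -mulr_sumr /H mulrA.
    congr (_ * _); rewrite -val_eqE /= eq_sym -/(tm u) -/(tm v).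
    by case: (_ != _); case: (tm u); case: (tm v); rewrite /= ?(mulr0, mul0r, mulr1).
  have -> : \sum_u \sum_v H (jof u) (A u) (jof v) (A v) =
      \sum_u (fun j a => \sum_j' \sum_a' cardV R A j' a' * H j a j' a') (jof u) (A u).
    by apply: eq_bigr => u _; apply: sum_by_label.
  rewrite (sum_by_label (fun j a => \sum_j' \sum_a' cardV R A j' a' * H j a j' a')).
  apply: ler_sum => j _ /=; under eq_bigr do rewrite mulr_sumr.
  rewrite exchange_big [leRHS]big_mkcond; apply: ler_sum => j' _.
  case: ifP => jj; last first.
    by rewrite big1 // => a _; rewrite big1 ?mulr0 // => a' _; rewrite /H jj mul0r mulr0.
  apply: ler_sum => a _; rewrite mulr_sumr; apply: ler_sum => a' _.
  by rewrite /H jj mul1r le_eqVlt; apply/orP; left; apply/eqP; ring.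
Qed.

End Distance.

(** * A single graph *)

Lemma ler_term_sum (R : numDomainType) (I : finType) (P : pred I) (F : I -> R) i :
  P i -> (forall j, 0 <= F j) -> F i <= \sum_(j | P j) F j.
Proof. by move=> Pi F0; rewrite (bigD1 i) //= lerDl sumr_ge0. Qed.

Lemma sum_small_cells (R : realType) (V : finType) (k : nat) (p : V -> 'I_k) (b : R) : 0 <= b ->
  \sum_x (cellsize R p x < b)%R%:R <= k%:R * b.
Proof.
move=> b0; rewrite (partition_big p predT) //= mulr_natl.
have -> : b *+ k = \sum_(i < k) b by rewrite sumr_const card_ord.
apply: ler_sum => i _.
have [/existsP[x /eqP <-]|/existsPn no] := boolP [exists x, p x == i]; last first.
  by rewrite big_pred0 // => x; apply/negbTE/no.
rewrite (eq_bigr (fun=> (cellsize R p x < b)%R%:R)) => [|y /eqP /(eq_cellsize R) -> //].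
by rewrite sum_cell_const; case: ltP => [lt|_]; rewrite ?mul1r ?mul0r // ltW.
Qed.

Section CellDensity.
Variables (R : realType) (S : finType) (n : nat) (G : ograph S n) (K : eqType) (P : 'I_n -> K).
Implicit Types (x y : 'I_n) (c : S).

Lemma gcol_inj c c' x y : gcol G c x y -> gcol G c' x y -> c = c'.
Proof. by case/existsP=> e /andP[/eqP ve /eqP <-]; rewrite (gcolE _ _ ve) => /eqP. Qed.

Lemma cexp_lift2 (f : S * 'I_n * 'I_n -> R) c x y :
  cexp (lift2 P) f (c, x, y) * (cellsize R P x * cellsize R P y) =
  \sum_(u | P u == P x) \sum_(v | P v == P y) f (c, u, v).
Proof.
have sumE (H : S * 'I_n * 'I_n -> R) : \sum_(w | lift2 P w == lift2 P (c, x, y)) H w =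
    \sum_(u | P u == P x) \sum_(v | P v == P y) H (c, u, v).
  rewrite big_mkcond sum3 (bigD1 c) //= [X in _ + X]big1 ?addr0 => [|c' /negPf cc]; last first.
    by apply: big1 => u _; apply: big1 => v _; rewrite /lift2 !xpair_eqE /= cc.
  rewrite [RHS]big_mkcond; apply: eq_bigr => u _ /=.
  case: ifP => Pu; last by apply: big1 => v _; rewrite /lift2 !xpair_eqE /= Pu andbF.
  rewrite [RHS]big_mkcond; apply: eq_bigr => v _ /=.
  by rewrite /lift2 !xpair_eqE /= eqxx Pu.
have -> : cellsize R P x * cellsize R P y = cellsize R (lift2 P) (c, x, y).
  rewrite -[RHS]mul1r -[RHS]sum_cell_const.
  rewrite (sumE (fun=> 1)).
  under [RHS] eq_bigr do rewrite sum_cell_const mul1r.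
  by rewrite sum_cell_const mulrC.
by rewrite -cexp_sum; exact: sumE.
Qed.

(** Distinct cells are disjoint, so no product pair is of the form [(x, x)], the only form without a
    colour. *)
Lemma sum_dens x y : P x != P y -> \sum_c dens R G P (c, x, y) = 1.
Proof.
move=> xy; have N0 : 0 < cellsize R P x * cellsize R P y by rewrite mulr_gt0 ?cellsize_gt0.
apply: (mulIf (lt0r_neq0 N0)); rewrite mul1r mulr_suml.
under eq_bigr do rewrite cexp_lift2.
rewrite exchange_big /=.
transitivity (\sum_(u | P u == P x) \sum_(v | P v == P y) (1 : R)); last first.
  under eq_bigr do rewrite sum_cell_const mul1r.
  by rewrite sum_cell_const mulrC.
apply: eq_bigr => u /eqP Pu; rewrite exchange_big; apply: eq_bigr => v /eqP Pv /=.
by rewrite sum_fcol (_ : u != v) //; apply: contra xy => /eqP uv; rewrite -Pu -Pv uv.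
Qed.

Lemma dens_large (al : R) x y : P x != P y -> al * #|S|%:R <= 1 ->
  exists c, al <= dens R G P (c, x, y).
Proof.
move=> xy al1; apply: contrapT => /forallNP no.
have s1 := sum_dens xy.
have [c0 _] : exists c0 : S, True.
  apply: contrapT => /forallNP nc; move: s1; rewrite big1 => [/eqP|c _]; last by case: (nc c).
  by rewrite eq_sym oner_eq0.
have : \sum_c dens R G P (c, x, y) < \sum_(c : S) al.
  apply: ltr_sum => [|c _]; last by rewrite ltNge; apply/negP/no.
  by apply/hasP; exists c0; rewrite ?mem_index_enum.
by rewrite s1 sumr_const -(mulr_natr al) ltNge al1.
Qed.

End CellDensity.

Section SingleGraph.
Variables (R : realType) (S : finType) (Fam : seq (anyograph S)) (Q n : nat) (G : ograph S n).
Variables (k1 k2 kS kT m1 m2 t : nat).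
Variables (A1 : 'I_n -> 'I_k1) (A2 : 'I_n -> 'I_k2) (PS : 'I_n -> 'I_kS) (PT : 'I_n -> 'I_kT).
Variables (eps al tau kap th bet lam c0 c1 c2 c4 e1 e2 e3 e4 e5 : R).
Hypothesis Fam_le : forall F, F \in Fam -> (tag F <= Q)%N.
Hypotheses (m1_gt0 : (0 < m1)%N) (m2_gt0 : (0 < m2)%N) (t_gt0 : (0 < t)%N) (m12 : (m1 %| m2)%N).
Hypothesis n_large : (2 * (m2 * t) <= n)%N.
Hypothesis t_ramsey : forall col : nat -> nat -> {ffun 'I_k1 * 'I_k1 -> S},
  exists (h : nat -> nat) c, [/\ forall i, (i < Q)%N -> (h i < t)%N,
    forall i j, (i < j < Q)%N -> (h i < h j)%N &
    forall i j, (i < j < Q)%N -> col (h i) (h j) = c].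
Hypotheses (A21 : measurable_wrt A2 A1) (PSA2 : measurable_wrt PS A2).
Hypotheses (PSpos : measurable_wrt PS (pos (m2 * t))) (PTS : measurable_wrt PT PS).
Hypothesis stab1 : energy2 R G PS <= energy2 R G A1 + e1 * n%:R ^+ 2.
Hypothesis stab2 : energy1 R A1 m2 <= energy1 R A1 m1 + e2 * n%:R.
Hypothesis stab3 : energy2 R G PS <= energy2 R G A2 + e3 * n%:R ^+ 2.
Hypothesis stab4 : energy1 R A2 (m2 * t) <= energy1 R A2 m2 + e4 * n%:R.
Hypothesis stab5 : energy2 R G PT <= energy2 R G PS + e5 * n%:R ^+ 2.
Hypothesis stab6 : forall k' (P' : 'I_n -> 'I_k'), (k' <= kT * 4)%N ->
  measurable_wrt P' PT -> energy2 R G P' <= energy2 R G PT + lam ^+ 2 * n%:R ^+ 2.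
Hypotheses (al_gt0 : 0 < al) (tau_gt0 : 0 < tau) (kap_gt0 : 0 < kap) (th_gt0 : 0 < th).
Hypotheses (bet01 : 0 < bet <= 1) (lam_gt0 : 0 < lam).
Hypotheses (c0_gt0 : 0 < c0) (c1_gt0 : 0 < c1) (c2_gt0 : 0 < c2) (c4_gt0 : 0 < c4).
Hypothesis al_small : al * #|S|%:R <= 1.
Hypothesis kap_small : kap * k1%:R <= 1.
Hypothesis budget1 : 4 * (c1 * e1) + (2 * m1%:R / kap * k1%:R) ^+ 2 * (c2 * e3) +
  c0 * (2 * kap * k1%:R + 2 / kap * e2) +
  2 * m1%:R / kap * k1%:R * (th * k2%:R + 16 * t%:R / th * e4) < 1.
Hypothesis budget2 : 2 / m1%:R + 2 / c0 + #|S|%:R * (al + tau) + (tau * c1)^-1 < eps / 4.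
Let M : R := (m1 * k1 * t)%:R.
Let mu0 : R := th / (4 * (m2 * t)%:R).
Hypothesis budget3 :
  M ^+ 2 * (mu0 ^- 2 * (c4 * e5) + 4 / al ^+ 2 * (64 * t%:R ^+ 2 / c2)) +
  M * (kS%:R * bet / mu0) < 1.
Hypothesis c4_large : (Q ^ 2)%:R * (16 / (al ^+ 2 * c4)) <= 1 / 2.
Hypothesis lam_small : (Q ^ 2)%:R * lam <= (al / 4) ^+ (Q ^ 2) * bet ^+ Q / 4.

Implicit Types (x y u v : 'I_n) (a : 'I_k1) (j : 'I_m1) (c : S) (l : 'I_m1 * 'I_k1).

Let P1 x := (A1 x, pos m1 x).
Let P2 x := (A2 x, pos m2 x).

Let n_gt0 : (0 < n)%N.
Proof. by apply: leq_trans n_large; rewrite !muln_gt0 m2_gt0. Qed.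

Let nR : 0 < n%:R :> R. Proof. by rewrite ltr0n. Qed.

Let m2n : (2 * m2 <= n)%N.
Proof. by apply: leq_trans n_large; rewrite leq_mul2l leq_pmulr. Qed.

Let m1n : (2 * m1 <= n)%N.
Proof. by apply: leq_trans m2n; rewrite leq_mul2l dvdn_leq. Qed.

Let pos21 x y : pos m2 x = pos m2 y -> pos m1 x = pos m1 y.
Proof.
have [d m2E] := dvdnP m12.
have d0 : (0 < d)%N by move: m2_gt0; rewrite m2E muln_gt0 => /andP[].
by rewrite m2E mulnC => e; rewrite -(pos_divn m1 x d0) -(pos_divn m1 y d0) e.
Qed.

Let P21 : measurable_wrt P2 P1.
Proof. by move=> x y [/A21 e /pos21 e']; rewrite /P1 e e'. Qed.

Let PS2 : measurable_wrt PS P2.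
Proof.
move=> x y e; rewrite /P2 (PSA2 e); congr (_, _).
by have := PSpos e; rewrite -(pos_divn m2 x t_gt0) -(pos_divn m2 y t_gt0) => ->.
Qed.

Let gap12 x y : R := \sum_c (dens R G P2 (c, x, y) - dens R G P1 (c, x, y)) ^+ 2.
Let gap2S (w : S * 'I_n * 'I_n) : R := (dens R G PS w - dens R G P2 w) ^+ 2.
Let gapST (w : S * 'I_n * 'I_n) : R := (dens R G PT w - dens R G PS w) ^+ 2.
(** Averaging over the [P2] cells makes this a function of these cells: it says how typical the [PS]
    densities inside a pair of picked cells are. *)
Let loc2 x y : R := \sum_c cexp (lift2 P2) gap2S (c, x, y).
Let locS x y : R := \sum_c cexp (lift2 PS) gapST (c, x, y).

Let sum_colours (H : S * 'I_n * 'I_n -> R) :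
  \sum_x \sum_y \sum_c H (c, x, y) = \sum_w H w.
Proof. by rewrite sum3 [RHS]exchange_big; apply: eq_bigr => x _; rewrite exchange_big. Qed.

Let sum_gap12 : \sum_x \sum_y gap12 x y <= e1 * n%:R ^+ 2.
Proof.
rewrite (sum_colours (fun w => (dens R G P2 w - dens R G P1 w) ^+ 2)) dens_diff //.
(* In energy, [A1], [P1], [P2] and [PS] are in increasing order, so the stability of [A1] against
   [PS] covers the step from [P1] to [P2]. *)
have l1 := energy2_mono R G PS2.
have l2 : energy2 R G A1 <= energy2 R G P1 by apply: energy2_mono => x y [].
move: stab1; lra.
Qed.

Let sum_loc2 : \sum_x \sum_y loc2 x y <= e3 * n%:R ^+ 2.
Proof.
rewrite (sum_colours (cexp (lift2 P2) gap2S)) sum_cexp dens_diff //.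
have l2 : energy2 R G A2 <= energy2 R G P2 by apply: energy2_mono => x y [].
move: stab3; lra.
Qed.

Let sum_locS : \sum_x \sum_y locS x y <= e5 * n%:R ^+ 2.
Proof.
rewrite (sum_colours (cexp (lift2 PS) gapST)) sum_cexp dens_diff //.
move: stab5; lra.
Qed.

Let loc2_ge0 x y : 0 <= loc2 x y.
Proof. by apply: sumr_ge0 => c _; apply: cexp_ge0 => w; apply: sqr_ge0. Qed.

Let locS_ge0 x y : 0 <= locS x y.
Proof. by apply: sumr_ge0 => c _; apply: cexp_ge0 => w; apply: sqr_ge0. Qed.

Let gap12_ge0 x y : 0 <= gap12 x y.
Proof. by apply: sumr_ge0 => c _; apply: sqr_ge0. Qed.

Let us j a x := used A1 m2 kap a x.
Let tm j a x := tame A1 m1 m2 kap a x.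

Definition good_representatives (xs : 'I_m1 -> 'I_n) (ys : 'I_m1 * 'I_k1 -> 'I_n) :=
  [/\ forall j, pos m1 (xs j) = j,
      forall j a, used A1 m2 kap a (xs j) ->
        A1 (ys (j, a)) = a /\ pos m2 (ys (j, a)) = pos m2 (xs j),
      \sum_j \sum_a cardV R A1 j a * (~~ tame A1 m1 m2 kap a (xs j))%:R <= n%:R / c0 &
    [/\ \sum_j \sum_(j' | j' != j) \sum_a \sum_a'
          (tame A1 m1 m2 kap a (xs j))%:R * (tame A1 m1 m2 kap a' (xs j'))%:R *
          (cardV R A1 j a * cardV R A1 j' a') * gap12 (ys (j, a)) (ys (j', a')) <= n%:R ^+ 2 / c1,
        forall j j' a a', j' != j -> used A1 m2 kap a (xs j) -> used A1 m2 kap a' (xs j') ->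
          loc2 (ys (j, a)) (ys (j', a')) <= c2^-1 &
        forall j a, used A1 m2 kap a (xs j) -> unevenness A2 m2 t th (ys (j, a)) < 1]].

(** Every quantity is divided by the bound wanted for it, and [budget1] keeps the total price below
    1. All prices are nonnegative, so each weighted sum, and each single term for the conditions on
    individual picks, is below 1. *)
Let representatives_exist : exists xs ys, good_representatives xs ys.
Proof.
have c1n : 0 <= c1 / n%:R ^+ 2 by rewrite divr_ge0 ?exprn_ge0 // ltW.
have b0 : 0 <= c0 / n%:R by rewrite divr_ge0 // ltW.
have Z10 x y : 0 <= c1 / n%:R ^+ 2 * gap12 x y by rewrite mulr_ge0.
have Z20 x y : 0 <= c2 * loc2 x y by rewrite mulr_ge0 // ltW.
have h0 x : 0 <= unevenness A2 m2 t th x by exact: unevenness_ge0.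
have [xs [ys [xsE ysE le]]] := representatives A1 m1_gt0 m2_gt0 m12 m1n kap_gt0 b0 Z10 Z20 h0.
exists xs, ys.
pose SA := \sum_j \sum_(j' | j' != j) \sum_a \sum_a'
    (tame A1 m1 m2 kap a (xs j))%:R * (tame A1 m1 m2 kap a' (xs j'))%:R *
    (cardV R A1 j a * cardV R A1 j' a') * gap12 (ys (j, a)) (ys (j', a')).
pose FB j j' a a' : R := (used A1 m2 kap a (xs j))%:R * (used A1 m2 kap a' (xs j'))%:R *
    (c2 * loc2 (ys (j, a)) (ys (j', a'))).
pose SB := \sum_j \sum_(j' | j' != j) \sum_a \sum_a' FB j j' a a'.
pose SC := \sum_j \sum_a cardV R A1 j a * (~~ tame A1 m1 m2 kap a (xs j))%:R.
pose FD j a : R := (used A1 m2 kap a (xs j))%:R * unevenness A2 m2 t th (ys (j, a)).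
pose SD := \sum_j \sum_a FD j a.
have lt1 : c1 / n%:R ^+ 2 * SA + SB + (SC * (c0 / n%:R) + SD) < 1.
  apply: le_lt_trans budget1; apply: le_trans (le_trans le _).
    rewrite le_eqVlt; apply/orP; left; apply/eqP; congr (_ + _).
      rewrite /SA /SB mulr_sumr -big_split; apply: eq_bigr => j _.
      rewrite mulr_sumr -big_split; apply: eq_bigr => j' _.
      rewrite mulr_sumr -big_split; apply: eq_bigr => a _.
      rewrite mulr_sumr -big_split; apply: eq_bigr => a' _ /=.
      by congr (_ + _); rewrite mulrCA.
    rewrite /SC /SD mulr_suml -big_split; apply: eq_bigr => j _.
    by rewrite mulr_suml -big_split.
  have nn : n%:R != 0 :> R by rewrite gt_eqF.
  apply: lerD; [apply: lerD; [apply: lerD|]|].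
  - rewrite ler_wpM2l //; under eq_bigr do rewrite -mulr_sumr.
    rewrite -mulr_sumr; apply: le_trans (ler_wpM2l c1n sum_gap12) _.
    by rewrite le_eqVlt; apply/orP; left; apply/eqP; field.
  - under eq_bigr do rewrite -mulr_sumr.
    rewrite -mulr_sumr; apply: (@le_trans _ _ ((2 * m1%:R / (kap * n%:R) * k1%:R) ^+ 2 * (c2 * (e3 * n%:R ^+ 2)))).
      by apply: ler_wpM2l; [exact: sqr_ge0|apply: ler_wpM2l => //; exact: ltW].
    by rewrite le_eqVlt; apply/orP; left; apply/eqP; field; rewrite nn gt_eqF.
  - apply: (@le_trans _ _ (c0 / n%:R * (2 * kap * k1%:R * n%:R + 2 / kap * (e2 * n%:R)))).
      apply: ler_wpM2l => //; rewrite lerD2l; apply: ler_wpM2l; first by rewrite divr_ge0 // ltW.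
      by move: stab2; lra.
    by rewrite le_eqVlt; apply/orP; left; apply/eqP; field; rewrite nn gt_eqF.
  - apply: (@le_trans _ _ (2 * m1%:R / (kap * n%:R) * k1%:R * (th * k2%:R * n%:R + 16 * t%:R / th * (e4 * n%:R)))).
      apply: ler_wpM2l; first by rewrite mulr_ge0 // divr_ge0 ?mulr_ge0 // ltW.
      apply: le_trans (sum_unevenness A2 m2_gt0 t_gt0 n_large th_gt0) _.
      rewrite lerD2l; apply: ler_wpM2l; first by rewrite divr_ge0 ?mulr_ge0 // ltW.
      by move: stab4; lra.
    by rewrite le_eqVlt; apply/orP; left; apply/eqP; field; rewrite nn !gt_eqF.
have FB0 j j' a a' : 0 <= FB j j' a a' by rewrite /FB mulr_ge0 // mulr_ge0.
have FD0 j a : 0 <= FD j a by rewrite /FD mulr_ge0.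
have cV0 j a : 0 <= cardV R A1 j a by apply: sumr_ge0.
have SA0 : 0 <= c1 / n%:R ^+ 2 * SA.
  rewrite mulr_ge0 //; apply: sumr_ge0 => j _; apply: sumr_ge0 => j' _.
  by apply: sumr_ge0 => a _; apply: sumr_ge0 => a' _; rewrite !mulr_ge0.
have SC0 : 0 <= SC * (c0 / n%:R).
  by rewrite mulr_ge0 //; apply: sumr_ge0 => j _; apply: sumr_ge0 => a _; rewrite mulr_ge0.
have SB0 : 0 <= SB.
  by apply: sumr_ge0 => j _; apply: sumr_ge0 => j' _; apply: sumr_ge0 => a _; apply: sumr_ge0.
have SD0 : 0 <= SD by apply: sumr_ge0 => j _; apply: sumr_ge0.
split=> //.
  rewrite -/SC; have : SC * (c0 / n%:R) <= 1 by lra.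
  by rewrite -ler_pdivlMr ?divr_gt0 // div1r invf_div.
split.
- rewrite -/SA; have : c1 / n%:R ^+ 2 * SA <= 1 by lra.
  by rewrite -ler_pdivlMl ?divr_gt0 ?exprn_gt0 // mulr1 invf_div.
- move=> j j' a a' jj ua ua'; have : FB j j' a a' <= 1.
    apply: (@le_trans _ _ SB); last by lra.
    apply: le_trans (ler_term_sum (P := predT) (i := j) isT _) => [|i]; last first.
      by apply: sumr_ge0 => i' _; apply: sumr_ge0 => b _; apply: sumr_ge0.
    apply: le_trans (ler_term_sum (P := fun i => i != j) (i := j') jj _) => [|i]; last first.
      by apply: sumr_ge0 => b _; apply: sumr_ge0.
    apply: le_trans (ler_term_sum (P := predT) (i := a) isT _) => [|i]; last by apply: sumr_ge0.
    exact: ler_term_sum.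
  by rewrite /FB ua ua' !mul1r -ler_pdivlMl // mulr1.
- move=> j a ua; have : FD j a < 1; last by rewrite /FD ua mul1r.
  apply: (@le_lt_trans _ _ SD); last by lra.
  apply: le_trans (ler_term_sum (P := predT) (i := j) isT _) => [|i]; last by apply: sumr_ge0.
  exact: ler_term_sum.
Qed.

Let lt1_terms (T : finType) (F : T -> T -> R) (H : T -> R) :
  (forall i i', 0 <= F i i') -> (forall i, 0 <= H i) ->
  \sum_i \sum_(i' | i' != i) F i i' + \sum_i H i < 1 ->
  (forall i i', i' != i -> F i i' < 1) /\ (forall i, H i < 1).
Proof.
move=> F0 H0 lt1.
have S1 : 0 <= \sum_i \sum_(i' | i' != i) F i i' by apply: sumr_ge0 => i _; apply: sumr_ge0.
have S2 : 0 <= \sum_i H i by apply: sumr_ge0.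
split=> [i i' ii|i].
  apply: (@le_lt_trans _ _ (\sum_i \sum_(i' | i' != i) F i i')); last by lra.
  apply: le_trans (ler_term_sum (P := predT) (i := i) isT _) => [|j]; last by apply: sumr_ge0.
  exact: (ler_term_sum (P := fun i' => i' != i)).
apply: (@le_lt_trans _ _ (\sum_i H i)); last by lra.
exact: ler_term_sum.
Qed.

Definition good_clusters (xs : 'I_m1 -> 'I_n) (ys : 'I_m1 * 'I_k1 -> 'I_n)
    (z : ('I_m1 * 'I_k1) * 'I_t -> 'I_n) :=
  [/\ forall l s, used A1 m2 kap l.2 (xs l.1) ->
        A2 (z (l, s)) = A2 (ys l) /\ pos (m2 * t) (z (l, s)) = (pos m2 (ys l) * t + s)%N,
      forall l s, used A1 m2 kap l.2 (xs l.1) -> bet * n%:R <= cellsize R PS (z (l, s)),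
      forall l s l' s', used A1 m2 kap l.2 (xs l.1) -> used A1 m2 kap l'.2 (xs l'.1) ->
        (l', s') != (l, s) -> locS (z (l, s)) (z (l', s')) <= c4^-1 &
      forall l s l' s' c, used A1 m2 kap l.2 (xs l.1) -> used A1 m2 kap l'.2 (xs l'.1) ->
        l'.1 != l.1 -> gap2S (c, z (l, s), z (l', s')) <= (al / 2) ^+ 2].

(** The same pricing inside the blocks: [locS] is the global price, [gap2S] the local one,
    controlled through [loc2], and [h] charges points in small cells of [PS]. *)
Let clusters_exist xs ys : good_representatives xs ys -> exists z, good_clusters xs ys z.
Proof.
move=> [xsE ysE _ [_ loc2le even]].
have [bet0 _] := andP bet01.
pose usd (i : ('I_m1 * 'I_k1) * 'I_t) := used A1 m2 kap i.1.2 (xs i.1.1).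
pose U (i : ('I_m1 * 'I_k1) * 'I_t) : pred 'I_n := block A2 m2 t (ys i.1) i.2.
have mt0 : 0 < (m2 * t)%:R :> R by rewrite ltr0n muln_gt0 m2_gt0.
have mu0_gt0 : 0 < mu0 by rewrite divr_gt0 // mulr_gt0.
have UP i : usd i -> mu0 * n%:R <= #|U i|%:R /\
    cellsize R P2 (ys i.1) <= 8 * t%:R * #|U i|%:R.
  case: i => [[j a] s] ui; have [] := block_large m2_gt0 t_gt0 n_large th_gt0 (ltn_ord s) (even _ _ ui).
  rewrite /mu0 mulrAC => le1 le2; split=> //; apply: le_trans le2.
  rewrite /cellsize -sumr_const le_eqVlt; apply/orP; left; apply/eqP.
  by apply: eq_bigl => x; rewrite unfold_in /= /P2 xpair_eqE.
have mu_gt0 : 0 < mu0 * n%:R by rewrite mulr_gt0.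
(* The inverse of [(al / 2) ^+ 2], so that a price below 1 bounds the squared deviation by it. *)
pose c5 := 4 / al ^+ 2.
have c5_gt0 : 0 < c5 by rewrite divr_gt0 // exprn_gt0.
pose Z x y : R := c4 * locS x y.
pose Z' x y : R := c5 * \sum_c gap2S (c, x, y).
pose h x : R := (cellsize R PS x < bet * n%:R)%R%:R.
pose E : R := c5 * (64 * t%:R ^+ 2 / c2).
have E0 : 0 <= E by rewrite mulr_ge0 ?(ltW c5_gt0) // divr_ge0 ?mulr_ge0 ?exprn_ge0 // ltW.
have Z0 x y : 0 <= Z x y by rewrite mulr_ge0 // ltW.
have Z'0 x y : 0 <= Z' x y by rewrite mulr_ge0 ?(ltW c5_gt0) // sumr_ge0 // => c _; apply: sqr_ge0.
have h0 x : 0 <= h x by rewrite ler0n.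
pose ind (i i' : ('I_m1 * 'I_k1) * 'I_t) := i'.1.1 != i.1.1.
have Z's i i' : usd i -> usd i' -> ind i i' ->
    \sum_(x | U i x) \sum_(y | U i' y) Z' x y <= E * (#|U i|%:R * #|U i'|%:R).
  move=> ui ui' ii'.
  have Usub k x : U k x -> P2 x == P2 (ys k.1).
    rewrite /U /block /= => /andP[/eqP Ax /eqP px].
    rewrite /P2 Ax -(pos_divn m2 x t_gt0) px divnMDl // divn_small ?ltn_ord // addn0 eqxx //.
  (* The blocks are enlarged to whole [P2] cells, where [loc2] is the average; each cell is at most
     [8 * t] times its block, whence 64 in [E]. *)
  apply: (@le_trans _ _ (\sum_(x | P2 x == P2 (ys i.1)) \sum_(y | P2 y == P2 (ys i'.1)) Z' x y)).
    rewrite big_mkcond [leRHS]big_mkcond; apply: ler_sum => x _.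
    have [Ux|_] := boolP (U i x); last by case: ifP => _ //; apply: sumr_ge0.
    rewrite Usub // big_mkcond [leRHS]big_mkcond; apply: ler_sum => y _.
    have [Uy|_] := boolP (U i' y); last by case: ifP.
    by rewrite Usub.
  have -> : \sum_(x | P2 x == P2 (ys i.1)) \sum_(y | P2 y == P2 (ys i'.1)) Z' x y =
      c5 * (loc2 (ys i.1) (ys i'.1) * (cellsize R P2 (ys i.1) * cellsize R P2 (ys i'.1))).
    rewrite /loc2 mulr_suml; under [in RHS]eq_bigr do rewrite cexp_lift2.
    rewrite [X in _ = _ * X]exchange_big mulr_sumr; apply: eq_bigr => x _ /=.
    by rewrite [X in _ = _ * X]exchange_big mulr_sumr; apply: eq_bigr => y _ /=.
  rewrite /E -[leRHS]mulrA; apply: ler_wpM2l; first exact: ltW.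
  have [_ s1] := UP _ ui; have [_ s2] := UP _ ui'.
  have -> : 64 * t%:R ^+ 2 / c2 * (#|U i|%:R * #|U i'|%:R) =
    c2^-1 * ((8 * t%:R * #|U i|%:R) * (8 * t%:R * #|U i'|%:R)) by ring.
  have l2 : loc2 (ys i.1) (ys i'.1) <= c2^-1.
    by move: ui ui' ii'; case: i {s1} => [[j a] s]; case: i' {s2} => [[j' a'] s'] ui ui' ii'; apply: loc2le.
  by apply: ler_pM => //; [rewrite mulr_ge0|apply: ler_pM].
have [z [zU le]] := @clusters R _ _ usd U (mu0 * n%:R) ind Z Z' h E (xs (Ordinal m1_gt0)) mu_gt0 E0
  (fun i ui => proj1 (UP i ui)) Z0 h0 Z's.
pose F i i' : R := (usd i)%:R * (usd i')%:R * (Z (z i) (z i') + (ind i i')%:R * Z' (z i) (z i')).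
have F0 i i' : 0 <= F i i' by rewrite /F !mulr_ge0 // addr_ge0 // mulr_ge0.
have H0 i : 0 <= (usd i)%:R * h (z i) by rewrite mulr_ge0.
have lt1 : \sum_i \sum_(i' | i' != i) F i i' + \sum_i (usd i)%:R * h (z i) < 1.
  apply: le_lt_trans le (le_lt_trans _ budget3).
  have cI : #|{: ('I_m1 * 'I_k1) * 'I_t}|%:R = M by rewrite !card_prod !card_ord.
  rewrite cI; have M0 : 0 <= M by rewrite ler0n.
  have n0 : n%:R != 0 :> R by rewrite gt_eqF.
  have mu00 : mu0 != 0 by rewrite gt_eqF.
  apply: lerD.
    rewrite ler_wpM2l ?exprn_ge0 // lerD2r.
    under eq_bigr do rewrite -mulr_sumr.
    rewrite -mulr_sumr; apply: (@le_trans _ _ ((mu0 * n%:R) ^- 2 * (c4 * (e5 * n%:R ^+ 2)))).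
      apply: ler_wpM2l; first by rewrite invr_ge0 exprn_ge0 // ltW.
      by apply: ler_wpM2l => //; rewrite ltW.
    by rewrite le_eqVlt; apply/orP; left; apply/eqP; field; rewrite n0 mu00.
  rewrite ler_wpM2l //; apply: (@le_trans _ _ ((mu0 * n%:R)^-1 * (kS%:R * (bet * n%:R)))).
    apply: ler_wpM2l; first by rewrite invr_ge0 ltW.
    by apply: sum_small_cells; rewrite mulr_ge0 // ltW.
  by rewrite le_eqVlt; apply/orP; left; apply/eqP; field; rewrite n0 mu00.
have [F1 H1] := lt1_terms F0 H0 lt1.
exists z; split.
- move=> [j a] s ul; have := zU (j, a, s) ul.
  by rewrite /U /block /= => /andP[/eqP -> /eqP ->].
- move=> [j a] s ul; have := H1 (j, a, s); rewrite /usd ul mul1r /h.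
  rewrite [bet * _ <= _]leNgt; case: (cellsize R PS _ < _); last by [].
  by rewrite ltxx.
- move=> [j a] s [j' a'] s' ul ul' ne; have := F1 (j, a, s) (j', a', s') ne.
  rewrite /F /usd ul ul' !mul1r => lt; rewrite -[leRHS]mulr1 ler_pdivlMl //.
  have := Z'0 (z (j, a, s)) (z (j', a', s')) => z'0.
  apply: le_trans (ltW lt); rewrite lerDl mulr_ge0 //.
- move=> [j a] s [j' a'] s' c ul ul' ne.
  have ne2 : (j', a', s') != (j, a, s) by rewrite !xpair_eqE (negPf ne).
  have := F1 (j, a, s) (j', a', s') ne2.
  rewrite /F /usd ul ul' /ind ne !mul1r => lt.
  have -> : (al / 2) ^+ 2 = c5^-1 by rewrite /c5; field; rewrite gt_eqF.
  rewrite -[leRHS]mulr1 ler_pdivlMl //; apply: le_trans (ltW lt).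
  apply: (@le_trans _ _ (Z' (z (j, a, s)) (z (j', a', s')))); last by rewrite lerDr.
  rewrite ler_wpM2l ?(ltW c5_gt0) //.
  by apply: (ler_term_sum (P := predT) (F := fun c => gap2S (c, _, _))) => // c'; apply: sqr_ge0.
Qed.

Let used_letter x : exists a, used A1 m2 kap a x.
Proof.
apply: contrapT => /forallNP no; have := sum_freq R A1 m2 x; apply/eqP; rewrite lt_eqF //.
apply: (@lt_le_trans _ _ (\sum_(a < k1) kap)); last by rewrite sumr_const card_ord -(mulr_natr kap).
apply: ltr_sum => [|a _]; last by rewrite ltNge; apply/negP/no.
by apply/hasP; exists (A1 x); rewrite ?mem_index_enum.
Qed.

Lemma single_graph : ofar eps Fam G -> exists2 F, F \in Fam &
  (al / 4) ^+ (Q ^ 2) * bet ^+ Q / 4 * n%:R ^+ tag F <= #|copies F G|%:R.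
Proof.
move=> [_ far].
have [xs [ys gr]] := representatives_exist; have [z gz] := clusters_exist gr.
case: gr => xsE ysE Xle [Yle _ _]; case: gz => zE zlarge zloc zgap.
have n2 : (2 <= n)%N by apply: leq_trans n_large; rewrite leq_pmulr // muln_gt0 m2_gt0.
have [cdef _] : exists c : S, True.
  have [|e _] := @vpair_exists n (Ordinal n_gt0) (Ordinal n2); first by rewrite -val_eqE.
  by exists (G e).
pose zz l s := z (l, insubd (Ordinal t_gt0) s).
have zzE l s : (s < t)%N -> used A1 m2 kap l.2 (xs l.1) ->
    A2 (zz l s) = A2 (ys l) /\ pos (m2 * t) (zz l s) = (pos m2 (ys l) * t + s)%N.
  by move=> st ul; have [-> ->] := zE l (insubd (Ordinal t_gt0) s) ul; rewrite val_insubd st.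
have zz_P2 l s : (s < t)%N -> used A1 m2 kap l.2 (xs l.1) -> P2 (zz l s) = P2 (ys l).
  move=> st ul; have [Az pz] := zzE l s st ul.
  by rewrite /P2 Az -(pos_divn m2 (zz l s) t_gt0) pz divnMDl // divn_small // addn0.
have /choice[best bestP] : forall p : 'I_n * 'I_n, exists c : S,
    PS p.1 != PS p.2 -> al <= dens R G PS (c, p.1, p.2).
  move=> p; have [ne|ne] := boolP (PS p.1 != PS p.2); last by exists cdef.
  by have [c cP] := dens_large G ne al_small; exists c.
have /choice[best2 best2P] : forall p : 'I_n * 'I_n, exists c : S,
    P2 p.1 != P2 p.2 -> al <= dens R G P2 (c, p.1, p.2).
  move=> p; have [ne|ne] := boolP (P2 p.1 != P2 p.2); last by exists cdef.
  by have [c cP] := dens_large G ne al_small; exists c.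
have /choice[a0 a0P] : forall j, exists a, used A1 m2 kap a (xs j).
  by move=> j; apply: used_letter.
(* Ramsey's theorem is applied once per interval, a colour being a whole table: for each pair of
   letters, the popular colour between the two clusters. *)
have /choice[hc hcP] : forall j, exists p : (nat -> nat) * {ffun 'I_k1 * 'I_k1 -> S},
    [/\ forall i, (i < Q)%N -> (p.1 i < t)%N,
      forall i i', (i < i' < Q)%N -> (p.1 i < p.1 i')%N &
      forall i i' a a', (i < i' < Q)%N ->
        best (zz (j, a) (p.1 i), zz (j, a') (p.1 i')) = p.2 (a, a')].
  move=> j.
  have [h [c [h1 h2 h3]]] := t_ramsey (fun s s' => [ffun p => best (zz (j, p.1) s, zz (j, p.2) s')]).
  exists (h, c); split=> //= i i' a a' ii'.
  by rewrite -(h3 i i' ii') ffunE.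
pose jj u := jof m1_gt0 u.
pose astar u := if used A1 m2 kap (A1 u) (xs (jj u)) then A1 u else a0 (jj u).
have astarP u : used A1 m2 kap (astar u) (xs (jj u)) by rewrite /astar; case: ifP.
pose lab u := (jj u, astar u).
have ysP u : pos m2 (ys (lab u)) = pos m2 (xs (jj u)) by have [] := ysE _ _ (astarP u).
have ysP1 u : pos m1 (ys (lab u)) = pos m1 u by rewrite (pos21 (ysP u)) xsE.
(* Between intervals the search finds the colour of [uv] in [G] whenever it is dense between the
   picked cells, and [best2] replaces a rare one. *)
pose newc u v : S := if pos m1 u == pos m1 v then (hc (jj u)).2 (astar u, astar v)
  else if [pick c | gcol G c u v && (al <= dens R G P2 (c, ys (lab u), ys (lab v)))] is Some c
  then c else best2 (ys (lab u), ys (lab v)).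
have newc_dense u v : pos m1 u != pos m1 v -> al <= dens R G P2 (newc u v, ys (lab u), ys (lab v)).
  rewrite /newc => /[dup] ne /negPf ->; case: pickP => [c /andP[] //|_].
  by apply: best2P; rewrite /P2 xpair_eqE; apply: contra ne => /andP[_ /eqP /pos21]; rewrite !ysP1 => ->.
have newcE u v c : (u < v)%N -> pos m1 u != pos m1 v ->
    tame A1 m1 m2 kap (A1 u) (xs (jof m1_gt0 u)) -> tame A1 m1 m2 kap (A1 v) (xs (jof m1_gt0 v)) ->
    gcol G c u v -> al <= dens R G P2 (c, ys (jof m1_gt0 u, A1 u), ys (jof m1_gt0 v, A1 v)) ->
    newc u v = c.
  move=> _ ne /andP[tu _] /andP[tv _] gc dc; rewrite /newc (negPf ne).
  have lu : lab u = (jof m1_gt0 u, A1 u) by rewrite /lab /astar tu.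
  have lv : lab v = (jof m1_gt0 v, A1 v) by rewrite /lab /astar tv.
  case: pickP => [c' /andP[gc' _]|/(_ c)]; first exact: gcol_inj gc' gc.
  by rewrite gc lu lv dc.
have close : (odist G (recolour newc))%:R < eps * 'C(n, 2)%:R.
  have := odist_recolour m2_gt0 m12 m1n tau_gt0 (ltW al_gt0) xsE ysE newcE.
  set Y := \sum_j \sum_(j' | _) _; set X := \sum_j \sum_a _.
  have {}Yle : Y <= n%:R ^+ 2 / c1 by exact: Yle.
  have {}Xle : X <= n%:R / c0 by exact: Xle.
  move=> /le_lt_trans; apply.
  (* Since [n] is at least 2; this is the 4 in [budget2]. *)
  have n4 : n%:R ^+ 2 / 4 <= 'C(n, 2)%:R :> R.
    rewrite ler_pdivrMr // -natrX -natrM ler_nat.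
    have binE : ('C(n, 2) * 2 = n * n.-1)%N.
      by rewrite bin2 muln2 -[RHS]odd_double_half oddM; case: (n) => //= k; rewrite andNb.
    rewrite (_ : 4 = 2 * 2)%N // mulnA binE -mulnA -mulnn leq_mul2l; apply/orP; right.
    by case: (n) n2 => [//|[//|k]] _ /=; rewrite muln2 doubleS !ltnS -addnn leq_addr.
  apply: (@lt_le_trans _ _ (eps / 4 * n%:R ^+ 2)); last first.
    have e0 : 0 <= eps.
      have : 0 <= eps / 4 by apply: ltW; apply: le_lt_trans budget2; rewrite !addr_ge0 //
        ?divr_ge0 ?invr_ge0 ?mulr_ge0 ?addr_ge0 // ltW.
      by lra.
    by rewrite -mulrA [4^-1 * _]mulrC ler_wpM2l.
  apply: le_lt_trans (_ : _ <= (2 / m1%:R + 2 / c0 + #|S|%:R * (al + tau) + (tau * c1)^-1) * n%:R ^+ 2) _; last first.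
    by rewrite ltr_pM2r // exprn_gt0.
  have l1 : 2 * n%:R * X <= 2 * n%:R * (n%:R / c0) by apply: ler_wpM2l => //; rewrite mulr_ge0.
  have l2 : tau^-1 * Y <= tau^-1 * (n%:R ^+ 2 / c1) by apply: ler_wpM2l => //; rewrite invr_ge0 ltW.
  apply: (le_trans (lerD (lerD (lerD (lexx _) l1) (lexx _)) l2)).
  rewrite le_eqVlt; apply/orP; left; apply/eqP; field.
  by rewrite !gt_eqF ?ltr0n.
have /existsNP[U /negP] : ~ ofree Fam (recolour newc).
  by move=> /far; rewrite leNgt close.
rewrite negbK => UF; exists (to_anyograph (osub (recolour newc) U)) => //.
pose W (l : 'I_m1 * 'I_k1) (i : nat) : pred 'I_n := [pred x | PS x == PS (zz l ((hc l.1).1 i))].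
have cut := @cut_functions R S n G kT PT lam lam_gt0 stab6.
have hQ u i : (i < Q)%N -> ((hc (lab u).1).1 i < t)%N by have [+ _ _] := hcP (lab u).1; apply.
have Wpos u i x : (i < Q)%N -> W (lab u) i x ->
    pos (m2 * t) x = (pos m2 (xs (jj u)) * t + (hc (jj u)).1 i)%N /\ pos m1 x = jj u.
  move=> iQ /eqP /PSpos px; have [_ pz] := zzE (lab u) _ (hQ u i iQ) (astarP u).
  have px' : pos (m2 * t) x = (pos m2 (xs (jj u)) * t + (hc (jj u)).1 i)%N by rewrite px pz ysP.
  split=> //; rewrite -(xsE (jj u)); apply: pos21.
  by rewrite -(pos_divn m2 x t_gt0) px' divnMDl // divn_small ?addn0 // hQ.
(* The threshold drops from [al] at the picked cells to [al / 2] at the clusters and to [al / 4] for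
   most pairs of their [PT] cells; the last drop is Chebyshev's inequality and yields [rho]. *)
apply: (@transfer R S n kT Q G PT _ lab (fun l => val l.1) W newc lam (al / 4) (16 / (al ^+ 2 * c4)) bet n_gt0).
- by move=> u v uv; apply: pos_mono; apply: ltnW.
- move=> u v x y i i' /andP[ii' i'Q] juv Wx Wy.
  have iQ := ltn_trans ii' i'Q.
  have [px jx] := Wpos _ _ _ iQ Wx; have [py jy] := Wpos _ _ _ i'Q Wy.
  move: juv; rewrite leq_eqVlt => /orP[/eqP juv|lt]; last by apply: (@pos_lt_lt _ m1); rewrite jx jy.
  apply: (@pos_lt_lt _ (m2 * t)%N); rewrite px py.
  have -> : jj v = jj u by apply: val_inj.
  by rewrite ltn_add2l; have [_ + _] := hcP (jj u); apply; rewrite ii'.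
- move=> u i iQ; exact: (zlarge (lab u) (insubd (Ordinal t_gt0) ((hc (lab u).1).1 i)) (astarP u)).
- move=> u v i i' uv /andP[ii' i'Q]; have iQ := ltn_trans ii' i'Q.
  set zu := zz (lab u) ((hc (lab u).1).1 i); set zv := zz (lab v) ((hc (lab v).1).1 i').
  have Wzu : W (lab u) i zu by rewrite /W /= eqxx.
  have Wzv : W (lab v) i' zv by rewrite /W /= eqxx.
  have [pu ju] := Wpos _ _ _ iQ Wzu; have [pv jv] := Wpos _ _ _ i'Q Wzv.
  have zuv : (zu < zv)%N.
    have : (jj u <= jj v)%N by apply: pos_mono; apply: ltnW.
    rewrite leq_eqVlt => /orP[/eqP juv|lt]; last by apply: (@pos_lt_lt _ m1); rewrite ju jv.
    apply: (@pos_lt_lt _ (m2 * t)%N); rewrite pu pv.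
    have -> : jj v = jj u by apply: val_inj.
    by rewrite ltn_add2l; have [_ + _] := hcP (jj u); apply; rewrite ii'.
  (* Two vertices of a copy may share a label; their clusters still differ, because the ranks select
     different blocks. *)
  have labne : (lab v, insubd (Ordinal t_gt0) ((hc (lab v).1).1 i')) !=
     (lab u, insubd (Ordinal t_gt0) ((hc (lab u).1).1 i)).
    by apply: contraL zuv => /eqP e; rewrite /zu /zv /zz e ltnn.
  have dense : al / 2 <= dens R G PS (newc u v, zu, zv).
    have [e|ne] := eqVneq (pos m1 u) (pos m1 v).
      have juv : jj v = jj u by apply: val_inj.
      have -> : newc u v = best (zu, zv).
        have [_ _ hb] := hcP (jj u); rewrite /newc e eqxx -(hb i i') ?ii' //.
        by rewrite /zu /zv /lab /= juv.
      apply: (@le_trans _ _ al); first by move: al_gt0; lra.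
      apply: (bestP (zu, zv)) => /=; apply/eqP => /PSpos.
      rewrite pu pv juv => /addnI /eqP; have [_ hlt _] := hcP (jj u).
      by rewrite ltn_eqF // hlt // ii'.
    have d2 := newc_dense u v ne; set c := newc u v in d2 *.
    have eP : dens R G P2 (c, zu, zv) = dens R G P2 (c, ys (lab u), ys (lab v)).
      apply: cexp_measurable; rewrite /lift2 /zu /zv /=.
      by rewrite (zz_P2 (lab u) _ (hQ u i iQ) (astarP u)) (zz_P2 (lab v) _ (hQ v i' i'Q) (astarP v)).
    have jne : (lab v).1 != (lab u).1 by apply: contra ne => /eqP /(congr1 val) /= ->.
    have gap := zgap (lab u) (insubd (Ordinal t_gt0) ((hc (lab u).1).1 i)) (lab v)
      (insubd (Ordinal t_gt0) ((hc (lab v).1).1 i')) c (astarP u) (astarP v) jne.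
    rewrite /gap2S -[z (lab u, _)]/zu -[z (lab v, _)]/zv eP in gap.
    have al2 : 0 <= al / 2 by move: al_gt0; lra.
    rewrite -ler_sqrt ?sqr_ge0 // in gap.
    rewrite !sqrtr_sqr (ger0_norm al2) ler_norml in gap; case/andP: gap => gap _.
    by move: gap d2; lra.
  set c := newc u v in dense *.
  have loc := zloc (lab u) _ (lab v) _ (astarP u) (astarP v) labne.
  have a4 : 0 < (al / 4) ^+ 2 by rewrite exprn_gt0 // divr_gt0.
  rewrite -(ler_pM2l a4).
  (* A pair with [PT] density below [al / 4] deviates by at least [al / 4] from its [PS] density,
     which is at least [al / 2]. *)
  apply: (@le_trans _ _ (\sum_(x | W (lab u) i x) \sum_(y | W (lab v) i' y) gapST (c, x, y))).
    rewrite mulr_sumr; apply: ler_sum => x /eqP Wx; rewrite mulr_sumr; apply: ler_sum => y /eqP Wy.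
    case: ltP => [lt|_]; last by rewrite mulr0 sqr_ge0.
    have eS : dens R G PS (c, x, y) = dens R G PS (c, zu, zv).
      by apply: cexp_measurable; rewrite /lift2 /= Wx Wy.
    rewrite mulr1 /gapST eS -subr_ge0.
    set p := dens R G PT _ in lt *; set s := dens R G PS _ in dense *.
    rewrite (_ : _ - _ = (s - p - al / 4) * (s - p + al / 4)); last by field.
    by apply: mulr_ge0; move: lt dense al_gt0; lra.
  rewrite -(cexp_lift2 PS gapST c zu zv).
  have -> : (al / 4) ^+ 2 * (16 / (al ^+ 2 * c4) * (#|W (lab u) i|%:R * #|W (lab v) i'|%:R)) =
     c4^-1 * (#|W (lab u) i|%:R * #|W (lab v) i'|%:R) by field; rewrite !gt_eqF.
  apply: ler_pM => //.
  - by apply: cexp_ge0 => w; apply: sqr_ge0.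
  - by rewrite mulr_ge0.
  - apply: le_trans loc; apply: (ler_term_sum (P := predT) (F := fun c => cexp (lift2 PS) gapST (c, zu, zv))) => // c'.
    by apply: cexp_ge0 => w; apply: sqr_ge0.
- exact: cut.
- have S1 : 1 <= #|S|%:R :> R.
    by rewrite ler1n; apply/card_gt0P; exists cdef.
  rewrite divr_gt0 //= ler_pdivrMr // mul1r; have : al <= 1 by apply: le_trans al_small; rewrite ler_peMr // ltW.
  by lra.
- by [].
- by rewrite divr_ge0 // mulr_ge0 ?exprn_ge0 // ltW.
- exact: ltW.
- exact: c4_large.
- exact: lam_small.
- exact: (Fam_le UF).
Qed.

End SingleGraph.

(** * Choice of the constants *)

Section Levels.
Variables (R : realType) (S : finType) (Y : nat -> Type) (eta : R).
Variables (Phi : forall n, Y n -> nat -> Prop).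
Hypothesis eta_gt0 : 0 < eta.
Hypothesis Phi_mono : forall n (y : Y n) r r', (r <= r')%N -> Phi y r -> Phi y r'.

(** [Y n] bundles the graph with the partitions fixed at earlier levels; [r] is uniform in [n] and
    in all these data. *)
Lemma partition_level (gr : forall n, Y n -> ograph S n)
    (okp : forall n, Y n -> forall k, ('I_n -> 'I_k) -> Prop) :
  (forall k, exists r, forall n (y : Y n) (P : 'I_n -> 'I_k), okp n y k P ->
    (forall k' (P' : 'I_n -> 'I_k'), (k' <= r)%N -> okp n y k' P' ->
      energy2 R (gr n y) P' <= energy2 R (gr n y) P + eta * n%:R ^+ 2) -> Phi y r) ->
  forall k, exists r, forall n (y : Y n) (P : 'I_n -> 'I_k), okp n y k P -> Phi y r.
Proof.
move=> H k.
have [] := @stable_exists R {n & Y n} (fun x k => 'I_(tag x) -> 'I_k)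
  (fun x k P => okp (tag x) (tagged x) k P) (fun x k P => energy2 R (gr (tag x) (tagged x)) P)
  (fun x => (tag x)%:R ^+ 2) eta (fun x r => Phi (tagged x) r) eta_gt0 _ _ _ _ k.
- by move=> x; rewrite exprn_ge0.
- by move=> x k' P; rewrite energy2_ge0 energy2_le.
- by move=> x r r'; apply: Phi_mono.
- by move=> k'; have [r Hr] := H k'; exists r => -[n y] P; apply: Hr.
- by move=> r Hr; exists r => n y P; apply: (Hr (existT _ n y) P).
Qed.

(** A grid is determined by its scale, which also plays the part of its size; hence the structure
    type is [unit]. *)
Lemma interval_level (k : nat) (ltr : forall n, Y n -> 'I_n -> 'I_k) (okm : nat -> Prop) :
  (forall m, okm m -> exists r, forall n (y : Y n),
    (forall m', (m' <= r)%N -> okm m' ->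
      energy1 R (ltr n y) m' <= energy1 R (ltr n y) m + eta * n%:R) -> Phi y r) ->
  forall m, okm m -> exists r, forall n (y : Y n), Phi y r.
Proof.
move=> H m okmm.
have [] := @stable_exists R {n & Y n} (fun _ _ => unit)
  (fun _ m _ => okm m) (fun x m _ => energy1 R (ltr (tag x) (tagged x)) m)
  (fun x => (tag x)%:R) eta (fun x r => Phi (tagged x) r) eta_gt0 _ _ _ _ m.
- by [].
- by move=> x m' _; rewrite energy1_ge0 energy1_le.
- by move=> x r r'; apply: Phi_mono.
- move=> m'; have [okm'|nok] := pselect (okm m'); last by exists 0%N => x P /nok.
  have [r Hr] := H m' okm'; exists r => -[n y] P _ st; apply: Hr => m'' le ok.
  exact: (st m'' tt).
- by move=> r Hr; exists r => n y; apply: (Hr (existT _ n y) tt).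
Qed.

End Levels.

Section Constants.
Variables (R : realType) (S : finType) (Fam : seq (anyograph S)) (eps : R).
Hypotheses (S_gt0 : (0 < #|S|)%N) (eps_gt0 : 0 < eps).

(* One number [r] serves both as a bound on partition sizes and as [1 / delta]. *)
Definition many_copies n (G : ograph S n) (r : nat) := ofar eps Fam G ->
  exists2 F, F \in Fam & (r.+1%:R)^-1 * n%:R ^+ tag F <= #|copies F G|%:R :> R.

Lemma many_copies_mono n (G : ograph S n) r r' : (r <= r')%N ->
  many_copies G r -> many_copies G r'.
Proof.
move=> rr' H /H[F FF le]; exists F => //; apply: le_trans le.
by rewrite ler_wpM2r ?exprn_ge0 // lef_pV2 ?posrE ?ltr0n // ler_nat ltnS.
Qed.

Let Q := \max_(F <- Fam) tag F.

Let Fam_le F : F \in Fam -> (tag F <= Q)%N.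
Proof. by move=> FF; rewrite /Q (big_rem F) //= leq_maxl. Qed.

(** For bounded [n] a single copy is enough, and there is one because [ofar] excludes free
    graphs. *)
Lemma many_copies_small N n (G : ograph S n) : (n <= N)%N -> many_copies G (N.+1 ^ Q)%N.
Proof.
move=> nN [/existsNP[U /negP]]; rewrite negbK => UF _.
exists (to_anyograph (osub G U)) => //.
have c1 : 1 <= #|copies (to_anyograph (osub G U)) G|%:R :> R.
  by rewrite ler1n; apply/card_gt0P; exists U; rewrite inE.
apply: le_trans c1; rewrite ler_pdivrMl ?ltr0n // mulr1 -natrX ler_nat.
apply: (@leq_trans (N.+1 ^ tag (to_anyograph (osub G U)))%N); first last.
  by apply: leqW; rewrite leq_pexp2l ?Fam_le.
by case: (tag _) => [//|q]; rewrite leq_exp2r // leqW.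
Qed.

(** The order of the quantifiers is the order of dependence. In particular [m0] and [e1] depend on
    [eps] and the number of colours alone. *)
Lemma parameters : exists (m0 : nat) (e1 : R), [/\ (0 < m0)%N, 0 < e1 &
  forall k1, exists (e2 : R) (t : nat), [/\ 0 < e2, (0 < t)%N &
  forall m1, (m0 <= m1)%N -> exists2 e3 : R, 0 < e3 &
  forall k2, exists2 e4 : R, 0 < e4 &
  forall m2, (0 < m2)%N /\ (m1 %| m2)%N -> exists2 e5 : R, 0 < e5 &
  forall kS, exists2 lam : R, 0 < lam &
  forall kT, exists r, forall n (G : ograph S n) (A1 : 'I_n -> 'I_k1) (A2 : 'I_n -> 'I_k2)
    (PS : 'I_n -> 'I_kS) (PT : 'I_n -> 'I_kT),
    measurable_wrt A2 A1 -> measurable_wrt PS A2 -> measurable_wrt PS (pos (m2 * t)) ->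
    measurable_wrt PT PS ->
    energy2 R G PS <= energy2 R G A1 + e1 * n%:R ^+ 2 ->
    energy1 R A1 m2 <= energy1 R A1 m1 + e2 * n%:R ->
    energy2 R G PS <= energy2 R G A2 + e3 * n%:R ^+ 2 ->
    energy1 R A2 (m2 * t) <= energy1 R A2 m2 + e4 * n%:R ->
    energy2 R G PT <= energy2 R G PS + e5 * n%:R ^+ 2 ->
    (forall k' (P' : 'I_n -> 'I_k'), (k' <= kT * 4)%N -> measurable_wrt P' PT ->
       energy2 R G P' <= energy2 R G PT + lam ^+ 2 * n%:R ^+ 2) ->
    many_copies G r]].
Proof.
have sg0 : 0 < #|S|%:R :> R by rewrite ltr0n.
pose al0 : R := eps / (64 * (1 + eps)).
have al0P : 0 < al0 by rewrite divr_gt0 // mulr_gt0 // addr_gt0.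
have al0_1 : al0 <= 1 by rewrite ler_pdivrMr ?mulr_gt0 ?addr_gt0 //; move: eps_gt0; lra.
have al0_e : al0 <= eps / 64.
  rewrite ler_pdivrMr ?mulr_gt0 ?addr_gt0 //.
  rewrite (_ : eps / 64 * (64 * (1 + eps)) = eps + eps * eps); last by field.
  by rewrite lerDl ltW // mulr_gt0.
pose al : R := al0 / #|S|%:R.
have al_gt0 : 0 < al by rewrite divr_gt0.
have alS : al * #|S|%:R = al0 by rewrite /al divfK ?gt_eqF.
(* [budget2] is counted in units of [eps / 64]: at most one each for [2 / m1], [2 / c0] and the
   inverse of [al * c1], and two for the colours, since [tau] is taken equal to [al]. *)
pose c0 : R := 128 / eps.
have c0_gt0 : 0 < c0 by rewrite divr_gt0.
pose c1 : R := 64 / (al * eps).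
have c1_gt0 : 0 < c1 by rewrite divr_gt0 // mulr_gt0.
pose m0 := (Num.bound c0).+1.
have m0P : c0 <= m0%:R.
  by apply: (le_trans (ltW (archi_boundP (ltW c0_gt0)))); rewrite ler_nat.
have small (a b : R) : 0 <= a -> a <= b -> 0 < b -> a / (8 * b) <= 1 / 8.
  move=> a0 ab b0; rewrite ler_pdivrMr ?mulr_gt0 //; lra.
have sqr_le (x : R) : 0 <= x -> x ^+ 2 <= (x + 1) ^+ 2.
  by move=> x0; rewrite -subr_ge0 (_ : _ - _ = 2 * x + 1); [lra|ring].
exists m0, (1 / (32 * c1)); split=> //; first by rewrite divr_gt0 // mulr_gt0.
(* [budget1] has six summands, each kept at most 1/8; [kap] settles [2 * c0 * kap * k1]. The
   successors here and below avoid dividing by 0. *)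
move=> k1; pose kap : R := ((16 * c0 + 1) * k1.+1%:R)^-1.
have c16 : 0 < 16 * c0 + 1 by move: c0_gt0; lra.
have kap_gt0 : 0 < kap by rewrite invr_gt0 mulr_gt0 // ltr0n.
have kapk : kap * k1%:R <= (16 * c0 + 1)^-1.
  rewrite /kap invfM -mulrA ler_piMr ?invr_ge0 ?(ltW c16) //.
  by rewrite ler_pdivrMl ?ltr0n // mulr1 ler_nat.
have [d0 _] := card_gt0P S_gt0.
have [t' ht] := ramsey_pairs ([ffun=> d0] : {ffun 'I_k1 * 'I_k1 -> S}) Q.
exists (kap / (16 * c0)), t'.+1; split=> //; first by rewrite divr_gt0 // mulr_gt0.
set t := t'.+1 in ht *.
have t0 : 0 < t%:R :> R by rewrite ltr0n.
move=> m1 m01; have m1_gt0 : (0 < m1)%N by apply: leq_trans m01.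
pose M : R := (m1 * k1 * t)%:R.
have M0 : 0 <= M by rewrite ler0n.
(* Gives a quarter of [budget3] to the term with [c2]; [e5] and [bet] get a quarter each. *)
pose c2 : R := 1024 * (M + 1) ^+ 2 * t%:R ^+ 2 / al ^+ 2.
have M1 : 0 < M + 1 by rewrite ltr_wpDl.
have c2_gt0 : 0 < c2 by rewrite divr_gt0 ?exprn_gt0 // !mulr_gt0 ?exprn_gt0.
pose D : R := 2 * m1%:R / kap * k1%:R.
have D0 : 0 <= D by rewrite mulr_ge0 // divr_ge0 ?mulr_ge0 // ltW.
have D1 : 0 < D + 1 by rewrite ltr_wpDl.
exists ((8 * (D + 1) ^+ 2 * c2)^-1); first by rewrite invr_gt0 mulr_gt0 // mulr_gt0 // exprn_gt0.
move=> k2; pose th : R := (8 * (D + 1) * k2.+1%:R)^-1.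
have th_gt0 : 0 < th by rewrite invr_gt0 !mulr_gt0 // ltr0n.
exists (th / (128 * (D + 1) * t%:R)); first by rewrite divr_gt0 // !mulr_gt0.
move=> m2 [m2_gt0 m12]; pose mu0 : R := th / (4 * (m2 * t)%:R).
have mu0_gt0 : 0 < mu0 by rewrite divr_gt0 // mulr_gt0 // ltr0n muln_gt0 m2_gt0.
pose c4 : R := 32 * ((Q ^ 2)%:R + 1) / al ^+ 2.
have Q1 : 0 < (Q ^ 2)%:R + 1 :> R by rewrite ltr_wpDl.
have c4_gt0 : 0 < c4 by rewrite divr_gt0 ?exprn_gt0 // mulr_gt0.
exists (mu0 ^+ 2 / (4 * (M + 1) ^+ 2 * c4)).
  by rewrite divr_gt0 ?exprn_gt0 // mulr_gt0 // mulr_gt0 // exprn_gt0.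
(* The summand [mu0] in the denominator keeps [bet] at most 1. *)
move=> kS; pose bet : R := mu0 / (4 * (M + 1) * kS.+1%:R + mu0).
have bd : 0 < 4 * (M + 1) * kS.+1%:R :> R by rewrite !mulr_gt0 // ltr0n.
have bet_gt0 : 0 < bet by rewrite divr_gt0 // addr_gt0.
have bet_1 : bet <= 1 by rewrite ler_pdivrMr ?addr_gt0 // mul1r lerDr ltW.
pose del : R := (al / 4) ^+ (Q ^ 2) * bet ^+ Q / 4.
have del_gt0 : 0 < del by rewrite divr_gt0 // mulr_gt0 ?exprn_gt0 // divr_gt0.
exists (del / ((Q ^ 2)%:R + 1)); first by rewrite divr_gt0.
set lam := del / _ => kT.
(* The first bound is for large [n], the second for [n] below [2 * (m2 * t)], where the grids are
   too fine. *)
exists (maxn (Num.bound del^-1) ((2 * (m2 * t)).+1 ^ Q)%N).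
move=> n G A1 A2 PS PT A21 PSA2 PSpos PTS st1 st2 st3 st4 st5 st6.
have [n_large|/ltnW n_small] := leqP (2 * (m2 * t))%N n; last first.
  exact: many_copies_mono (leq_maxr _ _) (many_copies_small n_small).
apply: (@many_copies_mono _ _ (Num.bound del^-1)); first exact: leq_maxl.
move=> far.
have ramsey col : exists (h : nat -> nat) (c : {ffun 'I_k1 * 'I_k1 -> S}),
    [/\ forall i, (i < Q)%N -> (h i < t)%N, forall i j, (i < j < Q)%N -> (h i < h j)%N &
    forall i j, (i < j < Q)%N -> col (h i) (h j) = c].
  by have [h [c [h1 h2 h3]]] := ht col; exists h, c; split=> // i /h1 /ltnW.
have m1R : 0 < m1%:R :> R by rewrite ltr0n.
have al_small : al * #|S|%:R <= 1 by rewrite alS.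
have kap_small : kap * k1%:R <= 1.
  by apply: le_trans kapk _; rewrite invf_le1 // lerDr mulr_ge0 // ltW.
have bet01 : 0 < bet <= 1 by rewrite bet_gt0.
have lam_gt0 : 0 < lam by rewrite divr_gt0.
have budget1 : 4 * (c1 * (1 / (32 * c1))) + D ^+ 2 * (c2 * (8 * (D + 1) ^+ 2 * c2)^-1) +
  c0 * (2 * kap * k1%:R + 2 / kap * (kap / (16 * c0))) +
  D * (th * k2%:R + 16 * t%:R / th * (th / (128 * (D + 1) * t%:R))) < 1.
  have -> : 4 * (c1 * (1 / (32 * c1))) = 1 / 8 by field; rewrite gt_eqF.
  have -> : D ^+ 2 * (c2 * (8 * (D + 1) ^+ 2 * c2)^-1) = D ^+ 2 / (8 * (D + 1) ^+ 2).
    by field; rewrite !gt_eqF.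
  have b1 : D ^+ 2 / (8 * (D + 1) ^+ 2) <= 1 / 8.
    by apply: small; [exact: sqr_ge0|exact: sqr_le|exact: exprn_gt0].
  have -> : c0 * (2 * kap * k1%:R + 2 / kap * (kap / (16 * c0))) = 2 * c0 * (kap * k1%:R) + 1 / 8.
    by field; rewrite !gt_eqF.
  have b2 : 2 * c0 * (kap * k1%:R) <= 1 / 8.
    apply: (@le_trans _ _ (2 * c0 * (16 * c0 + 1)^-1)); first by apply: ler_wpM2l => //; rewrite mulr_ge0 // ltW.
    by rewrite ler_pdivrMr //; lra.
  have -> : D * (th * k2%:R + 16 * t%:R / th * (th / (128 * (D + 1) * t%:R))) =
     D * k2%:R / (8 * ((D + 1) * k2.+1%:R)) + D / (8 * (D + 1)).
    have kk1 : 0 < 1 + k2%:R :> R by rewrite ltr_wpDr.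
    by rewrite /th; field; rewrite !gt_eqF.
  have b3 : D * k2%:R / (8 * ((D + 1) * k2.+1%:R)) <= 1 / 8.
    apply: small; [exact: mulr_ge0| |by rewrite mulr_gt0 // ltr0n].
    by apply: ler_pM => //; rewrite ?lerDl ?ler_nat.
  have b4 : D / (8 * (D + 1)) <= 1 / 8 by apply: small; rewrite // lerDl.
  apply: (@le_lt_trans _ _ (1 / 8 + 1 / 8 + (1 / 8 + 1 / 8) + (1 / 8 + 1 / 8))); last by lra.
  by apply: lerD; [apply: lerD; [exact: lerD|apply: lerD]|exact: lerD].
have budget2 : 2 / m1%:R + 2 / c0 + #|S|%:R * (al + al) + (al * c1)^-1 < eps / 4.
  have b1 : 2 / m1%:R <= 2 / c0.
    rewrite ler_wpM2l // lef_pV2 ?posrE //; apply: le_trans m0P _; by rewrite ler_nat.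
  have -> : #|S|%:R * (al + al) = 2 * al0 by rewrite -alS; ring.
  have -> : (al * c1)^-1 = eps / 64 by rewrite /c1; field; rewrite !gt_eqF.
  have e0 : 2 / c0 = eps / 64 by rewrite /c0; field; rewrite gt_eqF.
  by rewrite e0 in b1 *; move: b1 al0_e eps_gt0; lra.
have budget3 : M ^+ 2 * (mu0 ^- 2 * (c4 * (mu0 ^+ 2 / (4 * (M + 1) ^+ 2 * c4))) +
    4 / al ^+ 2 * (64 * t%:R ^+ 2 / c2)) + M * (kS%:R * bet / mu0) < 1.
  have -> : M ^+ 2 * (mu0 ^- 2 * (c4 * (mu0 ^+ 2 / (4 * (M + 1) ^+ 2 * c4))) +
    4 / al ^+ 2 * (64 * t%:R ^+ 2 / c2)) = 4 * (M ^+ 2 / (8 * (M + 1) ^+ 2)).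
    have M1' : 0 < m1%:R * k1%:R * t%:R + 1 :> R by rewrite -!natrM.
    by rewrite /c2; field; rewrite !gt_eqF.
  have b1 : M ^+ 2 / (8 * (M + 1) ^+ 2) <= 1 / 8.
    by apply: small; [exact: sqr_ge0|exact: sqr_le|exact: exprn_gt0].
  have -> : M * (kS%:R * bet / mu0) = M * kS%:R / (4 * (M + 1) * kS.+1%:R + mu0).
    rewrite /bet; set X := _ + mu0; have X0 : 0 < X by rewrite addr_gt0.
    by field; rewrite !gt_eqF.
  have b2 : M * kS%:R / (4 * (M + 1) * kS.+1%:R + mu0) <= 1 / 4.
    rewrite ler_pdivrMr ?addr_gt0 //.
    have mk : M * kS%:R <= (M + 1) * kS.+1%:R by apply: ler_pM => //; rewrite ?lerDl ?ler_nat.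
    by move: mk mu0_gt0; lra.
  apply: (@le_lt_trans _ _ (4 * (1 / 8) + 1 / 4)); last by lra.
  by apply: lerD => //; apply: ler_wpM2l.
have c4_large : (Q ^ 2)%:R * (16 / (al ^+ 2 * c4)) <= 1 / 2.
  have -> : (Q ^ 2)%:R * (16 / (al ^+ 2 * c4)) = (Q ^ 2)%:R / (2 * ((Q ^ 2)%:R + 1)).
    have Q1' : 0 < Q%:R ^+ 2 + 1 :> R by rewrite -natrX.
    by rewrite /c4; field; rewrite !gt_eqF.
  by rewrite ler_pdivrMr ?mulr_gt0 //; lra.
have lam_small : (Q ^ 2)%:R * lam <= del.
  by rewrite /lam mulrA ler_pdivrMr // mulrC ler_wpM2l ?(ltW del_gt0) // lerDl.
have [F FF le] := @single_graph R S Fam Q n G k1 k2 kS kT m1 m2 t A1 A2 PS PT eps al al kap th bet lam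
  c0 c1 c2 c4 _ _ _ _ _ Fam_le m1_gt0 m2_gt0 isT m12 n_large ramsey A21 PSA2 PSpos PTS st1 st2 st3 st4 st5 st6
  al_gt0 al_gt0 kap_gt0 th_gt0 bet01 lam_gt0 c0_gt0 c1_gt0 c2_gt0 c4_gt0 al_small kap_small
  budget1 budget2 budget3 c4_large lam_small far.
exists F => //; apply: le_trans le; rewrite ler_wpM2r ?exprn_ge0 //.
rewrite -/del -[leRHS]invrK lef_pV2 ?posrE ?ltr0n ?invr_gt0 //.
apply: ltW; apply: (lt_le_trans (archi_boundP _)); first by rewrite invr_ge0 ltW.
by rewrite ler_nat.
Qed.

End Constants.

Theorem theorem6p1 (R : realType) (S : finType) (hS : (2 <= #|S|)%N)
    (Fam : seq (anyograph S)) (eps : R) (heps : 0 < eps) :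
  exists2 delta : R, 0 < delta &
    forall (n : nat) (G : ograph S n), ofar eps Fam G ->
      exists2 F : anyograph S, F \in Fam &
        delta * n%:R ^+ tag F <= #|copies F G|%:R.
Proof.
have radius (a b c d e : nat) : [/\ (b <= a + b + c + d + e * 4)%N, (c <= a + b + c + d + e * 4)%N,
    (d <= a + b + c + d + e * 4)%N, (e <= a + b + c + d + e * 4)%N &
    (e * 4 <= a + b + c + d + e * 4)%N] by split; lia.
have S_gt0 : (0 < #|S|)%N by apply: leq_trans hS.
suff [r Hr] : exists r, forall n (G : ograph S n), many_copies Fam eps G r.
  by exists (r.+1%:R)^-1; [rewrite invr_gt0 ltr0n|exact: Hr].
have [m0 [e1 [m0_gt0 e1_gt0 H1]]] := parameters Fam S_gt0 heps.
pose refines n k k' (P : 'I_n -> 'I_k) (P' : 'I_n -> 'I_k') := measurable_wrt P' P.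
pose stab2 n (G : ograph S n) (ok : forall k, ('I_n -> 'I_k) -> Prop) (e : R) r k (P : 'I_n -> 'I_k) :=
  forall k' (P' : 'I_n -> 'I_k'), (k' <= r)%N -> ok k' P' ->
    energy2 R G P' <= energy2 R G P + e * n%:R ^+ 2.
pose stab1 n k (A : 'I_n -> 'I_k) (ok : nat -> Prop) (e : R) r m :=
  forall m', (m' <= r)%N -> ok m' -> energy1 R A m' <= energy1 R A m + e * n%:R.
have stab2_anti n G ok e r r' k P : (r <= r')%N ->
    stab2 n G ok e r' k P -> stab2 n G ok e r k P.
  by move=> rr st k' P' le; apply: st; apply: leq_trans rr.
have stab1_anti n k A ok e r r' m : (r <= r')%N ->
    stab1 n k A ok e r' m -> stab1 n k A ok e r m.
  by move=> rr st m' le; apply: st; apply: leq_trans rr.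
pose okA1 n : forall k, ('I_n -> 'I_k) -> Prop := fun _ _ => True.
pose okI1 m := (m0 <= m)%N.
pose okA2 n k1 (A1 : 'I_n -> 'I_k1) k (P : 'I_n -> 'I_k) := measurable_wrt P A1.
pose okI2 m1 m := (0 < m)%N /\ (m1 %| m)%N.
pose okS n k2 (A2 : 'I_n -> 'I_k2) m k (P : 'I_n -> 'I_k) :=
  measurable_wrt P A2 /\ measurable_wrt P (pos m).
have mono n (G : ograph S n) r r' := @many_copies_mono R S Fam eps n G r r'.
have stepA1 k1 : exists r, forall n (G : ograph S n) (A1 : 'I_n -> 'I_k1), True ->
    stab2 n G (okA1 n) e1 r k1 A1 -> many_copies Fam eps G r.
  have [e2 [t [e2_gt0 t_gt0 H2]]] := H1 k1.
  pose Y1 n := (ograph S n * ('I_n -> 'I_k1))%type.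
  (* Stability of the earlier choices stays inside the claim, because its radius [r] is found only
     at the innermost level. The claims [Phi2] to [Phi5] extend this one in the same way. *)
  pose Phi1 n (y : Y1 n) r := stab2 n y.1 (okA1 n) e1 r k1 y.2 -> many_copies Fam eps y.1 r.
  have mono1 n (y : Y1 n) r r' : (r <= r')%N -> Phi1 n y r -> Phi1 n y r'.
    by move=> rr H /(stab2_anti _ _ _ _ _ _ _ _ rr) /H; apply: mono.
  have stepI1 m1 : okI1 m1 -> exists r, forall n (y : Y1 n),
      stab1 n k1 y.2 okI1 e2 r m1 -> Phi1 n y r.
    move=> m01; have m1_gt0 := leq_trans m0_gt0 m01; have [e3 e3_gt0 H3] := H2 m1 m01.
    pose Phi2 n (y : Y1 n) r := stab1 n k1 y.2 okI1 e2 r m1 -> Phi1 n y r.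
    have mono2 n (y : Y1 n) r r' : (r <= r')%N -> Phi2 n y r -> Phi2 n y r'.
      by move=> rr H /(stab1_anti _ _ _ _ _ _ _ _ rr) /H; apply: mono1.
    have stepA2 k2 : exists r, forall n (y : Y1 n) (A2 : 'I_n -> 'I_k2), okA2 n k1 y.2 k2 A2 ->
        stab2 n y.1 (okA2 n k1 y.2) e3 r k2 A2 -> Phi2 n y r.
      have [e4 e4_gt0 H4] := H3 k2.
      pose Y2 n := (Y1 n * ('I_n -> 'I_k2))%type.
      pose Phi3 n (y : Y2 n) r := okA2 n k1 y.1.2 k2 y.2 ->
        stab2 n y.1.1 (okA2 n k1 y.1.2) e3 r k2 y.2 -> Phi2 n y.1 r.
      have mono3 n (y : Y2 n) r r' : (r <= r')%N -> Phi3 n y r -> Phi3 n y r'.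
        by move=> rr H ok /(stab2_anti _ _ _ _ _ _ _ _ rr) /(H ok); apply: mono2.
      have stepI2 m2 : okI2 m1 m2 -> exists r, forall n (y : Y2 n),
          stab1 n k2 y.2 (okI2 m1) e4 r m2 -> Phi3 n y r.
        move=> okm2; have [m2_gt0 m12] := okm2; have [e5 e5_gt0 H5] := H4 m2 okm2.
        pose Phi4 n (y : Y2 n) r := stab1 n k2 y.2 (okI2 m1) e4 r m2 -> Phi3 n y r.
        have mono4 n (y : Y2 n) r r' : (r <= r')%N -> Phi4 n y r -> Phi4 n y r'.
          by move=> rr H /(stab1_anti _ _ _ _ _ _ _ _ rr) /H; apply: mono3.
        have stepS kS : exists r, forall n (y : Y2 n) (PS : 'I_n -> 'I_kS),
            okS n k2 y.2 (m2 * t)%N kS PS ->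
            stab2 n y.1.1 (okS n k2 y.2 (m2 * t)%N) e5 r kS PS -> Phi4 n y r.
          have [lam lam_gt0 H6] := H5 kS.
          pose Y3 n := (Y2 n * ('I_n -> 'I_kS))%type.
          pose Phi5 n (y : Y3 n) r := okS n k2 y.1.2 (m2 * t)%N kS y.2 ->
            stab2 n y.1.1.1 (okS n k2 y.1.2 (m2 * t)%N) e5 r kS y.2 -> Phi4 n y.1 r.
          have mono5 n (y : Y3 n) r r' : (r <= r')%N -> Phi5 n y r -> Phi5 n y r'.
            by move=> rr H ok /(stab2_anti _ _ _ _ _ _ _ _ rr) /(H ok); apply: mono4.
          have stepT kT : exists r, forall n (y : Y3 n) (PT : 'I_n -> 'I_kT),
              okA2 n kS y.2 kT PT ->
              stab2 n y.1.1.1 (okA2 n kS y.2) (lam ^+ 2) r kT PT -> Phi5 n y r.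
            (* The radius must reach every later object used in a comparison: [PS], the scales [m2]
               and [m2 * t], [PT], and the fourfold splittings of [PT]. *)
            have [r Hr] := H6 kT; exists (r + kS + m2 + m2 * t + kT * 4)%N.
            move=> n [[[G A1] A2] PS] PT PTS st6 [PSA2 PSpos] st5 st4 A21 st3 st2 st1.
            apply: (@mono n G r); first by rewrite -!addnA leq_addr.
            have [b1 b2 b3 b4 b5] := radius r kS m2 (m2 * t)%N kT.
            apply: (Hr n G A1 A2 PS PT A21 PSA2 PSpos PTS).
            - exact: st1.
            - apply: st2 => //.
              by apply: leq_trans m01 _; apply: dvdn_leq.
            - apply: st3 => //.
              by move=> x y /PSA2 /A21.
            - by apply: st4; [exact: b3|split; [rewrite muln_gt0 m2_gt0|apply: dvdn_mulr]].
            - apply: st5 => //.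
              by split=> x y /PTS; [apply: PSA2|apply: PSpos].
            - move=> k' P' k'4 mP'; apply: st6; first exact: leq_trans b5.
              by move=> x y /mP' /PTS.
          have [r Hr] := @partition_level R S Y3 (lam ^+ 2) Phi5 (exprn_gt0 2 lam_gt0) mono5
            (fun n y => y.1.1.1) (fun n y => okA2 n kS y.2) stepT kS.
          by exists r => n y PS okPS st; apply: (Hr n (y, PS) PS).
        (* The search for [PS] starts from the common refinement of [A2] and the grid of scale
           [m2 * t]. The others start from the preceding partition or scale, and the first ones from
           a single cell and from [m0]. *)
        have [r Hr] := @partition_level R S Y2 e5 Phi4 e5_gt0 mono4
          (fun n y => y.1.1) (fun n y => okS n k2 y.2 (m2 * t)%N) stepS #|{: 'I_k2 * 'I_(m2 * t)}|.
        exists r => n y.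
        have mt_gt0 : (0 < m2 * t)%N by rewrite muln_gt0 m2_gt0.
        apply: (Hr n y (fun x => enum_rank (y.2 x, Ordinal (pos_lt x mt_gt0)))).
        by split=> x x' /enum_rank_inj[].
      have okm1 : okI2 m1 m1 by split.
      have [r Hr] := @interval_level R Y2 e4 Phi3 e4_gt0 mono3 k2 (fun n y => y.2) (okI2 m1) stepI2 m1 okm1.
      by exists r => n y A2; apply: (Hr n (y, A2)).
    have [r Hr] := @partition_level R S Y1 e3 Phi2 e3_gt0 mono2 (fun n y => y.1)
      (fun n y => okA2 n k1 y.2) stepA2 k1.
    by exists r => n y; apply: (Hr n y y.2).
  have [r Hr] := @interval_level R Y1 e2 Phi1 e2_gt0 mono1 k1 (fun n y => y.2) okI1 stepI1 m0 (leqnn m0).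
  by exists r => n G A1 _; apply: (Hr n (G, A1)).
have [r Hr] := @partition_level R S (ograph S) e1 (fun n G r => many_copies Fam eps G r) e1_gt0
  mono (fun n G => G) (fun n G => okA1 n) stepA1 1%N.
by exists r => n G; apply: (Hr n G (fun=> ord0)).
Qed.
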